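(* Let $d\ge 1$, let $S$ be a locally compact subspace of the unit sphere $S_{d-1}$ of $\mathbb{R}^d$ and let $H=\{ye^z: y\in S, z\in\mathbb{R}\}\subset\mathbb{R}^d\setminus\{0\}$. Let $\alpha\ge 0$. (Direct part.) Let $\{(\theta,\xi),P_{y,z}\}$ be a Markov additive process (MAP) in $S\times\mathbb{R}$ with lifetime $\zeta_p$ and absorbing state $\delta$. Define the process $X$ by \[X_t=\begin{cases}\theta_{\tau_t}e^{\xi_{\tau_t}}, & \text{if } t<\int_0^{\zeta_p}\exp(\alpha\xi_s)\,ds,\\ 0, & \text{if } t\ge\int_0^{\zeta_p}\exp(\alpha\xi_s)\,ds,\end{cases}\] where $\tau_t=\inf\{s:\int_0^s e^{\alpha\xi_u}\,du>t\}$ for $t<\int_0^{\zeta_p}e^{\alpha\xi_s}\,ds$. Define the probability measures $\mathbb{P}_x=P_{x/\|x\|,\log\|x\|}$ for $x\in H$ and $\mathbb{P}_0=P_\delta$. Then $\{X,\mathbb{P}_x\}$ is an $H$-valued self-similar Markov process (ssMp) with index $\alpha$ and lifetime $\int_0^{\zeta_p}\exp(\alpha\xi_s)\,ds$. (Converse part.) Let $\{X,\mathbb{P}_x\}$ be an $H$-valued ssMp with index $\alpha\ge0$ and denote by $\zeta_c$ its lifetime. Define the process $(\theta,\xi)$ by \[\xi_t=\log\|X_{A_t}\|\ \text{ and }\ \theta_t=\frac{X_{A_t}}{\|X_{A_t}\|}\quad\text{if } t<\int_0^{\zeta_c}\frac{ds}{\|X_s\|^\alpha},\qquad (\theta_t,\xi_t)=\delta\quad\text{if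 } t\ge\int_0^{\zeta_c}\frac{ds}{\|X_s\|^\alpha},\] where $\delta$ is some extra state and $A_t=\inf\{s:\int_0^s\frac{du}{\|X_u\|^\alpha}>t\}$ for $t<\int_0^{\zeta_c}\frac{ds}{\|X_s\|^\alpha}$. Define the probability measures $P_{y,z}:=\mathbb{P}_{ye^z}$ for $y\in S$, $z\in\mathbb{R}$, and $P_\delta=\mathbb{P}_0$. Then $\{(\theta,\xi),P_{y,z}\}$ is a MAP in $S\times\mathbb{R}$ with lifetime $\int_0^{\zeta_c}\frac{ds}{\|X_s\|^\alpha}$.
   Context: $\|\cdot\|$ is the Euclidean norm; $S_0=\{-1,+1\}$. Markov processes: an ''$E$-valued Markov process absorbed at $\delta$'', denoted $\{Z,P_x\}$, is a standard Markov process with a reference measure, i.e.: $E$ is a locally compact space with countable base, $\delta$ is an isolated extra state, $E_\delta=E\cup\{\delta\}$ with its Borel $\sigma$-field; $Z=(Z_t)_{t\ge0}$ is a strong Markov process with values in $E_\delta$ on a completed filtered probability space $(\Omega,\mathcal{F},(\mathcal{F}_t)_{t\ge0},(P_x)_{x\in E_\delta})$ with $P_x(Z_0=x)=1$; $\delta$ is absorbing, $Z_t=\delta$ for all $t\ge\zeta(Z):=\inf\{t:Z_t=\delta\}$ (the lifetime, possibly infinite); paths are right continuous on $[0,\infty)$, and have left limits and are quasi-left continuous on $[0,\zeta)$; and there is a $\sigma$-finite measure $\mu$ on $E$ (reference measure) such that for each $x\in E$ the potential measure $E_x(\int_0^{\zeta}1_{\{Z_t\in dy\}}dt)$ is equivalent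 to $\mu(dy)$. Absorption may or may not occur with positive probability. ssMp: an $H$-valued ssMp with index $\alpha\ge0$ is an $H$-valued Markov process $\{X,\mathbb{P}_x\}$ absorbed at $0$ (the point $0$ plays the role of the isolated extra state) such that for all $a>0$ and $x\in H$, the law of $X$ under $\mathbb{P}_x$ equals the law of $(aX_{a^{-\alpha}t},\,t\ge0)$ under $\mathbb{P}_{a^{-1}x}$. MAP: a MAP $\{(\theta,\xi),P_{y,z}\}$ in $S\times\mathbb{R}$ is an $S\times\mathbb{R}$-valued Markov process absorbed at an extra state $\delta$, with lifetime $\zeta_p$, such that for any $y\in S$, $z\in\mathbb{R}$, $s,t\ge0$ and any positive measurable $f$ on $S\times\mathbb{R}$, \[E_{y,z}\big(f(\theta_{t+s},\xi_{t+s}-\xi_t),\,t+s<\zeta_p\,\big|\,\mathcal{F}_t\big)=E_{\theta_t,0}\big(f(\theta_s,\xi_s),\,s<\zeta_p\big)1_{\{t<\zeta_p\}}.\] *)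

(* Defs.v *)
From HB Require Import structures.
From mathcomp Require Import all_boot all_order all_algebra.
From mathcomp Require Import all_classical all_reals all_analysis.
From mathcomp Require Import measurable_realfun.

Set Implicit Arguments.
Unset Strict Implicit.
Unset Printing Implicit Defensive.

Import Order.TTheory GRing.Theory Num.Theory.
Import numFieldNormedType.Exports.

Local Open Scope classical_set_scope.
Local Open Scope ring_scope.

(* The state space with its extra state: [None] is the isolated absorbing
   state, so the topology is that of the disjoint union of [E] and a point
   (not the one-point compactification). The sigma-field is Borel. *)
Definition absorbed (E : Type) : Type := option E.

Section absorbed_structure.
Context {E : topologicalType}.

HB.instance Definition _ := Choice.on (absorbed E).
HB.instance Definition _ := Pointed.on (absorbed E).

Let op : set_system (absorbed E) :=
  [set U | open ((fun x => Some x : absorbed E) @^-1` U)].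

Let opT : op setT. Proof. exact: openT. Qed.

Let opI : setI_closed op. Proof. by move=> A B; exact: openI. Qed.

Let op_bigU (I : Type) (f : I -> set (absorbed E)) :
  (forall i, op (f i)) -> op (\bigcup_i f i).
Proof.
move=> fop; rewrite /op /= preimage_bigcup.
by apply: bigcup_open => i _; exact: fop.
Qed.

HB.instance Definition _ :=
  isOpenTopological.Build (absorbed E) opT opI op_bigU.

HB.instance Definition _ :=
  @isMeasurable.Build (sigma_display (@open (absorbed E))) (absorbed E)
    <<s (@open (absorbed E)) >> (@sigma_algebra0 _ setT _)
    (@sigma_algebraC (absorbed E) _) (@sigma_algebra_bigcup _ setT _).

End absorbed_structure.

Section markov.
Context {R : realType} {E : topologicalType}.
Context {disp : measure_display} {Omega : measurableType disp}.

(* A process is a function on [R], of which only the restriction to [0, +oo[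
   is meaningful. *)
Implicit Types (Z : R -> Omega -> absorbed E).
Implicit Types (P : absorbed E -> probability Omega R).
Implicit Types (F : R -> set (set Omega)).

Definition lifetime Z (w : Omega) : \bar R :=
  ereal_inf [set t%:E | t in [set t : R | 0 <= t /\ Z t w = None]].

Definition alive Z (w : Omega) : set R :=
  [set t | 0 <= t /\ (t%:E < lifetime Z w)%E].

(* Closure under modification on sets that are null for P^mu := \int P_x mu(dx)
   for every initial law mu. That N is P^mu-null is written: P_x(N) = 0 for
   mu-almost every x; this does not need x |-> P_x(N) to be Borel. *)
Definition complete_wrt P (G : set (set Omega)) : Prop :=
  forall A, (forall mu : probability (absorbed E) R, exists B N,
    [/\ G B, measurable N, A `+` B `<=` N &
        {ae mu, forall x, P x N = 0%E}]) -> G A.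

Record filtration P F : Prop := {
  filtration_sigma : forall t, 0 <= t -> sigma_algebra setT (F t);
  filtration_sub : forall t, 0 <= t -> F t `<=` measurable;
  filtration_mono : forall s t, 0 <= s -> s <= t -> F s `<=` F t;
  filtration_right_cont :
    forall t, 0 <= t -> \bigcap_(u in [set u | t < u]) F u `<=` F t;
  filtration_complete_top : complete_wrt P measurable;
  filtration_complete : forall t, 0 <= t -> complete_wrt P (F t) }.

Definition stopping_time F (T : Omega -> \bar R) : Prop :=
  (forall w, (0 <= T w)%E) /\
  (forall t, 0 <= t -> F t [set w | (T w <= t%:E)%E]).

Definition stopped_sigma F (T : Omega -> \bar R) : set (set Omega) :=
  [set A | measurable A /\
    forall t, 0 <= t -> F t (A `&` [set w | (T w <= t%:E)%E])].

(* [Y] is a version of the conditional expectation of the nonnegative [X]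
   given the sub-sigma-algebra [G]. *)
Definition is_cond_exp (Q : probability Omega R) (G : set (set Omega))
    (X Y : Omega -> \bar R) : Prop :=
  (forall C : set (\bar R), measurable C -> G (Y @^-1` C)) /\
  (forall A, G A -> (\int[Q]_(w in A) Y w = \int[Q]_(w in A) X w)%E).

Definition strong_markov P F Z : Prop :=
  forall (x : absorbed E) (T : Omega -> \bar R) (s : R)
    (f : absorbed E -> \bar R),
    stopping_time F T -> 0 <= s -> measurable_fun setT f ->
    (forall p, (0 <= f p)%E) ->
    is_cond_exp (P x) (stopped_sigma F T)
      (fun w => if (T w < +oo)%E then f (Z (fine (T w) + s) w) else 0%E)
      (fun w => if (T w < +oo)%E then
         (\int[P (Z (fine (T w)) w)]_w' f (Z s w'))%E else 0%E).

Definition quasi_left_continuous P F Z : Prop :=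
  forall (x : absorbed E) (T : nat -> Omega -> \bar R),
    (forall n, stopping_time F (T n)) ->
    (forall n w, (T n w <= T n.+1 w)%E) ->
    let Tlim w := ereal_sup (range (T ^~ w)) in
    {ae P x, forall w, (Tlim w < lifetime Z w)%E ->
      Z (fine (T n w)) w @[n --> \oo] --> Z (fine (Tlim w)) w}.

Definition potential (Q : probability Omega R) Z
    (B : set (absorbed E)) : \bar R :=
  (\int[Q]_w \int[lebesgue_measure]_(t in alive Z w)
     (\1_B (Z t w))%:E)%E.

(* A standard Markov process with a reference measure, in the sense of
   Blumenthal and Getoor (so the filtration is right continuous and complete);
   the filtration is explicit. The reference measure is
   a measure on [absorbed E], but the equivalence forces it to be carried by
   [E] as soon as [E] is nonempty. *)
Record markov_process P F Z : Prop := {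
  mp_hausdorff : hausdorff_space E;
  mp_locally_compact : locally_compact [set: E];
  mp_second_countable : @second_countable E;
  mp_filtration : filtration P F;
  mp_adapted : forall t B, 0 <= t -> measurable B -> F t (Z t @^-1` B);
  mp_kernel : forall t B, 0 <= t -> measurable B ->
    measurable_fun setT (fun x => P x (Z t @^-1` B));
  mp_start : forall x, P x [set w | Z 0 w = x] = 1%E;
  mp_absorbing : forall w t, 0 <= t -> (lifetime Z w <= t%:E)%E ->
    Z t w = None;
  mp_right_cont : forall w t, 0 <= t -> Z u w @[u --> t^'+] --> Z t w;
  mp_left_lim : forall w t, 0 < t -> (t%:E < lifetime Z w)%E ->
    exists l : E, Z u w @[u --> t^'-] --> (Some l : absorbed E);
  mp_strong_markov : strong_markov P F Z;
  mp_quasi_left_cont : quasi_left_continuous P F Z;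
  mp_reference : exists2 mu : {measure set (absorbed E) -> \bar R},
    sigma_finite setT mu &
    forall x : E, potential (P (Some x)) Z `<< mu /\
                  mu `<< potential (P (Some x)) Z }.

(* Product sigma-field on the paths indexed by [0, +oo[. *)
Definition path_sigma : set (set (R -> absorbed E)) :=
  <<s [set C | exists t B,
         [/\ 0 <= t, measurable B & C = [set p | B (p t)]] ]>>.

Definition same_law (Q1 : probability Omega R) Z1
    (Q2 : probability Omega R) Z2 : Prop :=
  forall C, path_sigma C ->
    Q1 [set w | C (Z1 ^~ w)] = Q2 [set w | C (Z2 ^~ w)].

(* For a rate function [g] of the state: \int_0^s g(Z_u) du and
   \int_0^zeta g(Z_u) du, and the right-continuous inverse of the former. The
   values of [g] at the extra state are irrelevant to the inverse at times
   below the total. *)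
Definition clock (g : absorbed E -> R) Z (s : R) (w : Omega) : \bar R :=
  (\int[lebesgue_measure]_(u in `[0%R, s]) (g (Z u w))%:E)%E.

Definition total_clock (g : absorbed E -> R) Z (w : Omega) : \bar R :=
  (\int[lebesgue_measure]_(u in alive Z w) (g (Z u w))%:E)%E.

Definition inverse_clock (g : absorbed E -> R) Z (t : R) (w : Omega) : R :=
  inf [set s : R | 0 <= s /\ (t%:E < clock g Z s w)%E].

End markov.

Section cone.
Context {R : realType} {d : nat}.

(* The library norm on row vectors is the sup norm. *)
Definition enorm (x : 'rV[R]_d) : R := Num.sqrt (\sum_i x 0 i ^+ 2).

Definition sphere : set 'rV[R]_d := [set x | enorm x = 1].

Definition cone (S : set 'rV[R]_d) : set 'rV[R]_d :=
  [set x | exists y z, S y /\ x = expR z *: y].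

(* [cone S] and [S] are used as types, with the subspace topology. Since [0] is
   not in [cone S], [vec] identifies [absorbed (cone S)] with [cone S] plus the
   origin, and [state S] is the inverse identification. *)
Definition vec (S : set 'rV[R]_d) (p : absorbed (cone S)) : 'rV[R]_d :=
  if p is Some x then \val x else 0.

Definition state (S : set 'rV[R]_d) (v : 'rV[R]_d) : absorbed (cone S) :=
  insub v.

(* (y, z) |-> y e^z and x |-> (x / |x|, log |x|), with the extra states
   corresponding to each other. *)
Definition to_cone (S : set 'rV[R]_d) (p : absorbed (S * R)%type) :
    absorbed (cone S) :=
  if p is Some (y, z) then state S (expR z *: \val y) else None.

Definition to_polar (S : set 'rV[R]_d) (p : absorbed (cone S)) :
    absorbed (S * R)%type :=
  if p is Some x then
    omap (fun y : S => (y, ln (enorm (\val x))))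
      (insub ((enorm (\val x))^-1 *: \val x))
  else None.

Context {disp : measure_display} {Omega : measurableType disp}.

Record ssMp (S : set 'rV[R]_d) (alpha : R)
    (P : absorbed (cone S) -> probability Omega R)
    (F : R -> set (set Omega)) (X : R -> Omega -> absorbed (cone S)) : Prop := {
  ssMp_markov : markov_process P F X;
  ssMp_scaling : forall (a : R) (x : cone S), 0 < a ->
    same_law (P (Some x)) X
      (P (state S (a^-1 *: \val x)))
      (fun t w => state S (a *: vec (X (a `^ (- alpha) * t) w))) }.

(* The events t + s < zeta and t < zeta are expressed by the process not being
   in the extra state. *)
Definition additive_property (S : set 'rV[R]_d)
    (P : absorbed (S * R)%type -> probability Omega R)
    (F : R -> set (set Omega)) (Z : R -> Omega -> absorbed (S * R)%type) : Prop :=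
  forall (y : S) (z s t : R) (f : S * R -> \bar R),
    0 <= s -> 0 <= t ->
    (forall p, (0 <= f p)%E) ->
    (forall C : set (\bar R), measurable C ->
       <<s (@open (S * R)%type) >> (f @^-1` C)) ->
    is_cond_exp (P (Some (y, z))) (F t)
      (fun w => match Z (t + s) w, Z t w with
         | Some (y2, z2), Some (_, z1) => f (y2, z2 - z1)
         | _, _ => 0%E
         end)
      (fun w => match Z t w with
         | Some (y1, _) => (\int[P (Some (y1, 0%R))]_w'
             (if Z s w' is Some p then f p else 0))%E
         | None => 0%E
         end).

Record MAP (S : set 'rV[R]_d)
    (P : absorbed (S * R)%type -> probability Omega R)
    (F : R -> set (set Omega)) (Z : R -> Omega -> absorbed (S * R)%type) : Prop := {
  MAP_markov : markov_process P F Z;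
  MAP_additive : additive_property P F Z }.

Definition exp_rate (S : set 'rV[R]_d) (alpha : R)
    (p : absorbed (S * R)%type) : R :=
  if p is Some (_, z) then expR (alpha * z) else 0.

Definition norm_rate (S : set 'rV[R]_d) (alpha : R)
    (p : absorbed (cone S)) : R :=
  if p is Some x then (enorm (\val x) `^ alpha)^-1 else 0.

Definition ssMp_of_MAP (S : set 'rV[R]_d) (alpha : R)
    (Z : R -> Omega -> absorbed (S * R)%type) (t : R) (w : Omega) :
    absorbed (cone S) :=
  let g := exp_rate alpha in
  if (t%:E < total_clock g Z w)%E then to_cone (Z (inverse_clock g Z t w) w)
  else None.

Definition MAP_of_ssMp (S : set 'rV[R]_d) (alpha : R)
    (X : R -> Omega -> absorbed (cone S)) (t : R) (w : Omega) :
    absorbed (S * R)%type :=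
  let g := norm_rate alpha in
  if (t%:E < total_clock g X w)%E then to_polar (X (inverse_clock g X t w) w)
  else None.

End cone.

(* Main.v *)
(* In polar coordinates x = y e^z the norm rate with index alpha is the
   exponential rate with index - alpha, so both constructions are a time change
   of a process in S * R by the inverse of t |-> \int_0^t g(Z_u) du with g
   continuous and positive, composed with the homeomorphism between S * R and
   the cone.

   Such a time change preserves standard Markov processes for any g: if tau_t
   is the inverse clock, the new filtration is F_(tau_t), and for a stopping
   time T of this filtration tau_T is a stopping time of F, since
   {tau_T < r} is the union over rational q of {T <= q} and {tau_q < r}. The
   strong Markov property of the time-changed process is then that of Z at
   tau_T, applied to a functional of the whole path. Substituting t for the
   clock shows that the two potential measures have the same null sets, so a
   reference measure is kept.

   The additive property amounts to the invariance of the transition function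
   under shifts (y, z) |-> (y, z + c) of the level. By the Markov property this
   extends to the law of paths, and a level shift commutes with the time change
   up to the factor e^(alpha c) in time, which is the scaling property. *)

Require Import Defs.
From HB Require Import structures.
From mathcomp Require Import all_boot all_order all_algebra.
From mathcomp Require Import all_classical all_reals all_analysis.
From mathcomp Require Import measurable_realfun.
From mathcomp Require Import ring lra.

Set Implicit Arguments.
Unset Strict Implicit.
Unset Printing Implicit Defensive.

Import Order.TTheory GRing.Theory Num.Theory.
Import numFieldNormedType.Exports.

Local Open Scope classical_set_scope.
Local Open Scope ring_scope.

(** * The state space with its extra state *)

(** The strong Markov property in [markov_process] looks at one later time [s], and [Omega] carries
    no shift operators, whereas an inverse clock depends on a whole stretch of trajectory. Hence the
    detour through [paths], a concrete space of trajectories with shifts, to which the Markov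
    property is extended by an induction on cylinders. The regularity of trajectories is assumed for
    every [w], so clocks, inverses and time changes are studied path by path, and no exceptional set
    appears there. Left limits in [E] before the lifetime are what makes the clock work: they keep
    the continuous rate bounded on each compact time interval on which the path is alive, so that
    the clock is finite and Lipschitz there. [E] comes without a metric, so measurability of limits
    rests on a countable base that is regular because [E] is locally compact and Hausdorff. The
    additive property subtracts the random level at time [t]; this needs shifts that are jointly
    continuous in the amount and the point, so as to be evaluated at a random amount. *)

Section absorbed_topology.
Context {E : topologicalType}.
Implicit Types (U A : set (absorbed E)) (x : E).

Lemma open_absorbedE U : open U = open ((Some : E -> absorbed E) @^-1` U).
Proof. by []. Qed.

Lemma nbhs_SomeE x A :
  nbhs (Some x : absorbed E) A <-> nbhs x ((Some : E -> absorbed E) @^-1` A).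
Proof.
rewrite !nbhsE /=; split=> -[B [oB Bx] BA].
  by exists (Some @^-1` B); [split|move=> y; exact: BA].
exists (Some @` B); last by move=> _ [y By <-]; exact: BA.
split; last by exists x.
rewrite open_absorbedE (_ : _ @^-1` _ = B)//; apply/seteqP; split => y /=.
  by move=> [z Bz [<-]].
by exists y.
Qed.

Lemma nbhs_NoneE A : nbhs (None : absorbed E) A <-> A None.
Proof.
split; first exact: nbhs_singleton.
rewrite nbhsE => AN; exists [set None]; last by move=> _ ->.
split=> //; rewrite open_absorbedE (_ : _ @^-1` _ = set0); first exact: open0.
by apply/seteqP; split.
Qed.

Lemma continuous_absorbed {T : topologicalType} (f : absorbed E -> T) :
  continuous (fun x : E => f (Some x)) -> continuous f.
Proof.
move=> cf [x|] A; rewrite nbhs_simpl.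
  by move=> /cf h; apply/nbhs_SomeE.
by move=> /nbhs_singleton h; apply/nbhs_NoneE.
Qed.

Lemma measurable_openW U : open U -> measurable U.
Proof. exact: sub_sigma_algebra. Qed.

Lemma measurable_Some (B : set (absorbed E)) :
  measurable B -> <<s (@open E) >> ((Some : E -> absorbed E) @^-1` B).
Proof.
move: B; apply: smallest_sub; last by move=> U oU; exact: sub_sigma_algebra.
split => [|A|A h].
- by rewrite /= preimage_set0; exact: sigma_algebra0.
- by rewrite /= !setTD preimage_setC => h; rewrite -setTD; exact: sigma_algebraCD.
- by rewrite /= preimage_bigcup; exact: sigma_algebra_bigcup.
Qed.

(** Converse of [measurable_Some]. Whether [B] contains [None] is immaterial because [[set None]] is
    open; in the induction the image of a complement is taken inside [range Some], itself open. *)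
Lemma measurable_absorbedP (B : set (absorbed E)) :
  <<s (@open E) >> ((Some : E -> absorbed E) @^-1` B) -> measurable B.
Proof.
have main (C : set E) : <<s (@open E) >> C -> measurable ((Some : E -> absorbed E) @` C).
  move: C; apply: smallest_sub.
    have mS : measurable (range (Some : E -> absorbed E)).
      apply: measurable_openW; rewrite open_absorbedE.
      rewrite (_ : _ @^-1` _ = setT); first exact: openT.
      by apply/seteqP; split => // x _; exists x.
    split => [|A mA|A mA] /=.
    - by rewrite image_set0.
    - rewrite (_ : _ @` _ = range Some `\` (Some @` A)); first exact: measurableD.
      apply/seteqP; split=> [_ [y [_ nA] <-]|_ [[y _ <-] h]].
        by split; [exists y|move=> [z Az [zy]]; apply: nA; rewrite -zy].
      by exists y => //; split => // Ay; apply: h; exists y.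
    - by rewrite image_bigcup; exact: bigcupT_measurable.
  move=> A oA /=; apply: measurable_openW.
  rewrite open_absorbedE (_ : _ @^-1` _ = A)//; apply/seteqP; split => y /=.
    by move=> [z Bz [<-]].
  by exists y.
move=> /main mB.
have -> : B = Some @` (Some @^-1` B) `|` (B `&` [set None]).
  apply/seteqP; split=> [[x|] Bx|x].
  - by left; exists x.
  - by right.
  - by move=> [[y By <-]|[]].
apply: measurableU => //; have [BN|BN] := pselect (B None).
  rewrite (_ : _ `&` _ = [set None]).
    apply: measurable_openW; rewrite open_absorbedE (_ : _ @^-1` _ = set0).
      exact: open0.
    by apply/seteqP; split.
  by apply/seteqP; split=> [x []//|x ->].
rewrite (_ : _ `&` _ = set0)//; apply/seteqP; split => // x [+ xN].
by rewrite xN.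
Qed.

Lemma measurable_fun_absorbed d (T : measurableType d) (f : T -> absorbed E) :
  (forall U, open U -> measurable (f @^-1` U)) -> measurable_fun setT f.
Proof.
move=> mf; apply: (@measurability _ _ _ _ setT f (@open (absorbed E))) => //.
by move=> _ [U oU <-]; rewrite setTI; exact: mf.
Qed.

Lemma continuous_measurable_absorbed {R : realType} (f : absorbed E -> R) :
  continuous f -> measurable_fun setT f.
Proof.
move=> cf; apply: (measurability _ (RGenOpens.measurableE R)).
move=> _ [_ [x [y ->]] <-]; rewrite setTI; apply: measurable_openW.
by move/continuousP : cf; apply; exact: interval_open.
Qed.

End absorbed_topology.

Section regular_base.
Context {E : topologicalType}.
Hypotheses (hausE : hausdorff_space E) (lcE : locally_compact [set: E])
  (scE : @second_countable E).

Lemma locally_compact_hausdorff_regular : regular_space E.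
Proof.
move=> x; have [U] := lcE (I : [set: E] x).
rewrite withinET => Ux [cU _]; exact: (compact_regular hausE cU).
Qed.

Lemma closure_image_Some (W : set E) :
  closure ((Some : E -> absorbed E) @` W) `<=` Some @` closure W.
Proof.
move=> [x|] clx.
  exists x => // A Ax; have [|_ [[y Wy <-] [z Az [zy]]]] := clx (Some @` A).
    by apply/nbhs_SomeE; apply: filterS Ax => y Ay; exists y.
  by exists y; split => //; rewrite -zy.
by have [|_ [[y _ <-]]] := clx [set None]; first exact/nbhs_NoneE.
Qed.

(** A substitute for a countable family of balls. On [E] it comes from regularity and second
    countability; the isolated point [None] gets the index [0] and a singleton of its own. *)
Lemma absorbed_regular_base : exists V : nat -> set (absorbed E),
  (forall n, open (V n)) /\
  forall U x, open U -> U x -> exists n, V n x /\ closure (V n) `<=` U.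
Proof.
have [B cB [Bo Bb]] := scE; have [f fi] := countable_injP _ cB.
(* As [f] is injective on [B], [W n] is the base set coded by [n], or empty if there is none; this
   turns the countable base into a sequence. *)
pose W n : set E := \bigcup_(U in [set U | B U /\ f U = n]) U.
pose V n : set (absorbed E) := if n is n'.+1 then Some @` W n' else [set None].
exists V; split => [[|n] /=|U [x|] oU Ux].
- rewrite open_absorbedE (_ : _ @^-1` _ = set0); first exact: open0.
  by apply/seteqP; split.
- rewrite open_absorbedE (_ : _ @^-1` _ = W n).
    by apply: bigcup_open => A [BA _]; exact: Bo.
  apply/seteqP; split => y /=; first by move=> [z Wz [<-]].
  by move=> Wy; exists y.
- have [|A Ax clA] := @locally_compact_hausdorff_regular x (Some @^-1` U).
    by apply/nbhs_SomeE; exact: open_nbhs_nbhs.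
  have [C [BC Cx] CA] := Bb x A Ax.
  have WC : W (f C) = C.
    apply/seteqP; split=> [y [D [BD fDC] Dy]|y Cy]; last by exists C.
    by rewrite -(fi D C _ _ fDC) ?inE.
  exists (f C).+1; rewrite /= WC; split; first by exists x.
  move=> _ /closure_image_Some[y Cy <-].
  by apply: clA; exact: (closureS CA).
- exists 0%N; split => // -[y|] cly //.
  have [|z [zN [t _ tz]]] := cly (range Some); last by move: zN; rewrite -tz.
  by apply/nbhs_SomeE; apply: filterE => z; exists z.
Qed.

(* Without a metric: [f w] is in [U] iff for some [V] of a countable base with
   [closure V] in [U], [h n w] is in [V] for all large [n]. *)
Lemma measurable_fun_cvg_absorbed d (T : measurableType d)
    (h : nat -> T -> absorbed E) (f : T -> absorbed E) :
  (forall n, measurable_fun setT (h n)) ->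
  (forall w, h n w @[n --> \oo] --> f w) -> measurable_fun setT f.
Proof.
move=> mh hf; apply: measurable_fun_absorbed => U oU.
have [V [oV VU]] := absorbed_regular_base.
rewrite (_ : f @^-1` U = \bigcup_(k in [set k | closure (V k) `<=` U])
  \bigcup_N \bigcap_(n in [set n | (N <= n)%N]) (h n @^-1` V k)).
  apply: bigcup_measurable => k _; apply: bigcupT_measurable => N.
  apply: bigcap_measurable => [|n _]; first by exists N => /=.
  by rewrite -[X in measurable X]setTI; apply: mh => //; exact: measurable_openW.
apply/seteqP; split=> [w Uw|w [k kU [N _ Nh]]] /=.
  have [k [Vk kU]] := VU _ _ oU Uw; exists k => //.
  have [|N _ NV] := hf w (V k); first exact: open_nbhs_nbhs.
  by exists N => // n /= /NV.
apply: kU => A Aw; have [N' _ N'A] := hf w _ Aw.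
exists (h (maxn N N') w); split; first by apply: Nh => /=; exact: leq_maxl.
by apply: N'A => /=; exact: leq_maxr.
Qed.

End regular_base.

(** * Joint measurability of right continuous processes *)

Section right_continuous_measurable.
Context {R : realType} {E : topologicalType}.
Hypotheses (hausE : hausdorff_space E) (lcE : locally_compact [set: E])
  (scE : @second_countable E).

Lemma near_at_rightP (u : R) (A : set R) :
  (\forall y \near u^'+, A y) <->
  exists2 e, 0 < e & forall y, u < y -> y < u + e -> A y.
Proof.
split=> [/nbhs_ballP[e /= e0 h]|[e e0 h]].
  exists e => // y uy ye; apply: h => //.
  by rewrite /ball /= ltr_distlC; apply/andP; split=> //; lra.
near=> y; apply: h; near: y; first exact: nbhs_right_gt.
by apply: nbhs_right_lt; rewrite ltrDl.
Unshelve. all: by end_near. Qed.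

Lemma near_at_leftP (u : R) (A : set R) :
  (\forall y \near u^'-, A y) <->
  exists2 e, 0 < e & forall y, u - e < y -> y < u -> A y.
Proof.
split=> [/nbhs_ballP[e /= e0 h]|[e e0 h]].
  exists e => // y uy ye; apply: h => //.
  by rewrite /ball /= ltr_distlC; apply/andP; split=> //; lra.
near=> y; apply: h; near: y; last exact: nbhs_left_lt.
by apply: nbhs_left_gt; rewrite ltrBlDr ltrDl.
Unshelve. all: by end_near. Qed.

(** The mesh is [1/(n+1)]. The choice [floor + 1], even when [u] is itself a grid point, keeps the
    value strictly to the right of [u], as the punctured filter [u^'+] demands. *)
Lemma cvg_at_right_upper_dyadic (u : R) :
  ((Num.floor (u * n.+1%:R))%:~R + 1) / n.+1%:R @[n --> \oo] --> u^'+.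
Proof.
move=> A /near_at_rightP[e e0 uA].
have [N _ Ne] := near_infty_natSinv_lt (PosNum e0).
exists N => // n /= Nn.
have n0 : 0 < n.+1%:R :> R by [].
have n1 := Ne _ Nn.
have e1 : 1 < e * n.+1%:R by rewrite -[X in X < _](mulVf (lt0r_neq0 n0)) ltr_pM2r.
have /andP[f1 f2] := floor_itv (u * n.+1%:R).
apply: uA; first by rewrite ltr_pdivlMr//; rewrite intrD in f2.
by rewrite ltr_pdivrMr// mulrDl; exact: ler_ltD.
Qed.

(** [V] is the pointwise limit of the processes that read it at the next grid point. Each of these
    is constant in time on every grid cell, so its preimages are countable unions of measurable
    rectangles. *)
Lemma measurable_fun_right_continuous d (T : measurableType d)
    (V : R -> T -> absorbed E) :
  (forall u, measurable_fun setT (V u)) ->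
  (forall u w, V s w @[s --> u^'+] --> V u w) ->
  measurable_fun setT (fun uw : R * T => V uw.1 uw.2).
Proof.
move=> mV rcV.
pose k n (u : R) : R := ((Num.floor (u * n.+1%:R))%:~R + 1) / n.+1%:R.
apply: (measurable_fun_cvg_absorbed hausE lcE scE
  (h := fun n uw => V (k n uw.1) uw.2)) => [n|[u w] /=].
  move=> _ B mB; rewrite setTI.
  rewrite (_ : _ @^-1` _ = \bigcup_(z in [set: int])
      ([set u : R | Num.floor (u * n.+1%:R) = z] `*`
       (V ((z%:~R + 1) / n.+1%:R) @^-1` B))).
    apply: countable_bigcupT_measurable => // z.
    apply: measurableX; last by rewrite -[X in measurable X]setTI; exact: mV.
    rewrite (_ : [set _ | _] =
      `[z%:~R / n.+1%:R, (z + 1)%:~R / n.+1%:R[%classic); first exact: measurable_itv.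
    apply/seteqP; split => u /=; rewrite in_itv /= ler_pdivrMr// ltr_pdivlMr//.
      by move=> <-; exact: floor_itv.
    by move=> /floor_def.
  apply/seteqP; split => [[u w] /= h|[u w] [z _ /= [<-]]]//.
  by exists (Num.floor (u * n.+1%:R)).
by apply: cvg_comp (rcV u w); exact: cvg_at_right_upper_dyadic.
Qed.

End right_continuous_measurable.

(** * The space of paths and its cylinders *)

Section paths.
Context {R : realType} {E : topologicalType}.

(** These are properties that [markov_process] guarantees for every trajectory. Left limits are
    required only at times where the path is still alive, and they lie in [E], not merely in
    [absorbed E]. *)
Record is_path (p : R -> absorbed E) : Prop := {
  path_right_cont : forall t, 0 <= t -> p u @[u --> t^'+] --> p t;
  path_absorbing : forall s t, 0 <= s -> s <= t -> p s = None -> p t = None;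
  path_left_lim : forall t, 0 < t -> p t <> None ->
    exists l : E, p u @[u --> t^'-] --> (Some l : absorbed E) }.

Lemma is_path_None : is_path (fun=> None).
Proof. by split => // t _; exact: cvg_cst. Qed.

Definition paths : Type := {p : R -> absorbed E | is_path p}.

HB.instance Definition _ := gen_eqMixin paths.
HB.instance Definition _ := gen_choiceMixin paths.
HB.instance Definition _ := isPointed.Build paths (exist _ _ is_path_None).

Definition pcoord (t : R) (p : paths) : absorbed E := sval p t.

Definition coord_events : set (set paths) :=
  [set C | exists t B, [/\ 0 <= t, measurable B & C = pcoord t @^-1` B]].

HB.instance Definition _ :=
  @isMeasurable.Build (sigma_display coord_events) paths
    <<s coord_events >> (@sigma_algebra0 _ setT _)
    (@sigma_algebraC paths _) (@sigma_algebra_bigcup _ setT _).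

Lemma measurable_pcoord t : 0 <= t -> measurable_fun setT (pcoord t).
Proof.
move=> t0 _ B mB; rewrite setTI; apply: sub_sigma_algebra.
by exists t, B.
Qed.

Lemma measurable_fun_paths d (T : measurableType d) (f : T -> paths) :
  (forall t, 0 <= t -> measurable_fun setT (fun x => pcoord t (f x))) ->
  measurable_fun setT f.
Proof.
move=> mf; apply: (measurability coord_events) => //.
by move=> _ [_ [t [B [t0 mB ->]]] <-]; exact: mf.
Qed.

(* The dead path when [p] is not a path. *)
Definition mkpath (p : R -> absorbed E) : paths :=
  if pselect (is_path p) is left h then exist _ p h else point.

Lemma pcoord_mkpath p t : is_path p -> pcoord t (mkpath p) = p t.
Proof. by rewrite /pcoord /mkpath; case: pselect. Qed.

Lemma sval_mkpath p : is_path p -> sval (mkpath p) = p.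
Proof. by rewrite /mkpath; case: pselect. Qed.

Lemma paths_inj (p q : paths) : (forall t, pcoord t p = pcoord t q) -> p = q.
Proof.
case: p q => [p hp] [q hq] pq; have {}pq : p = q by apply/funext => t; exact: pq.
by rewrite -pq in hq *; rewrite (Prop_irrelevance hp hq).
Qed.

Implicit Types p : paths.

Lemma pcoord_cvg p t : 0 <= t -> pcoord u p @[u --> t^'+] --> pcoord t p.
Proof. exact: path_right_cont (svalP p) t. Qed.

Lemma pcoord_absorbing p s t : 0 <= s -> s <= t ->
  pcoord s p = None -> pcoord t p = None.
Proof. exact: path_absorbing (svalP p) s t. Qed.

Lemma pcoord_left_lim p t : 0 < t -> pcoord t p <> None ->
  exists l : E, pcoord u p @[u --> t^'-] --> (Some l : absorbed E).
Proof. exact: path_left_lim (svalP p) t. Qed.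

Lemma cvg_at_right_addl (a t : R) : (a + u) @[u --> t^'+] --> (a + t)^'+.
Proof.
move=> A /near_at_rightP[e e0 h]; apply/near_at_rightP; exists e => // y ty yt.
by apply: h; lra.
Qed.

Lemma cvg_at_left_addl (a t : R) : (a + u) @[u --> t^'-] --> (a + t)^'-.
Proof.
move=> A /near_at_leftP[e e0 h]; apply/near_at_leftP; exists e => // y ty yt.
by apply: h; lra.
Qed.

Lemma is_path_pshift r p : 0 <= r -> is_path (fun t => pcoord (r + t) p).
Proof.
move=> r0; split=> [t t0|s t s0 st|t t0 /pcoord_left_lim[|l pl]].
- apply: (@cvg_comp _ _ _ (fun u => r + u) (pcoord^~ p)).
    exact: cvg_at_right_addl.
  by apply: pcoord_cvg; exact: addr_ge0.
- by apply: pcoord_absorbing; [exact: addr_ge0|rewrite lerD2l].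
- exact: ltr_wpDl.
- exists l; apply: (@cvg_comp _ _ _ (fun u => r + u) (pcoord^~ p)) pl.
  exact: cvg_at_left_addl.
Qed.

Definition pshift (r : R) p : paths := mkpath (fun t => pcoord (r + t) p).

Lemma pcoord_shift r t p : 0 <= r -> pcoord t (pshift r p) = pcoord (r + t) p.
Proof. by move=> r0; rewrite pcoord_mkpath//; exact: is_path_pshift. Qed.

Lemma pshift0 p : pshift 0 p = p.
Proof. by apply: paths_inj => t; rewrite pcoord_shift// add0r. Qed.

Lemma pshiftD r s p : 0 <= r -> 0 <= s -> pshift s (pshift r p) = pshift (r + s) p.
Proof.
move=> r0 s0; apply: paths_inj => t.
by rewrite !pcoord_shift ?addr_ge0// addrA.
Qed.

Lemma measurable_pshift r : 0 <= r -> measurable_fun setT (pshift r).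
Proof.
move=> r0; apply: measurable_fun_paths => t t0.
rewrite (_ : (fun x => _) = pcoord (r + t)).
  by apply: measurable_pcoord; exact: addr_ge0.
by apply/funext => p; rewrite pcoord_shift.
Qed.

(* A cylinder is given by successive time increments, so that the Markov
   property peels it off one increment at a time. *)
Fixpoint cyl (l : seq (R * set (absorbed E))) : set paths :=
  if l is (d, B) :: l' then pcoord d @^-1` B `&` pshift d @^-1` (cyl l')
  else setT.

Fixpoint cyl_ok (l : seq (R * set (absorbed E))) : Prop :=
  if l is (d, B) :: l' then [/\ 0 <= d, measurable B & cyl_ok l'] else True.

Lemma measurable_cyl l : cyl_ok l -> measurable (cyl l).
Proof.
elim: l => [|[d B] l IH] //= [d0 mB /IH ml].
apply: measurableI; rewrite -[X in measurable X]setTI.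
  exact: measurable_pcoord.
exact: measurable_pshift.
Qed.

(** Two sequences of observation times are merged. The shorter first increment [d] is peeled off,
    the other list is rewritten as waiting [d] and then the rest of its first increment, and the
    total length decreases. Cylinders are thus a pi-system, ready for Dynkin's argument and for
    uniqueness of measures. *)
Lemma cylI l1 l2 : cyl_ok l1 -> cyl_ok l2 ->
  exists2 l, cyl_ok l & cyl l = cyl l1 `&` cyl l2.
Proof.
have [n] := ubnP (size l1 + size l2).
elim: n l1 l2 => // n IH [|[d1 B1] l1] [|[d2 B2] l2] sz ok1 ok2.
- by exists [::] => //; rewrite setTI.
- by exists ((d2, B2) :: l2) => //; rewrite setTI.
- by exists ((d1, B1) :: l1) => //; rewrite setIT.
have [d10 mB1 okl1] := ok1; have [d20 mB2 okl2] := ok2.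
have split_cyl d e B (l : seq (R * set (absorbed E))) : 0 <= d -> d <= e ->
    cyl ((e, B) :: l) = pshift d @^-1` cyl ((e - d, B) :: l).
  move=> d0 de; have ed0 : 0 <= e - d by rewrite subr_ge0.
  by apply/seteqP; split => p /=; rewrite pcoord_shift// pshiftD// addrC subrK.
have [d12|/ltW d21] := leP d1 d2.
  have [||| l okl lE] := IH l1 ((d2 - d1, B2) :: l2) => //.
    by split => //; rewrite subr_ge0.
  exists ((d1, B1) :: l) => //.
  by rewrite [cyl (_ :: l)]/= lE (split_cyl d1 d2)// preimage_setI setIA.
have [||| l okl lE] := IH ((d1 - d2, B1) :: l1) l2 => //.
- by rewrite -ltnS (leq_trans _ sz)//= addSn addnS ltnS.
- by split => //; rewrite subr_ge0.
- exists ((d2, B2) :: l) => //.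
  rewrite [cyl (_ :: l)]/= lE (split_cyl d2 d1)// preimage_setI.
  by rewrite setICA -/(cyl ((d2, B2) :: l2)).
Qed.

Lemma measurable_pathsE :
  @measurable _ paths = <<s [set C | exists2 l, cyl_ok l & C = cyl l] >>.
Proof.
apply/seteqP; split.
  apply: smallest_sub; first exact: smallest_sigma_algebra.
  move=> _ [t [B [t0 mB ->]]]; apply: sub_sigma_algebra.
  by exists [:: (t, B)] => //=; rewrite preimage_setT setIT.
apply: smallest_sub; first exact: sigma_algebra_measurable.
by move=> _ [l lok ->]; exact: measurable_cyl.
Qed.

End paths.
Arguments paths : clear implicits.

Section measurable_paths.
Context {R : realType} {E : topologicalType}.
Hypotheses (hausE : hausdorff_space E) (lcE : locally_compact [set: E])
  (scE : @second_countable E).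

Lemma cvg_at_right_maxr (u : R) :
  0 <= u -> Num.max s 0 @[s --> u^'+] --> u^'+.
Proof.
move=> u0 A /near_at_rightP[e e0 h]; apply/near_at_rightP; exists e => // y uy ye.
by rewrite /= max_l; [exact: h|lra].
Qed.

(** Nothing is assumed of [V] at negative times, so time is clamped by [Num.max _ 0]; the clamped
    process is right continuous on the whole line and constant on the negative half. *)
Lemma measurable_fun_right_continuous_pos d (T : measurableType d)
    (V : R -> T -> absorbed E) :
  (forall u, 0 <= u -> measurable_fun setT (V u)) ->
  (forall u w, 0 <= u -> V s w @[s --> u^'+] --> V u w) ->
  measurable_fun setT (fun uw : R * T => V (Num.max uw.1 0) uw.2).
Proof.
move=> mV rcV.
apply: (measurable_fun_right_continuous hausE lcE scE
  (V := fun u w => V (Num.max u 0) w)) => [u|u w].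
  by apply: mV; rewrite le_max lexx orbT.
have [u0|u0] := leP 0 u.
  apply: (@cvg_comp _ _ _ (fun s => Num.max s 0) (V^~ w)) (rcV u w u0).
  exact: cvg_at_right_maxr.
move=> A /nbhs_singleton A0; apply/near_at_rightP; exists (- u).
  by rewrite oppr_gt0.
by move=> y _ yu; rewrite /= max_r//; lra.
Qed.

Lemma measurable_fun_right_continuous_time d (T : measurableType d)
    (V : R -> T -> absorbed E) (S : T -> R) :
  (forall u, 0 <= u -> measurable_fun setT (V u)) ->
  (forall u w, 0 <= u -> V s w @[s --> u^'+] --> V u w) ->
  (forall w, 0 <= S w) -> measurable_fun setT S ->
  measurable_fun setT (fun w => V (S w) w).
Proof.
move=> mV rcV S0 mS.
have mV' := measurable_fun_right_continuous_pos mV rcV.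
rewrite (_ : (fun w => _) = (fun uw : R * T => V (Num.max uw.1 0) uw.2)
   \o (fun w => (S w, w))).
  by apply: measurableT_comp => //; exact: measurable_fun_pair.
by apply/funext => w /=; rewrite max_l.
Qed.

Lemma measurable_pcoord_joint d (T : measurableType d) (S : T -> R)
    (f : T -> paths R E) :
  (forall x, 0 <= S x) -> measurable_fun setT S -> measurable_fun setT f ->
  measurable_fun setT (fun x => pcoord (S x) (f x)).
Proof.
move=> S0 mS mf.
have mc := measurable_fun_right_continuous_pos
  (V := @pcoord R E) (@measurable_pcoord R E) (fun u w => @pcoord_cvg R E w u).
rewrite (_ : (fun x => _) = (fun up => pcoord (Num.max up.1 0) up.2)
   \o (fun x => (S x, f x))).
  by apply: measurableT_comp => //; exact: measurable_fun_pair.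
by apply/funext => x /=; rewrite max_l.
Qed.

Lemma measurable_pshift_joint d (T : measurableType d) (S : T -> R)
    (f : T -> paths R E) :
  (forall x, 0 <= S x) -> measurable_fun setT S -> measurable_fun setT f ->
  measurable_fun setT (fun x => pshift (S x) (f x)).
Proof.
move=> S0 mS mf; apply: measurable_fun_paths => t t0.
rewrite (_ : (fun x => _) = fun x => pcoord (S x + t) (f x)).
  apply: measurable_pcoord_joint => //; first by move=> x; exact: addr_ge0.
  exact: measurable_funD.
by apply/funext => x; rewrite pcoord_shift.
Qed.

End measurable_paths.

(** * Integration against a mixture of measures *)

Section mixture.
Context d1 d2 (X : measurableType d1) (Y : measurableType d2) (R : realType).
Variables (m : {measure set X -> \bar R}) (D : set X) (mD : measurable D).
Variables (k : X -> {measure set Y -> \bar R}) (nu : {measure set Y -> \bar R}).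
Hypothesis mk : forall U, measurable U -> measurable_fun setT (k ^~ U).
Hypothesis nuE : forall U, measurable U ->
  nu U = (\int[m]_(x in D) k x U)%E.
Import HBNNSimple.
Local Open Scope ereal_scope.

Let mixture_nnsfun (h : {nnsfun Y >-> R}) :
  \int[nu]_y (h y)%:E = \int[m]_(x in D) \int[k x]_y (h y)%:E.
Proof.
transitivity (\int[m]_(x in D)
    \sum_(r \in range h) r%:E * k x (h @^-1` [set r])); last first.
  by apply: eq_integral => x _; rewrite integralT_nnsfun sintegralE.
have h0 r x : 0 <= r%:E * k x (h @^-1` [set r]).
  have [r0|r0] := leP 0%R r; first by rewrite mule_ge0.
  by rewrite preimage_nnfun0// measure0 mule0.
rewrite ge0_integral_fsum//; last first.
  move=> r; apply: measurable_funS (measurable_funeM _ (mk _)) => //.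
rewrite integralT_nnsfun sintegralE; apply: eq_fsbigr => r _.
rewrite nuE//; have [r0|r0] := leP 0%R r.
  by rewrite ge0_integralZl// ?lee_fin//; exact: measurable_funS (mk _).
rewrite preimage_nnfun0//.
under eq_integral do rewrite measure0.
under [in RHS]eq_integral do rewrite measure0 mule0.
by rewrite integral0 mule0.
Qed.

(** Passage from sets to functions through simple functions and monotone convergence. Integration
    over a subset [D] is built in because the strong Markov property is used on an event of the
    past. *)
Lemma ge0_integral_mixture (f : Y -> \bar R) :
  (forall y, 0 <= f y) -> measurable_fun setT f ->
  \int[nu]_y f y = \int[m]_(x in D) \int[k x]_y f y.
Proof.
move=> f0 mf; pose f_ := nnsfun_approx measurableT mf.
have cvgf (mu : {measure set Y -> \bar R}) :
    \int[mu]_y f y = limn (fun n => \int[mu]_y (f_ n y)%:E).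
  rewrite -monotone_convergence//.
  - by apply: eq_integral => y _; apply/esym/cvg_lim => //; exact: cvg_nnsfun_approx.
  - by move=> n; exact/measurable_EFinP.
  - by move=> n y _; rewrite lee_fin.
  - by move=> y _ a b ab; rewrite lee_fin; exact/lefP/nd_nnsfun_approx.
rewrite cvgf; under eq_fun do rewrite mixture_nnsfun.
rewrite -monotone_convergence//.
- by apply: eq_integral => x _; rewrite cvgf.
- move=> n; apply: (measurable_funS measurableT) => //.
  apply: measurable_fun_integral_kernel => //.
  by move=> y; rewrite lee_fin.
  exact/measurable_EFinP.
- by move=> n x _; apply: integral_ge0 => y _; rewrite lee_fin.
- move=> x _ a b ab; apply: ge0_le_integral => //.
  + by move=> y _; rewrite lee_fin.
  + exact/measurable_EFinP.
  + exact/measurable_EFinP.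
  + by move=> y _; rewrite lee_fin; exact/lefP/nd_nnsfun_approx.
Qed.

End mixture.

(** * Stopping times *)

Section filtration_theory.
Context {R : realType} {E : topologicalType}.
Context {disp : measure_display} {Omega : measurableType disp}.
Variables (P : absorbed E -> probability Omega R) (F : R -> set (set Omega)).
Hypothesis FF : filtration P F.
Implicit Types (T : Omega -> \bar R) (A : set Omega).

Lemma filtration_measurable t A : 0 <= t -> F t A -> measurable A.
Proof. by move=> t0; exact: (filtration_sub FF t0). Qed.

Lemma filtrationS s t A : 0 <= s -> s <= t -> F s A -> F t A.
Proof. by move=> s0 st; exact: (filtration_mono FF s0 st). Qed.

Lemma filtration_measurableE t A : 0 <= t ->
  (@measurable _ (g_sigma_algebraType (F t)) A) = F t A.
Proof.
by move=> t0; rewrite measurable_g_measurableTypeE//; exact: (filtration_sigma FF).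
Qed.

Lemma filtrationI t A B : 0 <= t -> F t A -> F t B -> F t (A `&` B).
Proof. by move=> t0; rewrite -!filtration_measurableE//; exact: measurableI. Qed.

Lemma filtrationD t A B : 0 <= t -> F t A -> F t B -> F t (A `\` B).
Proof. by move=> t0; rewrite -!filtration_measurableE//; exact: measurableD. Qed.

Lemma filtration_bigcup t (A : nat -> set Omega) : 0 <= t ->
  (forall n, F t (A n)) -> F t (\bigcup_n A n).
Proof.
move=> t0 FA; rewrite -filtration_measurableE//; apply: bigcupT_measurable => n.
by rewrite filtration_measurableE.
Qed.

Lemma filtration_bigcap t (A : nat -> set Omega) : 0 <= t ->
  (forall n, F t (A n)) -> F t (\bigcap_n A n).
Proof.
move=> t0 FA; rewrite -filtration_measurableE//; apply: bigcapT_measurable => n.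
by rewrite filtration_measurableE.
Qed.

Lemma filtration0 t : 0 <= t -> F t set0.
Proof. by move=> t0; rewrite -filtration_measurableE. Qed.

Lemma filtrationT t : 0 <= t -> F t setT.
Proof. by move=> t0; rewrite -filtration_measurableE. Qed.

(** For each [u > t], the event is the intersection of the strict ones at the levels [v n], which
    decrease to [t] inside []t, u]], so it lies in [F u]; right continuity of [F] brings it down to
    [F t]. The factor [A] lets one lemma serve both stopping times ([A = setT]) and stopped
    sigma-fields. *)
Lemma filtration_right_limit A T :
  (forall t, 0 < t -> F t (A `&` [set w | (T w < t%:E)%E])) ->
  forall t, 0 <= t -> F t (A `&` [set w | (T w <= t%:E)%E]).
Proof.
move=> FA t t0; apply: (filtration_right_cont FF t0) => u /= tu.
have ut : 0 < u - t by rewrite subr_gt0.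
pose v n : R := t + (u - t) / n.+1%:R.
have vu n : v n <= u.
  rewrite /v -lerBrDl ler_pdivrMr// ler_peMr ?(ltW ut)//.
  by rewrite (_ : 1 = 1%:R)// ler_nat.
have tv n : t < v n by rewrite ltrDl divr_gt0.
rewrite (_ : _ `&` _ = \bigcap_n (A `&` [set w | (T w < (v n)%:E)%E])).
  apply: filtration_bigcap => [|n]; first exact: ltW (le_lt_trans t0 tu).
  apply: (@filtrationS (v n)) => //; first exact: ltW (le_lt_trans t0 (tv n)).
  by apply: FA; exact: le_lt_trans t0 (tv n).
apply/seteqP; split=> [w [Aw /= Tw] n _|w ATw].
  by split => //=; rewrite (le_lt_trans Tw)// lte_fin.
split; first by have [] := ATw 0%N I.
rewrite /= leNgt; apply/negP => tT.
have [r tr rT] : exists2 r : R, t < r & (r%:E <= T w)%E.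
  case Tw: (T w) tT => [r| |] //= tr; first by exists r.
  by exists (t + 1); rewrite ?ltrDl// leey.
have [n] : exists n, (u - t) / n.+1%:R < r - t.
  have rt : 0 < (r - t) / (u - t) by rewrite divr_gt0// subr_gt0.
  have [N _ /(_ N (leqnn N))] := near_infty_natSinv_lt (PosNum rt).
  by rewrite /= ltr_pdivlMr// mulrC => h; exists N.
move=> nr; have [_ /=] := ATw n I.
by rewrite ltNge (le_trans _ rT)// lee_fin /v -lerBrDl ltW.
Qed.

Lemma stopping_time_lt T t : stopping_time F T -> 0 <= t ->
  F t [set w | (T w < t%:E)%E].
Proof.
move=> [T0 FT] t0.
rewrite (_ : [set _ | _] =
    \bigcup_n [set w | (T w <= (t - n.+1%:R^-1)%:E)%E]).
  apply: filtration_bigcup => // n.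
  have [tn|tn] := leP 0 (t - n.+1%:R^-1).
    by apply: (filtrationS tn); [rewrite gerBl|exact: FT].
  rewrite (_ : [set _ | _] = set0); first exact: filtration0.
  apply/seteqP; split => // w /= h; have := le_trans (T0 w) h.
  by rewrite lee_fin leNgt tn.
apply/seteqP; split=> w /=; last first.
  by move=> [n _] /= /le_lt_trans; apply; rewrite lte_fin ltrBlDr ltrDl.
case Tw: (T w) (T0 w) => [r| |] //= _; rewrite lte_fin => rt.
have rt0 : 0 < t - r by rewrite subr_gt0.
have [N _ /(_ N (leqnn N)) /= h] := near_infty_natSinv_lt (PosNum rt0).
by exists N => //=; rewrite Tw lee_fin lerBrDr -lerBrDl ltW.
Qed.

Lemma stopped_sigma_lt A T t : stopping_time F T -> stopped_sigma F T A ->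
  0 <= t -> F t (A `&` [set w | (T w < t%:E)%E]).
Proof.
move=> sT [mA FA] t0.
rewrite (_ : _ `&` _ = (A `&` [set w | (T w <= t%:E)%E]) `&`
   [set w | (T w < t%:E)%E]).
  by apply: filtrationI => //; [exact: FA|exact: stopping_time_lt].
by apply/seteqP; split=> w /=; [move=> [? h]; rewrite ltW|move=> [[]]].
Qed.

Lemma measurable_stopping_time T : stopping_time F T -> measurable_fun setT T.
Proof.
move=> [T0 FT]; apply: (measurability _ (ErealGenInftyO.measurableE R)).
move=> _ [_ [r ->] <-]; rewrite setTI.
have [r0|r0] := leP 0 r.
  apply: (@filtration_measurable r) => //.
  rewrite (_ : _ @^-1` _ = [set w | (T w < r%:E)%E]).
    by apply: stopping_time_lt.
  by apply/seteqP; split=> w /=; rewrite in_itv.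
rewrite (_ : _ @^-1` _ = set0)//; apply/seteqP; split => // w /=.
by rewrite in_itv /= => h; have := le_lt_trans (T0 w) h; rewrite lte_fin ltNge ltW.
Qed.

Lemma measurable_fine_stopping T : stopping_time F T ->
  measurable_fun setT (fun w => fine (T w)).
Proof.
by move=> /measurable_stopping_time mT; exact: measurableT_comp.
Qed.

Lemma fine_stopping_ge0 T w : stopping_time F T -> 0 <= fine (T w).
Proof. by move=> [T0 _]; exact: fine_ge0. Qed.

Lemma stopping_time_cst r : 0 <= r -> stopping_time F (fun=> r%:E).
Proof.
move=> r0; split=> [w|t t0]; first by rewrite lee_fin.
have [rt|tr] := leP r t.
  rewrite (_ : [set _ | _] = setT); first exact: filtrationT.
  by apply/seteqP; split => // w _ /=; rewrite lee_fin.
rewrite (_ : [set _ | _] = set0); first exact: filtration0.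
by apply/seteqP; split => // w /=; rewrite lee_fin leNgt tr.
Qed.

Lemma stopped_sigma_cst r A : 0 <= r -> stopped_sigma F (fun=> r%:E) A <-> F r A.
Proof.
move=> r0; split=> [[mA FA]|FA].
  have := FA r r0; rewrite (_ : _ `&` _ = A)//; apply/seteqP.
  by split=> [w []//|w Aw]; split => //=; exact: lexx.
split; first exact: filtration_measurable FA.
move=> t t0; have [rt|tr] := leP r t.
  apply: filtrationI => //; first exact: filtrationS FA.
  exact: (stopping_time_cst r0).2.
rewrite (_ : _ `&` _ = set0); first exact: filtration0.
by apply/seteqP; split => // w [_ /=]; rewrite lee_fin leNgt tr.
Qed.

Lemma stopping_timeD T r : stopping_time F T -> 0 <= r ->
  stopping_time F (fun w => T w + r%:E)%E.
Proof.
move=> [T0 FT] r0; split=> [w|t t0]; first by rewrite adde_ge0.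
rewrite (_ : [set _ | _] = [set w | (T w <= (t - r)%:E)%E]); last first.
  by apply/seteqP; split => w /=; rewrite EFinB leeBrDr.
have [tr|tr] := leP 0 (t - r).
  by apply: (filtrationS tr); [rewrite gerBl|exact: FT].
rewrite (_ : [set _ | _] = set0); first exact: filtration0.
apply/seteqP; split => // w /= h; have := le_trans (T0 w) h.
by rewrite lee_fin leNgt tr.
Qed.

Lemma stopped_sigmaS S T A : stopping_time F T ->
  (forall w, (S w <= T w)%E) -> stopped_sigma F S A -> stopped_sigma F T A.
Proof.
move=> [T0 FT] ST [mA FA]; split => // t t0.
rewrite (_ : _ `&` _ = (A `&` [set w | (S w <= t%:E)%E]) `&`
   [set w | (T w <= t%:E)%E]).
  by apply: filtrationI => //; [exact: FA|exact: FT].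
apply/seteqP; split=> w /= => [[Aw Tt]|[[]]//].
by split => //; split => //; exact: le_trans (ST w) Tt.
Qed.

Lemma sigma_algebra_stopped_sigma T : stopping_time F T ->
  sigma_algebra setT (stopped_sigma F T).
Proof.
move=> [T0 FT]; split=> [|A [mA FA]|A FA].
- by split=> // t t0; rewrite set0I; exact: filtration0.
- rewrite setTD; split; first exact: measurableC.
  move=> t t0; rewrite (_ : _ `&` _ = [set w | (T w <= t%:E)%E] `\`
     (A `&` [set w | (T w <= t%:E)%E])).
    by apply: filtrationD => //; [exact: FT|exact: FA].
  apply/seteqP; split => w /=; first by move=> [nA h]; split => // -[].
  by move=> [h nA]; split => // Aw; apply: nA.
- split; first by apply: bigcupT_measurable => n; exact: (FA n).1.
  move=> t t0; rewrite setI_bigcupl; apply: filtration_bigcup => // n.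
  exact: (FA n).2.
Qed.

Lemma stopped_sigmaI T A B : stopping_time F T ->
  stopped_sigma F T A -> stopped_sigma F T B -> stopped_sigma F T (A `&` B).
Proof.
move=> sT [mA FA] [mB FB]; split; first exact: measurableI.
move=> t t0; rewrite -(setIid [set w | (T w <= t%:E)%E]) setIACA.
exact: filtrationI (FA t t0) (FB t t0).
Qed.

Lemma stopped_sigma_fin T : stopping_time F T ->
  stopped_sigma F T [set w | (T w < +oo)%E].
Proof.
move=> sT; split.
  rewrite -[X in measurable X]setTI; apply: emeasurable_fun_infty_o => //.
  exact: measurable_stopping_time.
move=> t t0; rewrite (_ : _ `&` _ = [set w | (T w <= t%:E)%E]); first exact: sT.2.
apply/seteqP; split=> w /= => [[]//|Tt]; split => //.
by rewrite (le_lt_trans Tt)// ltry.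
Qed.

Lemma stopped_sigma_eval (Z : R -> Omega -> absorbed E) T B :
  hausdorff_space E -> locally_compact [set: E] -> @second_countable E ->
  (forall t B, 0 <= t -> measurable B -> F t (Z t @^-1` B)) ->
  (forall w t, 0 <= t -> Z u w @[u --> t^'+] --> Z t w) ->
  stopping_time F T -> measurable B ->
  stopped_sigma F T ([set w | (T w < +oo)%E /\ B (Z (fine (T w)) w)]).
Proof.
move=> hE lE sE adZ rcZ sT mB.
set A := [set w | _].
have FA t : 0 <= t -> F t (A `&` [set w | (T w <= t%:E)%E]).
  (* [Ft] is [Omega] with the sigma-field [F t], so that general measurability lemmas become
     statements about [F t]. In [S], the default [t] outside [T <= t] gives an [F t]-measurable time
     bounded by [t] everywhere. *)
  move=> t0; pose Ft := g_sigma_algebraType (F t).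
  pose S (w : Ft) : R := if (T w <= t%:E)%E then fine (T w) else t.
  have S0 w : 0 <= S w.
    by rewrite /S; case: ifPn => // _; exact: (fine_stopping_ge0 w sT).
  have St w : S w <= t.
    rewrite /S; case: ifPn => // Tt.
    by rewrite -lee_fin fineK// ge0_fin_numE ?(sT.1)// (le_lt_trans Tt)// ltry.
  have mS : measurable_fun [set: Ft] S.
    apply: (measurability _ (RGenInftyO.measurableE R)) => _ [_ [r ->] <-].
    rewrite setTI filtration_measurableE//.
    have [tr|rt] := ltP t r.
      rewrite (_ : _ @^-1` _ = setT); first exact: filtrationT.
      apply/seteqP; split=> // w _ /=; rewrite in_itv /=.
      exact: le_lt_trans (St w) tr.
    have [r0|r0] := leP 0 r; last first.
      rewrite (_ : _ @^-1` _ = set0); first exact: filtration0.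
      apply/seteqP; split=> // w /=; rewrite in_itv /= => h.
      by have := le_lt_trans (S0 w) h; rewrite ltNge ltW.
    apply: (filtrationS r0 rt).
    rewrite (_ : _ @^-1` _ = [set w | (T w < r%:E)%E]).
      exact: stopping_time_lt.
    apply/seteqP; split=> w /=; rewrite in_itv /= /S.
      case: ifPn => [Tt|_]; last by rewrite ltNge rt.
      by rewrite -lte_fin fineK// ge0_fin_numE ?(sT.1)// (le_lt_trans Tt)// ltry.
    move=> Tr; rewrite (le_trans (ltW Tr)) ?lee_fin//.
    by rewrite -lte_fin fineK// ge0_fin_numE ?(sT.1)// (lt_trans Tr)// ltry.
  pose V (u : R) (w : Ft) := Z (Num.min u t) w.
  have mV u : 0 <= u -> measurable_fun [set: Ft] (V u).
    move=> u0 _ C mC; rewrite setTI filtration_measurableE//.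
    have m0 : 0 <= Num.min u t by rewrite le_min u0.
    by apply: (filtrationS m0); [rewrite ge_min lexx orbT|exact: adZ].
  have rcV u (w : Ft) : 0 <= u -> V s w @[s --> u^'+] --> V u w.
    move=> u0; have [tu|ut] := leP t u.
      rewrite /V min_r// => C /nbhs_singleton C0; apply/near_at_rightP.
      by exists 1 => // y uy _; rewrite /= min_r// (le_trans tu)// ltW.
    rewrite /V min_l ?ltW// => C /(rcZ w u u0)/near_at_rightP[e e0 h].
    apply/near_at_rightP; exists (Num.min e (t - u)).
      by rewrite lt_min e0 subr_gt0.
    move=> y uy; rewrite -ltrBlDl lt_min => /andP[ye yt].
    by rewrite /= min_l; [apply: h => //; lra|lra].
  have mVS : measurable_fun [set: Ft] (fun w => V (S w) w).
    exact: (measurable_fun_right_continuous_time hE lE sE).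
  have := mVS measurableT B mB; rewrite setTI filtration_measurableE// => FV.
  rewrite (_ : _ `&` _ = ((fun w => V (S w) w) @^-1` B) `&`
     [set w | (T w <= t%:E)%E]).
    by apply: filtrationI => //; exact: sT.2.
  apply/seteqP; split=> w [/=].
    move=> [Tf BT] Tt; split => //; rewrite /V min_l//.
    by rewrite /S Tt.
  rewrite /V min_l// /S => + Tt; rewrite Tt => BT; split => //; split => //.
  by rewrite (le_lt_trans Tt)// ltry.
split => //.
rewrite (_ : A = \bigcup_n (A `&` [set w | (T w <= n%:R%:E)%E])).
  by apply: bigcupT_measurable => n; apply: (@filtration_measurable n%:R) => //; exact: FA.
apply/seteqP; split=> [w Aw|w [n _ []//]].
have [Tf _] := Aw; exists (Num.truncn (fine (T w))).+1 => //; split => //=.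
rewrite -[T w]fineK ?lee_fin; last by rewrite ge0_fin_numE ?(sT.1).
by rewrite ltW// truncnS_gt.
Qed.

End filtration_theory.

Definition pathof {R : realType} {E : topologicalType} {Omega : Type}
  (Z : R -> Omega -> absorbed E) (w : Omega) : paths R E := mkpath (Z ^~ w).

(** The pushforward in bundled form: the explicit structure name yields a [{measure set _ -> _}]
    directly from the proof [mf], so that families of pushforwards can serve as kernels. *)
Definition image_measure d1 d2 (T1 : measurableType d1) (T2 : measurableType d2)
    (R : realType) (m : {measure set T1 -> \bar R}) (f : T1 -> T2)
    (mf : measurable_fun setT f) : {measure set T2 -> \bar R} :=
  measure_function_pushforward__canonical__measure_function_Measure m mf.

Lemma ge0_integral_image_measure d1 d2 (T1 : measurableType d1)
    (T2 : measurableType d2) (R : realType) (m : {measure set T1 -> \bar R})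
    (f : T1 -> T2) (mf : measurable_fun setT f) (h : T2 -> \bar R) :
  measurable_fun setT h -> (forall y, 0 <= h y)%E ->
  (\int[image_measure m mf]_y h y = \int[m]_x h (f x))%E.
Proof. by move=> mh h0; rewrite ge0_integral_pushforward. Qed.

(** * The strong Markov property on path space *)

Section markov_theory.
Context {R : realType} {E : topologicalType}.
Context {disp : measure_display} {Omega : measurableType disp}.
Variables (P : absorbed E -> probability Omega R) (F : R -> set (set Omega)).
Variable Z : R -> Omega -> absorbed E.
Hypothesis H : markov_process P F Z.
Implicit Types (T : Omega -> \bar R) (A : set Omega) (C : set (paths R E)).

Let FF := mp_filtration H.
Let hausE := mp_hausdorff H.
Let lcE := mp_locally_compact H.
Let scE := mp_second_countable H.

Lemma lt_lifetime t w : 0 <= t -> Z t w <> None <-> (t%:E < lifetime Z w)%E.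
Proof.
move=> t0; split=> [Zt|tl Zt].
  by rewrite ltNge; apply/negP => /(mp_absorbing H t0).
move: tl; rewrite ltNge => /negP; apply; apply: ereal_inf_lbound.
by exists t.
Qed.

Lemma is_path_process w : is_path (Z ^~ w).
Proof.
split=> [t t0|s t s0 st Zs|t t0 Zt].
- exact: (mp_right_cont H).
- apply: (mp_absorbing H); first exact: le_trans st.
  apply: (@le_trans _ _ s%:E); last by rewrite lee_fin.
  by apply: ereal_inf_lbound; exists s.
- by apply: (mp_left_lim H) => //; apply/lt_lifetime => //; exact: ltW.
Qed.

Lemma pcoord_pathof t w : pcoord t (pathof Z w) = Z t w.
Proof. by rewrite pcoord_mkpath//; exact: is_path_process. Qed.

Lemma measurable_process t : 0 <= t -> measurable_fun setT (Z t).
Proof.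
move=> t0 _ B mB; rewrite setTI.
exact: (filtration_measurable FF t0 (mp_adapted H t0 mB)).
Qed.

Lemma measurable_pathof : measurable_fun setT (pathof Z).
Proof.
apply: measurable_fun_paths => t t0.
by under eq_fun do rewrite pcoord_pathof; exact: measurable_process.
Qed.

Lemma measurable_shift_stopping T : stopping_time F T ->
  measurable_fun setT (fun w => pshift (fine (T w)) (pathof Z w)).
Proof.
move=> sT; apply: (measurable_pshift_joint hausE lcE scE).
- by move=> w; exact: (fine_stopping_ge0 w sT).
- exact: (measurable_fine_stopping FF sT).
- exact: measurable_pathof.
Qed.

Lemma measurable_process_stopping T : stopping_time F T ->
  measurable_fun setT (fun w => Z (fine (T w)) w).
Proof.
move=> sT; under eq_fun do rewrite -pcoord_pathof.
apply: (measurable_pcoord_joint hausE lcE scE).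
- by move=> w; exact: (fine_stopping_ge0 w sT).
- exact: (measurable_fine_stopping FF sT).
- exact: measurable_pathof.
Qed.

Lemma stopped_sigma_process T B : stopping_time F T -> measurable B ->
  stopped_sigma F T ([set w | (T w < +oo)%E /\ B (Z (fine (T w)) w)]).
Proof.
exact: (stopped_sigma_eval FF hausE lcE scE (mp_adapted H) (mp_right_cont H)).
Qed.

Local Open Scope ereal_scope.

Lemma strong_markov_fin x T A s (f : absorbed E -> \bar R) :
  stopping_time F T -> stopped_sigma F T A -> A `<=` [set w | T w < +oo] ->
  (0 <= s)%R -> measurable_fun setT f -> (forall p, 0 <= f p) ->
  \int[P x]_(w in A) f (Z (fine (T w) + s)%R w) =
  \int[P x]_(w in A) \int[P (Z (fine (T w)) w)]_w' f (Z s w').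
Proof.
move=> sT FA AT s0 mf f0.
have [_ /(_ A FA) h] := mp_strong_markov H x sT s0 mf f0.
transitivity (\int[P x]_(w in A)
    (if T w < +oo then f (Z (fine (T w) + s)%R w) else 0)).
  by apply: eq_integral => w; rewrite inE => /AT /= ->.
by rewrite -h; apply: eq_integral => w; rewrite inE => /AT /= ->.
Qed.

Let law C := fun x => P x (pathof Z @^-1` C).

Let sm C := forall x T A, stopping_time F T -> stopped_sigma F T A ->
  A `<=` [set w | T w < +oo] ->
  P x (A `&` [set w | C (pshift (fine (T w)) (pathof Z w))]) =
  \int[P x]_(w in A) law C (Z (fine (T w)) w).

Let measurable_event C T : measurable C -> stopping_time F T ->
  measurable [set w | C (pshift (fine (T w)) (pathof Z w))].
Proof.
move=> mC sT; rewrite -[X in measurable X]setTI.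
exact: (measurable_shift_stopping sT measurableT mC).
Qed.

Let measurable_pathof_event C : measurable C -> measurable (pathof Z @^-1` C).
Proof.
by move=> mC; rewrite -[X in measurable X]setTI; exact: measurable_pathof.
Qed.

Lemma measurable_integral_process (h : absorbed E -> \bar R) d : (0 <= d)%R ->
  measurable_fun setT h -> (forall p, 0 <= h p) ->
  measurable_fun setT (fun x => \int[P x]_w h (Z d w)).
Proof.
move=> d0 mh h0.
pose k x := image_measure (P x) (measurable_process d0).
have := @measurable_fun_integral_kernel _ _ (absorbed E) (absorbed E) R k.
move=> /(_ _ h h0 mh).
rewrite (_ : (fun x => \int[k x]_y h y) = (fun x => \int[P x]_w h (Z d w))).
  by apply=> U mU; exact: (mp_kernel H).
by apply/funext => x; rewrite ge0_integral_image_measure.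
Qed.

(** Induction on the number of coordinates. The hypothesis for [l] is used at the stopping time
    [T + d], with the past event intersected with the event that [Z] is in [B] at [T + d]. What
    remains is a function [h] of the single position at [T + d], to which the one-time strong Markov
    property applies at [T]. Measurability of [law] is proved along with it, since [h] contains
    [law (cyl l)]. *)
Let law_sm_cyl l : cyl_ok l ->
  measurable_fun setT (law (cyl l)) /\ sm (cyl l).
Proof.
elim: l => [_|[d B] l IH [d0 mB okl]].
  split=> [|x T A sT FA AT].
    rewrite (_ : law _ = cst 1)//.
    by apply/funext => x; rewrite /law preimage_setT probability_setT.
  rewrite setIT; under eq_integral do rewrite /law preimage_setT probability_setT.
  by rewrite integral_cst ?mul1e//; exact: FA.1.
have [mlaw sml] := IH okl.
pose h y := (\1_B y)%:E * law (cyl l) y.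
have h0 y : 0 <= h y by rewrite mule_ge0// lee_fin.
have mh : measurable_fun setT h.
  by apply: emeasurable_funM => //; apply/measurable_EFinP; exact: measurable_indic.
have step x T A : stopping_time F T -> stopped_sigma F T A ->
    A `<=` [set w | T w < +oo] ->
    P x (A `&` [set w | cyl ((d, B) :: l) (pshift (fine (T w)) (pathof Z w))]) =
    \int[P x]_(w in A) h (Z (fine (T w) + d)%R w).
  move=> sT FA AT; pose T' w := T w + d%:E.
  have sT' : stopping_time F T' by exact: (stopping_timeD FF).
  pose Q := [set w | T' w < +oo /\ B (Z (fine (T' w)) w)].
  have FQ : stopped_sigma F T' Q by exact: stopped_sigma_process.
  have FA' : stopped_sigma F T' (A `&` Q).
    apply: (stopped_sigmaI FF) => //; apply: (stopped_sigmaS FF) FA => // w.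
    by rewrite leeDl// lee_fin.
  have T'E w : A w -> T' w < +oo /\ fine (T' w) = (fine (T w) + d)%R.
    move=> Aw; have Tf : T w \is a fin_num.
      by rewrite ge0_fin_numE ?(sT.1)//; exact: AT.
    by rewrite /T' fineD// -[T w]fineK// -EFinD ltry.
  transitivity (P x ((A `&` Q) `&`
      [set w | cyl l (pshift (fine (T' w)) (pathof Z w))])).
    congr (P x _); apply/seteqP; split=> w /=.
      move=> [Aw]; rewrite pcoord_shift ?(fine_stopping_ge0 _ sT)//.
      rewrite pshiftD// ?(fine_stopping_ge0 _ sT)// pcoord_pathof => -[Bw Cw].
      by have [T'f T'w] := T'E w Aw; rewrite /Q /= T'w.
    move=> [[Aw [_ Bw]] Cw]; split => //.
    rewrite pcoord_shift ?(fine_stopping_ge0 _ sT)//.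
    rewrite pshiftD// ?(fine_stopping_ge0 _ sT)// pcoord_pathof.
    by have [T'f T'w] := T'E w Aw; rewrite -T'w.
  rewrite sml//; last by move=> w [_ []].
  rewrite integral_mkcondr; apply: eq_integral => w; rewrite inE => Aw.
  have [T'f T'w] := T'E w Aw.
  rewrite patchE /h indicE T'w.
  have -> : (w \in Q) = (Z (fine (T w) + d)%R w \in B).
    apply/idP/idP => /set_mem wQ; apply/mem_set.
      by case: wQ => _; rewrite T'w.
    by rewrite /Q /= T'w.
  by case: ifPn => _; rewrite ?mul1e ?mul0e.
(* The case [T = 0], [A = setT] of [step] under [P y] computes the law of the longer cylinder. *)
have lawE y : law (cyl ((d, B) :: l)) y = \int[P y]_w h (Z d w).
  have := step y (fun=> 0%:E) setT (stopping_time_cst FF (lexx _)).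
  rewrite setTI /= => h'; rewrite /law.
  transitivity (P y [set w | B (pcoord d (pshift 0 (pathof Z w))) /\
     cyl l (pshift d (pshift 0 (pathof Z w)))]).
    congr (P y _); apply/seteqP.
    by split=> w /=; rewrite pshift0.
  rewrite h'.
  - by apply: eq_integral => w _; rewrite add0r.
  - by apply/(stopped_sigma_cst FF) => //; exact: (filtrationT FF).
  - by move=> w _ /=; rewrite ltry.
split.
  rewrite (_ : law _ = fun y => \int[P y]_w h (Z d w)); last exact/funext.
  exact: measurable_integral_process.
move=> x T A sT FA AT; rewrite step// strong_markov_fin//.
by apply: eq_integral => w _; rewrite lawE.
Qed.

(** Dynkin's argument from cylinders. Complements are reached by subtraction from [P x A], which is
    legitimate as all masses are finite; disjoint unions by countable additivity and exchange of sum
    and integral. *)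
Let law_sm C : measurable C -> measurable_fun setT (law C) /\ sm C.
Proof.
rewrite measurable_pathsE.
apply: (@dynkin_induction _ (paths R E) _
  [set C | measurable_fun setT (law C) /\ sm C] measurable_pathsE).
- move=> _ _ [l1 ok1 ->] [l2 ok2 ->]; have [l okl <-] := cylI ok1 ok2.
  by exists l.
- exact: (@law_sm_cyl [::]).
- by move=> _ [l okl ->]; exact: law_sm_cyl.
- move=> S mS [mlaw smS].
  have lawC y : law (~` S) y = 1 - law S y.
    rewrite /law preimage_setC probability_setC//; exact: measurable_pathof_event.
  split.
    rewrite (_ : law _ = fun y => 1 - law S y); last exact/funext.
    exact: emeasurable_funB.
  move=> x T A sT FA AT; have mA := FA.1.
  have mE := measurable_event mS sT.
  have mlT : measurable_fun setT (fun w => law S (Z (fine (T w)) w)).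
    exact: measurableT_comp (measurable_process_stopping sT).
  have sum1 : \int[P x]_(w in A) law S (Z (fine (T w)) w) +
      \int[P x]_(w in A) law (~` S) (Z (fine (T w)) w) = P x A.
    rewrite -ge0_integralD//.
    + under eq_integral.
        move=> w _; rewrite lawC addeC subeK; last first.
          by rewrite fin_num_measure//; exact: measurable_pathof_event.
        over.
      by rewrite integral_cst ?mul1e.
    + exact: measurable_funS mlT.
    + under eq_fun do rewrite lawC.
      by apply: emeasurable_funB => //; exact: measurable_funS mlT.
  have sum2 : P x (A `&` [set w | S (pshift (fine (T w)) (pathof Z w))]) +
     P x (A `&` [set w | (~` S) (pshift (fine (T w)) (pathof Z w))]) = P x A.
    rewrite -measureU//.
    + by rewrite -setIUr (_ : _ `|` _ = setT) ?setIT//; exact: setUv.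
    + exact: measurableI.
    + by apply: measurableI => //; apply: measurable_event => //; exact: measurableC.
    + by rewrite setIACA setIid (_ : [set w | S _] `&` _ = set0) ?setI0//; exact: setICr.
  set I := \int[P x]_(w in A) law S (Z (fine (T w)) w) in sum1.
  have PI : P x (A `&` [set w | S (pshift (fine (T w)) (pathof Z w))]) = I.
    exact: smS.
  have finI : I \is a fin_num.
    by rewrite -PI fin_num_measure//; exact: measurableI.
  rewrite PI (addeC I) in sum2; rewrite (addeC I) in sum1.
  by rewrite -[LHS](addeK _ finI) sum2 -sum1 addeK.
- move=> S mS tS SS.
  have lawU y : law (\bigcup_n S n) y = \sum_(n <oo) law (S n) y.
    rewrite /law preimage_bigcup measure_semi_bigcup//.
    + by move=> n; exact: measurable_pathof_event.
    + apply/trivIsetP => i j _ _ ij; rewrite -preimage_setI.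
      by move/trivIsetP : tS => /(_ i j I I ij) ->; rewrite preimage_set0.
    + by apply: bigcupT_measurable => n; exact: measurable_pathof_event.
  split.
    rewrite (_ : law _ = fun y => \sum_(n <oo) law (S n) y); last exact/funext.
    by apply: ge0_emeasurable_sum => // n _; exact: (SS n).1.
  move=> x T A sT FA AT; have mA := FA.1.
  rewrite (_ : _ `&` _ =
      \bigcup_n (A `&` [set w | S n (pshift (fine (T w)) (pathof Z w))])).
    rewrite measure_semi_bigcup//.
    + under eq_integral do rewrite lawU.
      rewrite integral_nneseries//.
        by apply: eq_eseriesr => n _; exact: (SS n).2.
      move=> n; apply: (measurable_funS measurableT) => //.
      exact: measurableT_comp (SS n).1 (measurable_process_stopping sT).
    + by move=> n; apply: measurableI => //; exact: measurable_event.
    + apply/trivIsetP => i j _ _ ij; rewrite setIACA setIid.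
      move/trivIsetP : tS => /(_ i j I I ij) Sij.
      rewrite (_ : [set w | S i _] `&` _ = set0) ?setI0//.
      apply/seteqP; split => // w [Si Sj].
      by have : (S i `&` S j) (pshift (fine (T w)) (pathof Z w)); [|rewrite Sij].
    + apply: bigcupT_measurable => n; apply: measurableI => //.
      exact: measurable_event.
  by rewrite -setI_bigcupr; congr (_ `&` _); apply/seteqP; split.
Qed.

Lemma measurable_law C : measurable C ->
  measurable_fun setT (fun x => P x (pathof Z @^-1` C)).
Proof. by move=> /law_sm[]. Qed.

Lemma strong_markov_event C x T A : measurable C ->
  stopping_time F T -> stopped_sigma F T A -> A `<=` [set w | T w < +oo] ->
  P x (A `&` [set w | C (pshift (fine (T w)) (pathof Z w))]) =
  \int[P x]_(w in A) P (Z (fine (T w)) w) (pathof Z @^-1` C).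
Proof. by move=> /law_sm[_]; exact. Qed.

Lemma measurable_integral_pathof (f : paths R E -> \bar R) :
  measurable_fun setT f -> (forall p, 0 <= f p) ->
  measurable_fun setT (fun x => \int[P x]_w f (pathof Z w)).
Proof.
move=> mf f0; pose k x := image_measure (P x) measurable_pathof.
have := @measurable_fun_integral_kernel _ _ (absorbed E) (paths R E) R k.
move=> /(_ _ f f0 mf).
rewrite (_ : (fun x => \int[k x]_y f y) = (fun x => \int[P x]_w f (pathof Z w))).
  by apply=> U mU; exact: measurable_law.
by apply/funext => x; rewrite ge0_integral_image_measure.
Qed.

(** Both sides are the integral of [f] against [nu], the law of the shifted path restricted to [A],
    which is a mixture in two ways: of the point masses at the shifted paths, and, by
    [strong_markov_event], of the laws of the process started afresh from its position at [T]. *)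
Lemma strong_markov_functional (f : paths R E -> \bar R) x T A :
  measurable_fun setT f -> (forall p, 0 <= f p) ->
  stopping_time F T -> stopped_sigma F T A -> A `<=` [set w | T w < +oo] ->
  \int[P x]_(w in A) f (pshift (fine (T w)) (pathof Z w)) =
  \int[P x]_(w in A) \int[P (Z (fine (T w)) w)]_w' f (pathof Z w').
Proof.
move=> mf f0 sT FA AT; have mA := FA.1.
pose nu := image_measure (mrestr (P x) mA) (measurable_shift_stopping sT).
pose k w := image_measure (P (Z (fine (T w)) w)) measurable_pathof.
have nuE U : measurable U ->
    nu U = P x (A `&` [set w | U (pshift (fine (T w)) (pathof Z w))]).
  by rewrite setIC.
transitivity (\int[nu]_p f p).
  pose k' w : {measure set (paths R E) -> \bar R} :=
    \d_(pshift (fine (T w)) (pathof Z w)).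
  rewrite (@ge0_integral_mixture _ _ _ _ _ (P x) A mA k' nu)//.
  - by apply: eq_integral => w _; rewrite integral_dirac// diracT mul1e.
  - move=> U mU; rewrite (_ : (fun w => _) = EFin \o
        \1_[set w | U (pshift (fine (T w)) (pathof Z w))]).
      apply/measurable_EFinP; apply: measurable_indic; exact: measurable_event.
    apply/funext => w; rewrite /= indicE.
    change (k' w U) with ((\1_U (pshift (fine (T w)) (pathof Z w)) : R)%:E).
    by rewrite diracE; congr (_%:R%:E); apply/idP/idP; rewrite !inE.
  - move=> U mU; rewrite nuE//.
    transitivity (\int[P x]_(w in A)
        (\1_[set w | U (pshift (fine (T w)) (pathof Z w))] w)%:E).
      by rewrite integral_indic ?(setIC _ A)//; exact: measurable_event.
    apply: eq_integral => w _; rewrite /= indicE.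
    change (k' w U) with ((\1_U (pshift (fine (T w)) (pathof Z w)) : R)%:E).
    by rewrite diracE; congr (_%:R%:E); apply/idP/idP; rewrite !inE.
rewrite (@ge0_integral_mixture _ _ _ _ _ (P x) A mA k nu)//.
- by apply: eq_integral => w _; rewrite ge0_integral_image_measure.
- move=> U mU.
  exact: (measurableT_comp (measurable_law mU) (measurable_process_stopping sT)).
- by move=> U mU; rewrite nuE// strong_markov_event.
Qed.

End markov_theory.

(** * Additive functionals and their inverses *)

Section affine_integral.
Context {R : realType}.
Local Notation mu := (@lebesgue_measure R).
Local Open Scope ereal_scope.

(** Lebesgue measure equals [k] times its own image under [u |-> r + k * u], as one checks on
    half-open intervals. The case [k = 1] gives additivity of clocks, the case [r = 0] their
    behaviour under a change of speed. *)
Lemma integral_affine (r k s : R) (f : R -> \bar R) : (0 < k)%R ->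
  measurable_fun setT f -> (forall u, 0 <= f u) ->
  k%:E * \int[mu]_(u in `[0%R, s]) f (r + k * u)%R =
  \int[mu]_(u in `[r, (r + k * s)%R]) f u.
Proof.
move=> k0 mf f0; pose phi : R -> measurableTypeR R := fun u => (r + k * u)%R.
have mphi : measurable_fun [set: measurableTypeR R] phi.
  by apply: measurable_funD => //; exact: measurable_funM.
pose k' : {nonneg R} := NngNum (ltW k0).
pose nu : {measure set (measurableTypeR R) -> \bar R} :=
  mscale k' (image_measure mu mphi).
have nuE A : measurable A -> mu A = nu A.
  have := @lebesgue_measure_unique R nu.
  apply => _ [[a b] _ <-].
  rewrite /nu /= /mscale /= /pushforward.
  rewrite (_ : phi @^-1` _ = `]((a - r) / k)%R, ((b - r) / k)%R]%classic); last first.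
    apply/seteqP; split=> u /=; rewrite !in_itv /= ltr_pdivrMr// ler_pdivlMr// /phi mulrC.
      by rewrite ltrBlDl lerBrDl.
    by rewrite ltrBlDl lerBrDl.
  rewrite !lebesgue_measure_itv /= !lte_fin ltr_pM2r ?invr_gt0// ltrD2r.
  case: ifPn => _; last by rewrite mule0.
  by rewrite -!EFinB -EFinM -mulrBl mulrCA mulfV ?gt_eqF// mulr1; congr _%:E; ring.
have mitv : measurable (`[r, (r + k * s)%R]%classic : set R) by [].
transitivity (\int[nu]_(u in `[r, (r + k * s)%R]) f u); last first.
  by apply: eq_measure_integral => A mA _; exact/esym/nuE.
rewrite ge0_integral_mscale//=; last exact: measurable_funS mf.
congr (_ * _); rewrite ge0_integral_pushforward//; last exact: measurable_funS mf.
congr (integral _ _ _); apply/seteqP; split=> u /=; rewrite !in_itv /= /phi.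
  by move=> /andP[u0 us]; rewrite lerDl mulr_ge0 ?(ltW k0)//= lerD2l ler_pM2l.
by rewrite lerDl lerD2l ler_pM2l// pmulr_rge0.
Qed.

End affine_integral.

Section lifetime_paths.
Context {R : realType} {E : topologicalType}.
Implicit Types p : paths R E.

(** [None] is isolated, so being alive is an open condition on the state and right continuity
    preserves it for a while; a path is therefore dead at its lifetime, never alive there. *)
Lemma pcoord_near_alive t p : 0 <= t -> pcoord t p <> None ->
  exists2 e, 0 < e & forall u, t <= u -> u < t + e -> pcoord u p <> None.
Proof.
move=> t0; case pt: (pcoord t p) => [x|//] _.
have : \forall u \near t^'+, pcoord u p <> None.
  have /(_ [set y | y <> None]) := pcoord_cvg (p := p) t0; apply.
  by rewrite pt; apply/nbhs_SomeE; exact: filterE.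
move=> /near_at_rightP[e e0 h]; exists e => // u; rewrite le_eqVlt.
by move=> /predU1P[<- _|tu ut]; [rewrite pt|exact: h].
Qed.

Lemma pcoord_alive t s p : 0 <= s -> s <= t -> pcoord t p <> None ->
  pcoord s p <> None.
Proof. by move=> s0 st pt ps; apply: pt; exact: pcoord_absorbing ps. Qed.

Lemma lt_lifetime_paths t p : 0 <= t ->
  (t%:E < lifetime (@pcoord R E) p)%E <-> pcoord t p <> None.
Proof.
move=> t0; split=> [tl pt|pt].
  move: tl; rewrite ltNge => /negP; apply; apply: ereal_inf_lbound.
  by exists t.
have [e e0 h] := pcoord_near_alive t0 pt.
apply: (@lt_le_trans _ _ (t + e)%:E); first by rewrite lte_fin ltrDl.
apply: le_ereal_inf_tmp => _ [s [s0 ps] <-]; rewrite lee_fin leNgt.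
apply/negP => se; have [ts|st] := leP t s; first exact: h ps.
by apply: pt; exact: (pcoord_absorbing s0 (ltW st)).
Qed.

Lemma alive_pathsE p :
  alive (@pcoord R E) p = [set t | 0 <= t /\ pcoord t p <> None].
Proof.
by apply/seteqP; split=> t /= [t0 ht]; split => //; apply/(lt_lifetime_paths p t0).
Qed.

End lifetime_paths.

Section clock.
Context {R : realType} {E : topologicalType}.
Hypotheses (hausE : hausdorff_space E) (lcE : locally_compact [set: E])
  (scE : @second_countable E).
Implicit Types p : paths R E.
Local Notation mu := (@lebesgue_measure R).

Lemma measurable_functional2 (h : absorbed E -> R) : measurable_fun setT h ->
  measurable_fun setT (fun up : R * paths R E => h (pcoord (Num.max up.1 0) up.2)).
Proof.
move=> mh; apply: measurableT_comp => //.
exact: (measurable_fun_right_continuous_pos hausE lcE scE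
  (@measurable_pcoord R E) (fun u w => @pcoord_cvg R E w u)).
Qed.

Lemma measurable_functional1 (h : absorbed E -> R) p : measurable_fun setT h ->
  measurable_fun setT (fun u : R => h (pcoord (Num.max u 0) p)).
Proof.
move=> /measurable_functional2 mh.
exact: (measurableT_comp mh (pair2_measurable p)).
Qed.

Local Open Scope ereal_scope.

Lemma measurable_integral_functional (h : absorbed E -> R) (D : set R) :
  measurable_fun setT h -> (forall x, (0 <= h x)%R) -> measurable D ->
  D `<=` [set u | 0 <= u]%R ->
  measurable_fun setT (fun p => \int[mu]_(u in D) (h (pcoord u p))%:E).
Proof.
move=> mh h0 mD D0.
pose f (up : R * paths R E) :=
  (\1_D up.1 * h (pcoord (Num.max up.1 0) up.2))%:E.
have mf : measurable_fun setT f.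
  apply/measurable_EFinP; apply: measurable_funM.
    exact: (measurableT_comp (measurable_indic mD) (@measurable_fst _ _ _ _)).
  exact: measurable_functional2.
have f0 up : 0 <= f up by rewrite lee_fin mulr_ge0.
have := @measurable_fun_fubini_tonelli_G _ _ _ _ _ mu _ mf f0.
congr (measurable_fun _ _); apply/funext => p; rewrite /fubini_G [RHS]integral_mkcond.
apply: eq_integral => u _; rewrite /f patchE /= indicE.
case: ifPn => [uD|]; rewrite ?mul1r ?mul0r//.
by rewrite max_l//; apply: D0; exact: set_mem.
Qed.

Variable g : absorbed E -> R.
Hypotheses (gN : g None = 0%R) (gS : forall x : E, (0 < g (Some x))%R)
  (gc : continuous g).

Local Notation clk := (clock g (@pcoord R E)).
Local Notation tot := (total_clock g (@pcoord R E)).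

Lemma rate_ge0 x : (0 <= g x)%R.
Proof. by case: x => [x|]; [exact: ltW|rewrite gN]. Qed.

Lemma measurable_rate : measurable_fun setT g.
Proof. exact: continuous_measurable_absorbed. Qed.

Lemma clockE s p :
  clk s p = \int[mu]_(u in `[0%R, s]) (g (pcoord (Num.max u 0%R) p))%:E.
Proof.
by apply: eq_integral => u; rewrite inE /= in_itv /= => /andP[u0 _]; rewrite max_l.
Qed.

Lemma measurable_rate1 p (D : set R) :
  measurable_fun D (fun u => (g (pcoord (Num.max u 0%R) p))%:E).
Proof.
apply: (measurable_funS measurableT) => //; apply/measurable_EFinP.
exact: measurable_functional1 measurable_rate.
Qed.

Lemma clock_ge0 s p : 0 <= clk s p.
Proof. by apply: integral_ge0 => u _; rewrite lee_fin rate_ge0. Qed.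

Lemma le_clock s t p : (s <= t)%R -> clk s p <= clk t p.
Proof.
move=> st; rewrite !clockE; apply: ge0_subset_integral => //.
- exact: measurable_rate1.
- by move=> u _; rewrite lee_fin rate_ge0.
- by move=> u /=; rewrite !in_itv /= => /andP[-> us]; exact: le_trans us st.
Qed.

Lemma measurable_clock s : measurable_fun setT (clk s).
Proof.
apply: measurable_integral_functional => //.
- exact: measurable_rate.
- exact: rate_ge0.
- by move=> u /=; rewrite in_itv /= => /andP[].
Qed.

Lemma clockD r s p : (0 <= r)%R -> (0 <= s)%R ->
  clk (r + s)%R p = clk r p + clk s (pshift r p).
Proof.
move=> r0 s0; rewrite !clockE.
have rs : (r <= r + s)%R by rewrite lerDl.
rewrite (_ : `[0%R, (r + s)%R]%classic = `[0%R, r] `|` `]r, (r + s)%R])%classic; last first.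
  apply/seteqP; split => u /=; rewrite !in_itv /=.
    move=> /andP[u0 us]; have [ur|ru] := leP u r; [left|right];
    exact/andP.
  move=> [/andP[u0 ur]|/andP[ru us]]; apply/andP; split => //.
    exact: le_trans ur rs.
  exact: le_trans r0 (ltW ru).
rewrite ge0_integral_setU//.
- congr (_ + _); rewrite integral_itv_obnd_cbnd; last exact: measurable_rate1.
  rewrite -[in `[r, (r + s)%R]](mul1r s).
  rewrite -(integral_affine r s ltr01 _ _); last 2 first.
  + exact: measurable_rate1.
  + by move=> u; rewrite lee_fin rate_ge0.
  rewrite mul1e; apply: eq_integral => u; rewrite inE /= in_itv /= => /andP[u0 _].
  by rewrite mul1r pcoord_shift// !max_l// addr_ge0.
- exact: measurable_rate1.
- by move=> u _; rewrite lee_fin rate_ge0.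
- apply/disj_setPS => u [/=]; rewrite !in_itv /= => /andP[_ ur] /andP[ru _].
  by rewrite leNgt ru in ur.
Qed.

(** A compactness argument on [[0, s]]: around each [x] the rate is bounded to the right by right
    continuity and to the left by the left limit, which belongs to [E]. The path may jump, so the
    argument is carried out on times and not on the range of the path. *)
Lemma bounded_rate s p : (0 <= s)%R -> pcoord s p <> None ->
  exists2 M, (0 <= M)%R & forall u, (0 <= u)%R -> (u <= s)%R -> (g (pcoord u p) <= M)%R.
Proof.
move=> s0 ps.
have /compact_near_coveringP/(near_covering_withinP _).2 := @segment_compact R 0%R s.
move=> /(_ _ (@pinfty_nbhs R) (fun M u => (g (pcoord u p) <= M)%R) _)[].
  move=> x /=; rewrite in_itv /= => /andP[x0 xs].
  have rl (y : absorbed E) (F : set_system R) : Filter F ->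
      pcoord u p @[u --> F] --> y ->
      \forall u \near F, (g (pcoord u p) <= g y + 1)%R.
    move=> FF py; have gy : g (pcoord u p) @[u --> F] --> g y.
      exact: (cvg_comp _ _ py (@gc y)).
    have : \forall z \near g y, (z <= g y + 1)%R.
      by apply: lt_le_nbhsl; rewrite ltrDl.
    exact: gy.
  have [e e0 he] := (@near_at_rightP R x _).1 (rl _ _ _ (@pcoord_cvg _ _ p _ x0)).
  (* At [x = 0] there is no left limit to use, and no [y] to bound either, as [0 <= y < 0] is
     absurd. *)
  have [e' [e'0 [M' he']]] : exists e', (0 < e')%R /\
      exists M', forall y, (x - e' < y)%R -> (y < x)%R -> (0 <= y)%R ->
      (g (pcoord y p) <= M')%R.
    move: x0; rewrite le_eqVlt => /predU1P[<-|x0].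
      by exists 1%R; split => //; exists 0%R => y _ y0; rewrite leNgt y0.
    have [l /rl pl] := pcoord_left_lim x0 (pcoord_alive (ltW x0) xs ps).
    have [e' e'0 he'] := (@near_at_leftP R x _).1 pl.
    by exists e'; split => //; exists (g (Some l) + 1)%R => y y1 y2 _; exact: he'.
  pose M0 := Num.max M' (g (pcoord x p) + 1)%R.
  exists ([set y | `|x - y| < Num.min e e'], [set M | M0 <= M])%R.
    split; last by exists M0; split => //= M /ltW.
    by apply/nbhs_ballP; exists (Num.min e e') => //=; rewrite lt_min e0.
  move=> [y M] /= [xy M0M]; rewrite in_itv /= => /andP[y0 ys].
  have := xy; rewrite lt_min !ltr_distlC => /andP[/andP[y1 y2] /andP[y3 y4]].
  have [xy'|yx|<-] := ltgtP x y.
  - by rewrite (le_trans _ M0M)// le_max he ?orbT.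
  - by rewrite (le_trans _ M0M)// le_max he'.
  - by rewrite (le_trans _ M0M)// le_max lerDl ler01 orbT.
move=> M [_ hM].
(* Neighbourhoods of [+oo] contain open rays []M, +oo[], so the bound is taken at [M + 1] and not at
   [M]; the maximum with [0] makes it nonnegative. *)
exists (Num.max 0 (M + 1))%R; first by rewrite le_max lexx.
move=> u u0 us; rewrite le_max; apply/orP; right.
apply: (hM (M + 1)%R) => //=; first by rewrite ltrDl.
by rewrite in_itv /= u0.
Qed.

Lemma clock_lty s p : pcoord s p <> None -> clk s p < +oo.
Proof.
move=> ps; have [s0|s0] := leP 0%R s; last first.
  by rewrite /clock set_itv_ge ?integral_set0// bnd_simp -ltNge.
have [M M0 gM] := bounded_rate s0 ps.
apply: (@le_lt_trans _ _ (\int[mu]_(u in `[0%R, s]) (cst M%:E) u)).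
  rewrite clockE; apply: ge0_le_integral => //.
  - by move=> u _; rewrite lee_fin rate_ge0.
  - exact: measurable_rate1.
  - move=> u /=; rewrite in_itv /= => /andP[u0 us].
    by rewrite lee_fin max_l//; exact: gM.
rewrite integral_cst//= lebesgue_measure_itv /=.
by case: ifPn => _; rewrite ?mule0 ?ltry// -EFinB -EFinM ltry.
Qed.

Lemma clock_fin_num s p : pcoord s p <> None -> clk s p \is a fin_num.
Proof. by move=> ps; rewrite ge0_fin_numE ?clock_ge0// clock_lty. Qed.

Lemma clock_gt0 s p : (0 < s)%R -> pcoord 0%R p <> None -> 0 < clk s p.
Proof.
move=> s0; case p0: (pcoord 0%R p) => [x|//] _.
have gx : (0 < g (Some x))%R by [].
have : \forall u \near (0%R : R)^'+, (g (Some x) / 2 < g (pcoord u p))%R.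
  have cp : pcoord u p @[u --> (0%R : R)^'+] --> pcoord 0%R p by exact: pcoord_cvg.
  have gp : g (pcoord u p) @[u --> (0%R : R)^'+] --> g (Some x).
    by rewrite -p0; exact: (cvg_comp _ _ cp (@gc _)).
  have glt : (g (Some x) / 2 < g (Some x))%R.
    by rewrite ltr_pdivrMr// ltr_pMr// ltr1n.
  exact: (gp _ (lt_nbhsr glt)).
move=> /near_at_rightP[e e0 he].
pose d := Num.min s (e / 2)%R.
have d0 : (0 < d)%R by rewrite lt_min s0 divr_gt0.
have de : (d < e)%R by rewrite gt_min ltr_pdivrMr// ltr_pMr// ltr1n orbT.
apply: (@lt_le_trans _ _ (clk d p)); last by apply: le_clock; rewrite ge_min lexx.
apply: (@lt_le_trans _ _ (\int[mu]_(u in `[0%R, d]) (cst (g (Some x) / 2)%:E) u)).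
  rewrite integral_cst//= lebesgue_measure_itv /= lte_fin d0.
  by rewrite -EFinB -EFinM lte_fin subr0 mulr_gt0// divr_gt0.
rewrite clockE; apply: ge0_le_integral => //.
- by move=> u _; rewrite lee_fin divr_ge0// ltW.
- exact: measurable_rate1.
- move=> u /=; rewrite in_itv /= => /andP[u0 ud]; rewrite lee_fin max_l//.
  move: u0; rewrite le_eqVlt => /predU1P[<-|u0].
    by rewrite p0 ler_pdivrMr// ler_pMr// ler1n.
  by apply/ltW/he => //; rewrite add0r; exact: le_lt_trans de.
Qed.

Lemma lt_clock r s p : (0 <= r)%R -> (r < s)%R -> pcoord r p <> None ->
  clk r p < clk s p.
Proof.
move=> r0 rs pr; rewrite -(subrKC r s) clockD// ?subr_ge0 ?(ltW rs)//.
rewrite lteDl ?clock_fin_num//; apply: clock_gt0; first by rewrite subr_gt0.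
by rewrite pcoord_shift// addr0.
Qed.

Lemma clock_inj r s p : (0 <= r)%R -> (0 <= s)%R -> pcoord r p <> None ->
  pcoord s p <> None -> clk r p = clk s p -> r = s.
Proof.
move=> r0 s0 pr ps rs; apply/eqP; rewrite eq_le !leNgt.
by apply/andP; split; apply/negP => /lt_clock h;
  [have := h p s0 ps|have := h p r0 pr]; rewrite rs ltxx.
Qed.

Lemma clock0 p : clk 0%R p = 0.
Proof. by rewrite /clock set_itv1 integral_set1. Qed.

Lemma clock_lipschitz s p : (0 <= s)%R -> pcoord s p <> None ->
  exists2 M, (0 <= M)%R & forall u v, (0 <= u)%R -> (u <= v)%R -> (v <= s)%R ->
    (0 <= fine (clk v p) - fine (clk u p) <= M * (v - u))%R.
Proof.
move=> s0 ps; have [M M0 gM] := bounded_rate s0 ps; exists M => // u v u0 uv vs.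
have v0 := le_trans u0 uv.
have pv := pcoord_alive v0 vs ps; have pu := pcoord_alive u0 uv pv.
have vu0 : (0 <= v - u)%R by rewrite subr_ge0.
have pvu : pcoord (v - u) (pshift u p) <> None by rewrite pcoord_shift// subrKC.
have := clockD p u0 vu0; rewrite subrKC => ->.
rewrite fineD ?clock_fin_num// addrAC subrr add0r fine_ge0 ?clock_ge0//=.
rewrite -lee_fin fineK ?clock_fin_num//.
apply: (@le_trans _ _ (\int[mu]_(u in `[0%R, (v - u)%R]) (cst M%:E) u)).
  rewrite clockE; apply: ge0_le_integral => //.
  - by move=> x _; rewrite lee_fin rate_ge0.
  - exact: measurable_rate1.
  - move=> x /=; rewrite in_itv /= => /andP[x0 xs].
    by rewrite lee_fin max_l// pcoord_shift//; apply: gM; [exact: addr_ge0|lra].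
rewrite integral_cst//= lebesgue_measure_itv /=.
case: ifPn => _; last by rewrite mule0 lee_fin mulr_ge0.
by rewrite -EFinD -EFinM lee_fin oppr0 addr0.
Qed.

(** Intermediate value theorem. The clock is only controlled up to [s], so it is composed with [c],
    the projection of the line onto [[0, s]]; as [c] does not increase distances, the Lipschitz
    bound survives and the composite is continuous on the whole line. *)
Lemma clock_surj s t p : (0 <= s)%R -> pcoord s p <> None ->
  (0 <= t)%R -> t%:E <= clk s p -> exists r, [/\ (0 <= r)%R, (r <= s)%R & clk r p = t%:E].
Proof.
move=> s0 ps t0 ts; have [M M0 lip] := clock_lipschitz s0 ps.
pose c u := Num.min (Num.max u 0%R) s.
pose f u := fine (clk (c u) p).
have c0 u : (0 <= c u)%R by rewrite le_min s0 le_max lexx orbT.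
have cs u : (c u <= s)%R by rewrite ge_min lexx orbT.
have cid u : (0 <= u)%R -> (u <= s)%R -> c u = u by move=> u0 us; rewrite /c max_l// min_l.
have clip u v : (u <= v)%R -> (0 <= c v - c u <= v - u)%R.
  move=> uv; rewrite /c /Num.min /Num.max.
  by do !case: ifPn; rewrite -?leNgt => *; apply/andP; split; lra.
have flip (u v : R) : (`|f u - f v| <= M * `|u - v|)%R.
  wlog uv : u v / (u <= v)%R.
    move=> h; have [uv|/ltW vu] := leP u v; first exact: h.
    by rewrite distrC (distrC u); exact: h.
  have /andP[cuv cvu] := clip _ _ uv; rewrite subr_ge0 in cuv.
  have /andP[h1 h2] := lip _ _ (c0 u) cuv (cs v).
  rewrite distrC (distrC u) ger0_norm// ger0_norm ?subr_ge0//.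
  by apply: (le_trans h2); exact: ler_wpM2l.
have fc : continuous f.
  move=> x; apply/cvgrPdist_lt => e e0.
  have M1 : (0 < M + 1)%R by rewrite ltr_wpDl.
  apply/nbhs_ballP; exists (e / (M + 1))%R; first by rewrite /= divr_gt0.
  move=> y; rewrite /ball /= ltr_pdivlMr// => xy.
  rewrite (le_lt_trans (flip _ _))// (le_lt_trans _ xy)// mulrC.
  by apply: ler_wpM2l => //; rewrite lerDl.
have [||r] := @IVT R f 0%R s t s0.
- exact: continuous_subspaceT.
- have f0 : f 0%R = 0%R by rewrite /f cid// clock0.
  have fs : (t <= f s)%R.
    by rewrite -lee_fin /f cid// fineK// clock_fin_num.
  by rewrite f0 min_l ?max_r ?t0//; exact: le_trans fs.
- rewrite in_itv /= => /andP[r0 rs]; rewrite /f cid// => fr.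
  exists r; split => //; rewrite -fr fineK// clock_fin_num//.
  exact: pcoord_alive rs ps.
Qed.

(* Monotone convergence along [u in [0, n] | p (u + 1/(n+1)) is alive], whose
   supremum is attained before the lifetime. *)
Lemma total_clock_gt t p : (0 <= t)%R -> t%:E < tot p ->
  exists s, [/\ (0 <= s)%R, pcoord s p <> None & t%:E < clk s p].
Proof.
move=> t0 ttot.
pose A n := [set u : R | 0 <= u /\ u <= n%:R /\ pcoord (u + n.+1%:R^-1) p <> None]%R.
have Aalive n u : A n u -> pcoord u p <> None.
  by move=> [u0 [_]]; apply: pcoord_alive => //; rewrite lerDl.
have Adown n u v : (0 <= u)%R -> (u <= v)%R -> A n v -> A n u.
  move=> u0 uv [v0 [vn pv]]; split => //; split; first exact: le_trans uv vn.
  apply: pcoord_alive pv; first by rewrite addr_ge0.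
  by rewrite lerD2r.
have mA n : measurable (A n).
  apply: is_interval_measurable => u v Au Av w /andP[uw wv].
  by apply: Adown Av => //; exact: le_trans (Au.1) uw.
have UA : \bigcup_n A n = alive (@pcoord R E) p.
  rewrite alive_pathsE; apply/seteqP; split=> [u [n _ Au]|u [u0 pu]].
    by split; [exact: Au.1|exact: Aalive Au].
  have [e e0 he] := pcoord_near_alive u0 pu.
  have [N _ Ne] := near_infty_natSinv_lt (PosNum e0).
  pose n := maxn N (Num.truncn u).+1.
  exists n => //; split => //; split.
    apply: (@le_trans _ _ ((Num.truncn u).+1%:R)); first exact/ltW/truncnS_gt.
    by rewrite ler_nat leq_maxr.
  apply: he; first by rewrite lerDl.
  by rewrite ltrD2l; apply: Ne => /=; exact: leq_maxl.
have [n tn] : exists n, t%:E < \int[mu]_(u in A n) (g (pcoord (Num.max u 0%R) p))%:E.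
  apply: contrapT => /forallNP h; move: ttot; rewrite ltNge => /negP; apply.
  have -> : tot p = \int[mu]_(u in \bigcup_n A n) (g (pcoord (Num.max u 0%R) p))%:E.
    rewrite UA; apply: eq_integral => u; rewrite inE => -[u0 _].
    by rewrite max_l.
  have cv := @ge0_nondecreasing_set_cvg_integral _ (measurableTypeR R) R A
    (fun u => (g (pcoord (Num.max u 0%R) p))%:E) mu.
  apply: (cvge_le _ (cv _ _ _ _)).
  - by apply: nearW => n; rewrite leNgt; apply/negP/h.
  - move=> n m nm; apply/subsetPset => u [u0 [un pu]]; split => //; split.
      by rewrite (le_trans un)// ler_nat.
    apply: pcoord_alive pu; first by rewrite addr_ge0.
    by rewrite lerD2l lef_pV2 ?posrE// ler_nat.
  - by [].
  - by move=> n; exact: measurable_rate1.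
  - by move=> n u _; rewrite lee_fin rate_ge0.
have [u0 Au0] : A n !=set0.
  apply/set0P/eqP => A0; move: tn; rewrite A0 integral_set0.
  by rewrite lte_fin ltNge t0.
pose s := sup (A n).
have ubA : has_ubound (A n) by exists n%:R => u [_ [un _]].
have us u : A n u -> (u <= s)%R by move=> Au; exact: ub_le_sup.
have s0 : (0 <= s)%R := le_trans Au0.1 (us _ Au0).
exists s; split => //.
  (* A point [v] of [A n] beyond [s - 1/(n+1)] has the path alive at [v + 1/(n+1)], which exceeds
     [s]; this is what the margin in [A n] is for. *)
  have n0 : (0 < n.+1%:R^-1 :> R)%R by rewrite invr_gt0.
  have [v [v0 [vn pv]] sv] := sup_adherent n0 (conj (ex_intro _ u0 Au0) ubA).
  by apply: pcoord_alive pv => //; rewrite -lerBlDr ltW.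
apply: (lt_le_trans tn); rewrite clockE; apply: ge0_subset_integral => //.
- exact: mA.
- exact: measurable_rate1.
- by move=> u _; rewrite lee_fin rate_ge0.
- by move=> u Au /=; rewrite in_itv /= us// andbT; exact: Au.1.
Qed.

Lemma clock_le_total s p : (0 <= s)%R -> pcoord s p <> None -> clk s p <= tot p.
Proof.
move=> s0 ps.
have -> : tot p = \int[mu]_(u in alive (@pcoord R E) p) (g (pcoord (Num.max u 0%R) p))%:E.
  by apply: eq_integral => u; rewrite inE => -[u0 _]; rewrite max_l.
rewrite clockE; apply: ge0_subset_integral => //.
- rewrite alive_pathsE; apply: is_interval_measurable => u v [u0 pu] [v0 pv] w.
  move=> /andP[uw wv]; have w0 := le_trans u0 uw.
  by split => //; exact: pcoord_alive pv.
- exact: measurable_rate1.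
- by move=> u _; rewrite lee_fin rate_ge0.
- move=> u /=; rewrite in_itv /= alive_pathsE => /andP[u0 us].
  by split => //; exact: pcoord_alive ps.
Qed.

Lemma clock_lt_total s p : (0 <= s)%R -> pcoord s p <> None -> clk s p < tot p.
Proof.
move=> s0 ps; have [e e0 he] := pcoord_near_alive s0 ps.
have e2 : (0 < e / 2)%R by rewrite divr_gt0.
have pse : pcoord (s + e / 2) p <> None.
  by apply: he; rewrite ?lerDl ?(ltW e2)// ltrD2l ltr_pdivrMr// ltr_pMr// ltr1n.
apply: (@lt_le_trans _ _ (clk (s + e / 2)%R p)).
  by apply: lt_clock => //; rewrite ltrDl.
by apply: clock_le_total => //; rewrite addr_ge0// ltW.
Qed.

(** The clock is continuous and strictly increasing while the path is alive. So, below the total,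
    the set whose infimum is taken is the open ray beyond the unique alive time at which the clock
    reads [t]. *)
Lemma inverse_clockP t p : (0 <= t)%R -> t%:E < tot p ->
  let s := inverse_clock g (@pcoord R E) t p in
  [/\ (0 <= s)%R, pcoord s p <> None & clk s p = t%:E].
Proof.
move=> t0 /(total_clock_gt t0)[s1 [s10 ps1 ts1]].
have [s [s0 ss1 sE]] := clock_surj s10 ps1 t0 (ltW ts1).
have ps := pcoord_alive s0 ss1 ps1.
suff -> : inverse_clock g (@pcoord R E) t p = s by [].
rewrite /inverse_clock (_ : [set _ | _] = `]s, +oo[%classic); first exact: inf_itv.
apply/seteqP; split=> u /=; rewrite in_itv /= andbT -sE.
  move=> [u0]; rewrite [(_ < _)%R]ltNge; apply: contraTN => us.
  by rewrite -leNgt; exact: le_clock.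
by move=> su; split; [exact: le_trans s0 (ltW su)|exact: lt_clock].
Qed.

Lemma inverse_clock_unique s t p : (0 <= s)%R -> pcoord s p <> None ->
  clk s p = t%:E -> t%:E < tot p /\ inverse_clock g (@pcoord R E) t p = s.
Proof.
move=> s0 ps st; have tt : t%:E < tot p by rewrite -st; exact: clock_lt_total.
have t0 : (0 <= t)%R by rewrite -lee_fin -st clock_ge0.
split => //; have [r0 pr rt] := inverse_clockP t0 tt.
by apply: (@clock_inj _ _ p) => //; rewrite rt.
Qed.

End clock.

(** The common core of both constructions: [ssMp_of_MAP] is its image under [to_cone], and
    [MAP_of_ssMp] is its instance for the process written in polar coordinates. *)
Definition time_change {R : realType} {E : topologicalType}
    {disp : measure_display} {Omega : measurableType disp} (g : absorbed E -> R)
    (Z : R -> Omega -> absorbed E) (t : R) (w : Omega) : absorbed E :=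
  if (t%:E < total_clock g Z w)%E then Z (inverse_clock g Z t w) w else None.

Section density_measure.
Context d (T : measurableType d) (R : realType).
Variables (m : {measure set T -> \bar R}) (f : T -> \bar R).
Local Open Scope ereal_scope.

Definition density (mf : measurable_fun setT f) (f0 : forall x, 0 <= f x)
  (A : set T) : \bar R := \int[m]_(x in A) f x.

Variables (mf : measurable_fun setT f) (f0 : forall x, 0 <= f x).

Let density_set0 : density mf f0 set0 = 0. Proof. exact: integral_set0. Qed.

Let density_ge0 A : 0 <= density mf f0 A. Proof. exact: integral_ge0. Qed.

Let density_sigma_additive : semi_sigma_additive (density mf f0).
Proof.
move=> F mF tF mUF; rewrite /density ge0_integral_bigcup//.
  by apply: is_cvg_nneseries => n _ _; exact: integral_ge0.
exact: measurable_funS mf.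
Qed.

HB.instance Definition _ := isMeasure.Build _ _ _ (density mf f0)
  density_set0 density_ge0 density_sigma_additive.

Lemma density_eq0 (A : set T) : measurable A -> (forall x, A x -> 0 < f x) ->
  density mf f0 A = 0 <-> m A = 0.
Proof.
move=> mA fA; split=> [|A0].
  rewrite /density => h.
  have : \int[m]_(x in A) `|f x| = 0.
    by rewrite -[RHS]h; apply: eq_integral => x _; rewrite gee0_abs.
  have mfA : measurable_fun A f by exact: measurable_funS mf.
  move=> /(ae_eq_integral_abs m mA mfA)[N [mN N0 AN]].
  apply/eqP; rewrite -measure_le0 -N0; apply: le_measure; rewrite ?inE//.
  move=> x Ax; apply: AN => /= /(_ Ax) fx.
  by have := fA x Ax; rewrite fx ltxx.
have := @integral_abs_eq0 _ _ _ m A f mA (measurable_funS measurableT (@subsetT _ _) mf) A0.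
by rewrite /density => <-; apply: eq_integral => x _; rewrite gee0_abs.
Qed.

End density_measure.

(** * The time change of a single path *)

Section time_change_paths.
Context {R : realType} {E : topologicalType}.
Hypotheses (hausE : hausdorff_space E) (lcE : locally_compact [set: E])
  (scE : @second_countable E).
Variable g : absorbed E -> R.
Hypotheses (gN : g None = 0) (gS : forall x : E, 0 < g (Some x))
  (gc : continuous g).
Implicit Types p : paths R E.
Local Notation mu := (@lebesgue_measure R).
Local Notation clk := (clock g (@pcoord R E)).
Local Notation tot := (total_clock g (@pcoord R E)).
Local Notation inv := (inverse_clock g (@pcoord R E)).
Local Notation tc := (time_change g (@pcoord R E)).

Lemma time_changeP t p : 0 <= t -> (t%:E < tot p)%E -> exists s,
  [/\ 0 <= s, pcoord s p <> None, clk s p = t%:E & tc t p = pcoord s p].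
Proof.
move=> t0 tt; have [s0 ps st] := inverse_clockP hausE lcE scE gN gS gc t0 tt.
by exists (inv t p); split => //; rewrite /time_change tt.
Qed.

Lemma time_change_clock s t p : 0 <= s -> pcoord s p <> None ->
  clk s p = t%:E -> (t%:E < tot p)%E /\ tc t p = pcoord s p.
Proof.
move=> s0 ps st.
have [tt ts] := inverse_clock_unique hausE lcE scE gN gS gc s0 ps st.
by rewrite /time_change tt ts.
Qed.

Lemma time_change_alive t p : 0 <= t -> (t%:E < tot p)%E <-> tc t p <> None.
Proof.
move=> t0; split=> [/(time_changeP t0)[s [_ ps _ ->]]//|].
by rewrite /time_change; case: ifPn.
Qed.

(** As [g] vanishes at [None], the domain of integration, which depends on the path, can be replaced
    by the half-line; this makes Tonelli's theorem available for measurability in [p]. *)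
Lemma total_clockE p :
  tot p = (\int[mu]_(u in `[0%R, +oo[) (g (pcoord u p))%:E)%E.
Proof.
rewrite /total_clock [LHS]integral_mkcond [RHS]integral_mkcond.
congr (integral _ _ _); apply/funext => u; rewrite !patchE alive_pathsE.
have [u0|u0] := leP 0 u; last first.
  rewrite !memNset//= ?in_itv /= ?andbT; first by rewrite leNgt u0.
  by rewrite leNgt u0 => -[].
rewrite [X in _ = if X then _ else _]mem_set/= ?in_itv/= ?u0//.
case: ifPn => // /negP pu.
case pE: (pcoord u p) => [x|]; last by rewrite gN.
by case: pu; apply/mem_set; split => //; rewrite pE.
Qed.

Lemma clock_le_total_clock s p : (clk s p <= tot p)%E.
Proof.
have -> : tot p =
    (\int[mu]_(u in `[0%R, +oo[) (g (pcoord (Num.max u 0) p))%:E)%E.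
  rewrite total_clockE; apply: eq_integral => u.
  by rewrite inE /= in_itv /= => /andP[u0 _]; rewrite max_l.
rewrite clockE; apply: ge0_subset_integral => //.
- exact: measurable_rate1.
- by move=> u _; rewrite lee_fin rate_ge0.
- by move=> u /=; rewrite !in_itv /= => /andP[->].
Qed.

Lemma inverse_clock_lt t r p : 0 <= t -> (t%:E < tot p)%E ->
  (inv t p < r) <-> (t%:E < clk r p)%E.
Proof.
move=> t0 tt; have [s0 ps <-] := inverse_clockP hausE lcE scE gN gS gc t0 tt.
split=> [sr|]; first exact: lt_clock.
by rewrite [(_ < r)]ltNge; apply: contraTN => rs; rewrite -leNgt le_clock.
Qed.

Lemma inverse_clock_ge0 t p : 0 <= t -> (t%:E < tot p)%E -> 0 <= inv t p.
Proof. by move=> t0 /(inverse_clockP hausE lcE scE gN gS gc t0)[]. Qed.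

Lemma le_inverse_clock s t p : 0 <= s -> s <= t -> (t%:E < tot p)%E ->
  inv s p <= inv t p.
Proof.
move=> s0 st tt; have t0 := le_trans s0 st.
have ss : (s%:E < tot p)%E by rewrite (le_lt_trans _ tt)// lee_fin.
rewrite leNgt; apply/negP => /((inverse_clock_lt _ t0 tt).1).
have [_ _ ->] := inverse_clockP hausE lcE scE gN gS gc s0 ss.
by rewrite lte_fin ltNge st.
Qed.

(** The clock is an increasing bijection from the alive times onto [[0, tot p[], so one-sided
    neighbourhoods of [s] and of [t = clk s] correspond; a witness [r] next to [s] is turned into a
    radius around [t] through [clk r]. *)
Lemma is_path_time_change p : is_path (tc ^~ p).
Proof.
split=> [t t0|s t s0 st|t t0].
- have [tt|tt] := ltP t%:E (tot p); last first.
    rewrite {2}/time_change ltNge tt /= => A /nbhs_singleton AN.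
    apply/near_at_rightP; exists 1 => // u tu _ /=.
    by rewrite /time_change ltNge (le_trans tt)//= lee_fin ltW.
  have [s [s0 ps st ->]] := time_changeP t0 tt.
  move=> A /(@pcoord_cvg _ _ p _ s0)/near_at_rightP[e e0 he].
  have [e' e'0 he'] := pcoord_near_alive s0 ps.
  (* Half the minimum keeps the path alive at [r] (radius [e']), so that its clock is finite there,
     and keeps [r] in the neighbourhood given by right continuity (radius [e]). *)
  pose r := s + Num.min e e' / 2.
  have m0 : 0 < Num.min e e' by rewrite lt_min e0.
  have sr : s < r by rewrite ltrDl divr_gt0.
  have rm : r < s + Num.min e e' by rewrite ltrD2l ltr_pdivrMr// ltr_pMr// ltr1n.
  have [re re'] : r < s + e /\ r < s + e'.
    by move: rm; rewrite -ltrBlDl lt_min !ltrBlDl => /andP[].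
  have pr := he' _ (ltW sr) re'.
  have fr := clock_fin_num hausE lcE scE gN gS gc pr.
  have tr : t < fine (clk r p).
    by rewrite -lte_fin fineK// -st lt_clock.
  apply/near_at_rightP; exists (fine (clk r p) - t); first by rewrite subr_gt0.
  move=> u tu; rewrite subrKC => ur; have u0 := le_trans t0 (ltW tu).
  have ut : (u%:E < tot p)%E.
    rewrite (lt_le_trans _ (clock_le_total_clock r p))// -(fineK fr).
    by rewrite lte_fin.
  have [v [v0 pv vu /= ->]] := time_changeP u0 ut.
  apply: he.
    rewrite ltNge; apply/negP => /(le_clock hausE lcE scE gN gS gc p).
    by rewrite vu st lee_fin leNgt tu.
  apply: le_lt_trans re; rewrite leNgt; apply/negP => rv.
  have /ltW := lt_clock hausE lcE scE gN gS gc (le_trans s0 (ltW sr)) rv pr.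
  by rewrite vu -(fineK fr) lee_fin leNgt ur.
- apply: contraPP => /((time_change_alive _ (le_trans s0 st)).2) tt.
  by apply/(time_change_alive _ s0).1; rewrite (le_lt_trans _ tt)// lee_fin.
- move=> /((time_change_alive _ (ltW t0)).2) tt.
  have [s [s0 ps st _]] := time_changeP (ltW t0) tt.
  have sgt0 : 0 < s.
    rewrite lt_neqAle s0 andbT; apply/eqP => s00.
    by move: st; rewrite -s00 clock0 => -[t00]; move: t0; rewrite -t00 ltxx.
  have [l pl] := pcoord_left_lim sgt0 ps; exists l => A /pl/near_at_leftP[e e0 he].
  pose r := Num.max 0 (s - e / 2).
  have e2 : 0 < e / 2 by rewrite divr_gt0.
  have e2e : e / 2 < e by rewrite ltr_pdivrMr// ltr_pMr// ltr1n.
  have r0 : 0 <= r by rewrite le_max lexx.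
  have rs : r < s by rewrite gt_max sgt0 gtrBl.
  have er : s - e < r by rewrite lt_max; apply/orP; right; lra.
  have pr := pcoord_alive r0 (ltW rs) ps.
  have fr := clock_fin_num hausE lcE scE gN gS gc pr.
  have tr : fine (clk r p) < t by rewrite -lte_fin fineK// -st lt_clock.
  apply/near_at_leftP; exists (t - fine (clk r p)); first by rewrite subr_gt0.
  move=> u; rewrite subKr => ru ut.
  have u0 : 0 <= u by rewrite (le_trans _ (ltW ru))// fine_ge0// clock_ge0.
  have utt : (u%:E < tot p)%E by rewrite (lt_trans _ tt)// lte_fin.
  have [v [v0 pv vu /= ->]] := time_changeP u0 utt.
  apply: he.
    apply: (lt_le_trans er); rewrite leNgt; apply/negP => vr.
    have /ltW := lt_clock hausE lcE scE gN gS gc v0 vr pv.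
    by rewrite vu -(fineK fr) lee_fin leNgt ru.
  rewrite ltNge; apply/negP => /(le_clock hausE lcE scE gN gS gc p).
  by rewrite vu st lee_fin leNgt ut.
Qed.

Definition tc_path p : paths R E := mkpath (tc ^~ p).

Lemma pcoord_tc_path t p : pcoord t (tc_path p) = tc t p.
Proof. by rewrite pcoord_mkpath//; exact: is_path_time_change. Qed.

Lemma measurable_total_clock : measurable_fun setT tot.
Proof.
rewrite (funext total_clockE).
apply: measurable_integral_functional => //.
- exact: measurable_rate.
- exact: rate_ge0.
- by move=> u /=; rewrite in_itv /= => /andP[].
Qed.

Lemma measurable_time_change t : 0 <= t -> measurable_fun setT (tc t).
Proof.
move=> t0; pose S p := if (t%:E < tot p)%E then inv t p else 0.
have mtt : measurable_fun setT (fun p => t%:E < tot p)%E.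
  by apply: measurable_fun_lte => //; exact: measurable_total_clock.
have S0 p : 0 <= S p by rewrite /S; case: ifPn => // tt; exact: inverse_clock_ge0.
have mS : measurable_fun setT S.
  apply: (measurability _ (RGenInftyO.measurableE R)) => _ [_ [r ->] <-].
  rewrite setTI; have [r0|r0] := leP r 0.
    rewrite (_ : _ @^-1` _ = set0)//; apply/seteqP; split=> // p /=.
    by rewrite in_itv /= ltNge (le_trans r0).
  rewrite (_ : _ @^-1` _ = [set p | (t%:E < clk r p)%E] `|` ~` [set p | (t%:E < tot p)%E]).
    apply: measurableU; last apply: measurableC.
    - rewrite -[X in measurable X]setTI; apply: measurable_lte => //.
      exact: measurable_clock.
    - rewrite -[X in measurable X]setTI; apply: measurable_lte => //.
      exact: measurable_total_clock.
  apply/seteqP; split=> p /=; rewrite in_itv /= /S; case: ifPn => tt.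
  - by move=> /((inverse_clock_lt _ t0 tt).1); left.
  - by right; apply/negP.
  - by move=> [/((inverse_clock_lt _ t0 tt).2)//|/(_ isT)].
  - by [].
rewrite (_ : tc t = fun p => if (t%:E < tot p)%E then pcoord (S p) p else None).
  apply: measurable_fun_ifT => //.
  exact: (measurable_pcoord_joint hausE lcE scE S0 mS (@measurable_id _ _ _)).
by apply/funext => p; rewrite /time_change /S; case: ifPn.
Qed.

Lemma measurable_tc_path : measurable_fun setT tc_path.
Proof.
apply: measurable_fun_paths => t t0.
by under eq_fun do rewrite pcoord_tc_path; exact: measurable_time_change.
Qed.

(** By [clockD] the clock of the shifted path is the old clock minus [t]. The second half checks
    that both sides die together: if the left one were alive, the clock of [p] would reach [t + s]
    at an alive time. *)
Lemma time_change_pshift s t p : 0 <= s -> 0 <= t -> (t%:E < tot p)%E ->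
  tc s (pshift (inv t p) p) = tc (t + s) p.
Proof.
move=> s0 t0 tt; have [r0 pr rt] := inverse_clockP hausE lcE scE gN gS gc t0 tt.
set r := inv t p in r0 pr rt *.
have [ts|ts] := ltP (t + s)%:E (tot p).
  have [v [v0 pv vts ->]] := time_changeP (addr_ge0 t0 s0) ts.
  have rv : r <= v.
    rewrite leNgt; apply/negP => vr.
    have := lt_clock hausE lcE scE gN gS gc v0 vr pv.
    by rewrite rt vts lte_fin ltNge lerDl s0.
  have vr0 : 0 <= v - r by rewrite subr_ge0.
  have pvr : pcoord (v - r) (pshift r p) = pcoord v p.
    by rewrite pcoord_shift// subrKC.
  have cvr : clk (v - r) (pshift r p) = s%:E.
    have := clockD hausE lcE scE gN gS gc p r0 vr0.
    rewrite subrKC vts rt => E1.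
    rewrite -[LHS](addeK (x := t%:E))// [X in (X - _)%E]addeC -E1 -EFinB.
    by congr _%:E; rewrite addrC addKr.
  by have [|_ ->] := time_change_clock vr0 _ cvr; rewrite pvr.
rewrite [RHS]/time_change ltNge ts /=.
case tE: (tc s (pshift r p)) => [x|//].
have ss : (s%:E < tot (pshift r p))%E.
  by apply/(time_change_alive _ s0); rewrite tE.
have [v [v0 pv vs _]] := time_changeP s0 ss.
have prv : pcoord (r + v) p <> None by rewrite -pcoord_shift.
have crv : clk (r + v) p = (t + s)%:E.
  by rewrite clockD// rt vs.
have [] := time_change_clock (addr_ge0 r0 v0) prv crv.
by rewrite ltNge ts.
Qed.

(** The hypotheses give [clk s p' = m / k * clk (k * s) p], whence the speed [k / m]. The direct
    part uses [k = 1], so that the level shift alone creates a speed; in the converse [k = m], and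
    the speed coming from self-similarity is cancelled exactly. *)
Lemma time_change_scale (p p' : paths R E) (h : E -> E) (k m : R) :
  0 < k -> 0 < m ->
  (forall u, 0 <= u -> pcoord u p' = omap h (pcoord (k * u) p)) ->
  (forall x, g (Some (h x)) = m * g (Some x)) ->
  forall t, 0 <= t -> tc t p' = omap h (tc (k / m * t) p).
Proof.
move=> k0 m0 pp' gh t t0.
have cE s : 0 <= s -> (clk s p' = (m / k)%:E * clk (k * s)%R p)%E.
  move=> s0; rewrite [in RHS]clockE.
  rewrite (_ : `[0, k * s]%classic = `[0, (0 + k * s)]%classic); last by rewrite add0r.
  rewrite -integral_affine//; last 2 first.
  - exact: measurable_rate1.
  - by move=> u; rewrite lee_fin rate_ge0.
  rewrite muleA -EFinM -mulrA mulVf ?gt_eqF// mulr1.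
  rewrite -ge0_integralZl//; last 3 first.
  - have mg : measurable_fun setT (fun u : R => (g (pcoord (Num.max u 0) p))%:E).
      exact: measurable_rate1.
    have mphi : measurable_fun setT (fun u : R => 0 + k * u).
      by apply: measurable_funD => //; exact: measurable_funM.
    exact: (measurable_funS measurableT (@subsetT _ _) (measurableT_comp mg mphi)).
  - by move=> u _; rewrite lee_fin rate_ge0.
  - by rewrite lee_fin ltW.
  apply: eq_integral => u; rewrite inE /= in_itv /= => /andP[u0 _].
  rewrite add0r max_l ?mulr_ge0 ?(ltW k0)// -EFinM pp'//.
  by case: (pcoord _ p) => [x|] /=; rewrite ?gh// gN mulr0.
have kmt : 0 <= k / m * t by rewrite mulr_ge0// divr_ge0// ltW.
have [tt|tt] := ltP (k / m * t)%:E (tot p).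
  have [s [s0 ps st ->]] := time_changeP kmt tt.
  have sk0 : 0 <= s / k by rewrite divr_ge0// ltW.
  have ksk : k * (s / k) = s by rewrite mulrCA mulfV ?gt_eqF// mulr1.
  have psk : pcoord (s / k) p' = omap h (pcoord s p) by rewrite pp'// ksk.
  have csk : clk (s / k) p' = t%:E.
    rewrite cE// ksk st -EFinM; congr _%:E.
    rewrite !mulrA -(mulrA m) mulVf ?gt_eqF// mulr1 mulfV ?gt_eqF//.
    by rewrite mul1r.
  have [|_ ->//] := time_change_clock sk0 _ csk.
  by rewrite psk; case: (pcoord s p) ps.
rewrite [in RHS]/time_change ltNge tt /=.
case tE: (tc t p') => [x|//].
have ss : (t%:E < tot p')%E by apply/(time_change_alive _ t0); rewrite tE.
have [v [v0 pv vs _]] := time_changeP t0 ss.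
have kv0 : 0 <= k * v by rewrite mulr_ge0// ltW.
have pkv : pcoord (k * v) p <> None by move: pv; rewrite pp'//; case: (pcoord _ p).
have ckv : clk (k * v) p = (k / m * t)%:E.
  rewrite EFinM -vs cE// muleA -EFinM mulrA divfK ?gt_eqF//.
  by rewrite mulfV ?gt_eqF// mul1e.
have [] := time_change_clock kv0 pkv ckv.
by rewrite ltNge tt.
Qed.

End time_change_paths.

(** * Occupation times under the time change *)

Section occupation.
Context {R : realType} {E : topologicalType}.
Hypotheses (hausE : hausdorff_space E) (lcE : locally_compact [set: E])
  (scE : @second_countable E).
Variable g : absorbed E -> R.
Hypotheses (gN : g None = 0) (gS : forall x : E, 0 < g (Some x))
  (gc : continuous g).
Implicit Types p : paths R E.
Local Notation mu := (@lebesgue_measure R).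
Local Notation clk := (clock g (@pcoord R E)).
Local Notation tot := (total_clock g (@pcoord R E)).
Local Notation tc := (time_change g (@pcoord R E)).
Local Open Scope ereal_scope.

(** [N] is covered by its pieces up to rational times at which the path is still alive; by
    [pcoord_near_alive] there is such a time beyond each point of [N]. *)
Lemma alive_null (N : set R) p : measurable N ->
  N `<=` [set u | (0 <= u)%R /\ pcoord u p <> None] ->
  (forall s, (0 <= s)%R -> pcoord s p <> None -> mu (N `&` `[0%R, s]) = 0) ->
  mu N = 0.
Proof.
move=> mN Nalive N0.
pose q (n : nat) : R := if (unpickle n : option rat) is Some r then ratr r else (-1)%R.
pose A n := if `[< (0 <= q n)%R /\ pcoord (q n) p <> None >]
  then N `&` `[0%R, q n] else set0.
have NA : N `<=` \bigcup_n A n.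
  move=> u Nu; have [u0 pu] := Nalive u Nu.
  have [e e0 he] := pcoord_near_alive u0 pu.
  have [|r ur] := @rat_in_itvoo R u (u + e)%R; first by rewrite ltrDl.
  move: ur; rewrite in_itv /= => /andP[ur re].
  have qr : q (pickle r) = ratr r by rewrite /q pickleK.
  exists (pickle r) => //; rewrite /A qr asboolT.
    by split => //=; rewrite in_itv /= u0 ltW.
  by split; [exact: le_trans u0 (ltW ur)|apply: he => //; exact: ltW].
have mA n : measurable (A n) by rewrite /A; case: ifP => // _; exact: measurableI.
apply/eqP; rewrite -measure_le0.
apply: (le_trans (measure_sigma_subadditive mu mA mN NA)).
rewrite eseries0// => n _ _.
rewrite /A; case: asboolP => [[q0 pq]|_]; last exact: measure0.
exact: N0.
Qed.

Lemma measurable_pcoord_preimage (B : set (absorbed E)) p : measurable B ->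
  measurable [set u : R | (0 <= u)%R /\ B (pcoord u p)].
Proof.
move=> mB.
have mp : measurable_fun setT (fun u : R => pcoord (Num.max u 0%R) p).
  apply: (measurable_pcoord_joint hausE lcE scE).
  - by move=> u; rewrite le_max lexx orbT.
  - exact: (measurable_maxr (@measurable_id _ _ _) (@measurable_cst _ _ _ _ _ _)).
  - exact: measurable_cst.
have -> : [set u : R | (0 <= u)%R /\ B (pcoord u p)] =
    `[0%R, +oo[ `&` (fun u : R => pcoord (Num.max u 0%R) p) @^-1` B.
  apply/seteqP; split=> u /=; rewrite in_itv /= andbT => -[u0]; by rewrite max_l.
by apply: measurableI => //; rewrite -[X in measurable X]setTI; exact: mp.
Qed.

(* Change of variables [t = clk u]: the image under the clock of the measure
   [g (p u) du] on [[0, s]] is Lebesgue measure on [[0, clk s p]]. *)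
Lemma time_change_occupation (B : set (absorbed E)) s t p : measurable B ->
  (0 <= s)%R -> pcoord s p <> None -> clk s p = t%:E ->
  mu ([set u | (0 <= u)%R /\ B (tc u p)] `&` `[0%R, t]) =
  \int[mu]_(u in [set u | (0 <= u)%R /\ B (pcoord u p)] `&` `[0%R, s])
    (g (pcoord (Num.max u 0%R) p))%:E.
Proof.
move=> mB s0 ps st.
pose gam (u : R) := (g (pcoord (Num.max u 0%R) p))%:E.
have mgam : measurable_fun setT gam by exact: measurable_rate1.
have gam0 u : 0 <= gam u by rewrite lee_fin rate_ge0.
(* The clock with its time clamped to [[0, s]]: a nondecreasing, hence measurable, map of the whole
   line. *)
pose c : R -> measurableTypeR R :=
  fun u => fine (clk (Num.min (Num.max u 0%R) s) p).
have alive_s u : (0 <= u)%R -> (u <= s)%R -> pcoord u p <> None.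
  by move=> u0 us; exact: pcoord_alive ps.
have cE u : (0 <= u)%R -> (u <= s)%R -> (c u)%:E = clk u p.
  move=> u0 us; rewrite /c max_l// min_l// fineK//.
  by apply: clock_fin_num => //; exact: alive_s.
have clipl w : (0 <= Num.min (Num.max w 0) s <= s)%R.
  by rewrite le_min s0 le_max lexx orbT ge_min lexx orbT.
have mc : measurable_fun [set: measurableTypeR R] c.
  apply: nondecreasing_measurable => // u v uv; rewrite /c.
  have fin w : clk (Num.min (Num.max w 0%R) s) p \is a fin_num.
    by have /andP[? ?] := clipl w; apply: clock_fin_num => //; exact: alive_s.
  apply: fine_le => //; apply: le_clock => //.
  by rewrite le_min !ge_min lexx orbT andbT ge_max !le_max uv lexx !orbT.
have ct u : (c u <= t)%R.
  have /andP[a b] := clipl u; rewrite -lee_fin -st fineK; last first.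
    by apply: clock_fin_num => //; exact: alive_s.
  exact: le_clock.
have ms : measurable (`[0%R, s]%classic : set R) by [].
have mt : measurable (`[0%R, t]%classic : set R) by [].
pose m1 : {measure set (measurableTypeR R) -> \bar R} :=
  mrestr (@lebesgue_measure R) mt.
pose m2 : {measure set (measurableTypeR R) -> \bar R} :=
  image_measure (mrestr (density mu mgam gam0) ms) mc.
have t0 : (0 <= t)%R by rewrite -lee_fin -st clock_ge0.
have m2E A : m2 A = \int[mu]_(u in (c @^-1` A) `&` `[0%R, s]) gam u by [].
have m1E A : m1 A = mu (A `&` `[0%R, t]) by [].
(* The two measures are compared on the rays []-oo, r[]. For [0 < r <= t] the preimage under the
   clock is [[0, v[] with [clk v = r], whose mass is [r] by definition of the clock; the other two
   cases give the empty set or everything. *)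
have m12 (A : set (measurableTypeR R)) : measurable A -> m1 A = m2 A.
  apply: (@measure_unique _ _ (measurableTypeR R) (@RGenInftyO.G R) (fun n => `]-oo, n%:R[%classic)).
  - exact: RGenInftyO.measurableE.
  - move=> _ _ [x ->] [y ->]; exists (Num.min x y); apply/seteqP.
    by split=> z /=; rewrite !in_itv /= lt_min => /andP.
  - by move=> n; exists n%:R.
  - apply/seteqP; split=> // x _; exists (Num.truncn x).+1 => //=.
    by rewrite in_itv /= truncnS_gt.
  - move=> _ [r ->]; rewrite m2E m1E.
    have [r0|r0] := leP r 0%R.
      rewrite (_ : _ `&` _ = set0) ?measure0; last first.
        apply/seteqP; split=> // x /=; rewrite !in_itv /= => -[xr /andP[x0 _]].
        by move: xr; rewrite ltNge (le_trans r0).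
      rewrite (_ : _ `&` _ = set0) ?integral_set0//.
      apply/seteqP; split=> // x /=; rewrite !in_itv /= => -[xr /andP[x0 _]].
      by move: xr; rewrite ltNge (le_trans r0)// fine_ge0// clock_ge0.
    have [rt|tr] := leP r t.
      have rs : r%:E <= clk s p by rewrite st lee_fin.
      have [v [v0 vs vr]] := clock_surj hausE lcE scE gN gS gc s0 ps (ltW r0) rs.
      have -> : `]-oo, r[%classic `&` `[0%R, t] = `[0%R, r[%classic :> set R.
        apply/seteqP; split=> x /=; rewrite !in_itv /=.
          by move=> [xr /andP[-> _]].
        by move=> /andP[-> xr]; split => //; rewrite (le_trans (ltW xr)).
      have -> : (c @^-1` `]-oo, r[%classic) `&` `[0%R, s] = `[0%R, v[%classic :> set R.
        apply/seteqP; split=> x /=; rewrite !in_itv /=.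
          move=> [xr /andP[x0 xs]]; rewrite x0 ltNge; apply/negP => vx.
          have := le_clock hausE lcE scE gN gS gc p vx.
          by rewrite vr -cE// lee_fin leNgt xr.
        move=> /andP[x0 xv]; have xs := le_trans (ltW xv) vs.
        split; last by rewrite x0.
        by rewrite -lte_fin cE// -vr lt_clock//; exact: alive_s.
      rewrite integral_itv_bndo_bndc; last exact: measurable_rate1.
      rewrite -[RHS](clockE g v p) vr lebesgue_measure_itv /= lte_fin r0.
      by rewrite -EFinB subr0.
    have -> : `]-oo, r[%classic `&` `[0%R, t] = `[0%R, t]%classic :> set R.
      apply/seteqP; split=> x /=; rewrite !in_itv /=; first by case.
      by move=> /andP[-> xt]; split => //; exact: le_lt_trans tr.
    have -> : (c @^-1` `]-oo, r[%classic) `&` `[0%R, s] = `[0%R, s]%classic :> set R.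
      apply/seteqP; split=> x /=; rewrite !in_itv /=; first by case.
      by move=> h; split => //; exact: le_lt_trans (ct x) tr.
    rewrite -[RHS](clockE g s p) st lebesgue_measure_itv /= lte_fin.
    have := t0; rewrite le_eqVlt => /predU1P[<-|->]; first by rewrite ltxx.
    by rewrite oppr0 adde0.
  - move=> n; apply: (@le_lt_trans _ _ (mu `[0%R, t]%classic)).
      by apply: le_measure; rewrite ?inE//; exact: measurableI.
    by rewrite lebesgue_measure_itv /=; case: ifP => _; rewrite ltry.
have mA : measurable [set u : R | (0 <= u)%R /\ B (tc u p)].
  have := measurable_pcoord_preimage (tc_path g p) mB.
  congr (measurable _); apply/seteqP.
  by split=> u /=; rewrite pcoord_tc_path.
have := m12 _ mA; rewrite m2E => h; rewrite [LHS]h.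
congr (integral _ _ _); apply/seteqP; split=> u /=; rewrite in_itv /=.
  move=> [[cu Bu] /andP[u0 us]]; rewrite u0; split => //; split => //.
  have := time_change_clock hausE lcE scE gN gS gc u0 (alive_s u u0 us) (esym (cE u u0 us)).
  by move=> [_ <-].
move=> [[u0 Bu] /andP[_ us]]; rewrite u0; split => //.
have := time_change_clock hausE lcE scE gN gS gc u0 (alive_s u u0 us) (esym (cE u u0 us)).
by move=> [_ ->]; split => //; rewrite fine_ge0// clock_ge0.
Qed.

(** Up to an alive time [s], the occupation formula writes the measure of the first set as an
    integral of the rate over the second, and the rate is positive there because [B] avoids [None].
    [alive_null] then removes the bound [s] on either side. *)
Lemma time_change_null (B : set (absorbed E)) p : measurable B -> ~ B None ->
  mu [set u | (0 <= u)%R /\ B (tc u p)] = 0 <->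
  mu [set u | (0 <= u)%R /\ B (pcoord u p)] = 0.
Proof.
move=> mB BN.
set Nt := [set u | _ /\ B (tc u p)]; set Np := [set u | _ /\ B (pcoord u p)].
have mNp : measurable Np by exact: measurable_pcoord_preimage.
have NtE : Nt = [set u | (0 <= u)%R /\ B (pcoord u (tc_path g p))].
  by apply/seteqP; split=> u /=; rewrite pcoord_tc_path.
have mNt : measurable Nt by rewrite NtE; exact: measurable_pcoord_preimage.
pose gam (u : R) := (g (pcoord (Num.max u 0%R) p))%:E.
have mgam : measurable_fun setT gam by exact: measurable_rate1.
have gam0 u : 0 <= gam u by rewrite lee_fin rate_ge0.
have gam_gt0 s u : (Np `&` `[0%R, s]) u -> 0 < gam u.
  move=> [[u0 Bu] _]; rewrite /gam max_l// lte_fin.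
  by case: (pcoord u p) Bu => [x|].
have main s t : (0 <= s)%R -> pcoord s p <> None -> clk s p = t%:E ->
    mu (Nt `&` `[0%R, t]) = 0 <-> mu (Np `&` `[0%R, s]) = 0.
  move=> s0 ps st; rewrite (time_change_occupation mB s0 ps st).
  have mNps : measurable (Np `&` `[0%R, s]) by exact: measurableI.
  exact: (density_eq0 mu mgam gam0 mNps (gam_gt0 s)).
have sub0 (N D : set R) : measurable N -> measurable D -> mu N = 0 -> mu (N `&` D) = 0.
  move=> mN mD N0; apply/eqP; rewrite -measure_le0 -N0.
  by apply: le_measure; rewrite ?inE//; exact: measurableI.
split=> N0.
  apply: (alive_null (p := p)) => //.
    by move=> u [u0 Bu]; split => // pu; rewrite pu in Bu.
  move=> s s0 ps.
  have fs := clock_fin_num hausE lcE scE gN gS gc ps.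
  by apply/(main s _ s0 ps (esym (fineK fs))); exact: sub0.
apply: (alive_null (p := tc_path g p)) => //.
  by rewrite NtE => u [u0 Bu]; split => // pu; rewrite pu in Bu.
move=> t t0; rewrite pcoord_tc_path// => pt.
have tt := (time_change_alive hausE lcE scE gN gS gc p t0).2 pt.
have [s [s0 ps st _]] := time_changeP hausE lcE scE gN gS gc t0 tt.
by apply/(main s t s0 ps st); exact: sub0.
Qed.

End occupation.

Lemma measurable_None {E : topologicalType} : measurable [set (None : absorbed E)].
Proof.
apply: measurable_absorbedP.
rewrite (_ : _ @^-1` _ = set0); first exact: sigma_algebra0.
by apply/seteqP; split.
Qed.

Lemma eq_ereal_lt {R : realDomainType} (x y : \bar R) : (0 <= x)%E -> (0 <= y)%E ->
  (forall t : R, 0 <= t -> (t%:E < x)%E <-> (t%:E < y)%E) -> x = y.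
Proof.
have main (a b : \bar R) : (0 <= a)%E -> (0 <= b)%E ->
    (forall t : R, 0 <= t -> (t%:E < a)%E -> (t%:E < b)%E) -> (a <= b)%E.
  move=> a0 b0 h; rewrite leNgt; apply/negP => ba.
  have fb : b \is a fin_num by rewrite ge0_fin_numE// (lt_le_trans ba)// leey.
  have := h (fine b) (fine_ge0 b0); rewrite fineK// ltxx => /(_ ba).
  by [].
move=> x0 y0 h; apply/eqP; rewrite eq_le; apply/andP.
by split; apply: main => // t t0 /(h t t0).
Qed.

Section more_filtration.
Context {R : realType} {E : topologicalType}.
Context {disp : measure_display} {Omega : measurableType disp}.
Variables (P : absorbed E -> probability Omega R) (F : R -> set (set Omega)).
Hypothesis FF : filtration P F.
Implicit Types (T : Omega -> \bar R) (A : set Omega).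

Lemma stopping_time_of_lt T : (forall w, (0 <= T w)%E) ->
  (forall t, 0 < t -> F t [set w | (T w < t%:E)%E]) -> stopping_time F T.
Proof.
move=> T0 FT; split=> // t t0; rewrite -[X in F t X]setTI.
by apply: (filtration_right_limit FF) => // u u0; rewrite setTI; exact: FT.
Qed.

Lemma stopped_sigma_of_lt T A : measurable A ->
  (forall t, 0 < t -> F t (A `&` [set w | (T w < t%:E)%E])) ->
  stopped_sigma F T A.
Proof. by move=> mA FA; split => //; exact: (filtration_right_limit FF). Qed.

Lemma stopped_sigma_eval_default (Z : R -> Omega -> absorbed E) T (V : Type)
    (h : absorbed E -> V) (c : V) (C : set V) :
  hausdorff_space E -> locally_compact [set: E] -> @second_countable E ->
  (forall t B, 0 <= t -> measurable B -> F t (Z t @^-1` B)) ->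
  (forall w t, 0 <= t -> Z u w @[u --> t^'+] --> Z t w) ->
  stopping_time F T -> measurable (h @^-1` C) ->
  stopped_sigma F T
    ((fun w => if (T w < +oo)%E then h (Z (fine (T w)) w) else c) @^-1` C).
Proof.
move=> hE lE sE adZ rcZ sT mC.
have sa := sigma_algebra_stopped_sigma FF sT.
have gE A : @measurable _ (g_sigma_algebraType (stopped_sigma F T)) A =
    stopped_sigma F T A by rewrite measurable_g_measurableTypeE.
have F1 : stopped_sigma F T [set w | (T w < +oo)%E /\ (h @^-1` C) (Z (fine (T w)) w)].
  exact: (stopped_sigma_eval FF hE lE sE adZ rcZ sT mC).
have F2 : stopped_sigma F T (~` [set w | (T w < +oo)%E]).
  by rewrite -gE; apply: measurableC; rewrite gE; exact: (stopped_sigma_fin FF sT).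
have [Cc|Cc] := pselect (C c); last first.
  rewrite (_ : _ @^-1` _ =
      [set w | (T w < +oo)%E /\ (h @^-1` C) (Z (fine (T w)) w)])//.
  by apply/seteqP; split=> w /=; case: ifPn => // _ [].
rewrite (_ : _ @^-1` _ = [set w | (T w < +oo)%E /\ (h @^-1` C) (Z (fine (T w)) w)] `|`
  ~` [set w | (T w < +oo)%E]).
  by rewrite -gE; apply: measurableU; rewrite gE.
apply/seteqP; split=> w /=; case: ifPn => // Tw; [by left|by right|].
by move=> [[]|/(_ isT)].
Qed.

End more_filtration.

(** * Time change of a Markov process *)

Section process_paths.
Context {R : realType} {E : topologicalType}.
Context {d1 : measure_display} {O1 : measurableType d1}.
Context {d2 : measure_display} {O2 : measurableType d2}.
Variables (g : absorbed E -> R) (Z1 : R -> O1 -> absorbed E)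
  (Z2 : R -> O2 -> absorbed E) (w1 : O1) (w2 : O2).
Hypothesis Z12 : forall t, Z1 t w1 = Z2 t w2.

Lemma eq_lifetime : lifetime Z1 w1 = lifetime Z2 w2.
Proof.
rewrite /lifetime; congr (ereal_inf (_ @` _)).
by apply/seteqP; split=> t /=; rewrite Z12.
Qed.

Lemma eq_clock s : clock g Z1 s w1 = clock g Z2 s w2.
Proof. by apply: eq_integral => u _; rewrite Z12. Qed.

Lemma eq_total_clock : total_clock g Z1 w1 = total_clock g Z2 w2.
Proof.
rewrite /total_clock (_ : alive Z1 w1 = alive Z2 w2).
  by apply: eq_integral => u _; rewrite Z12.
by rewrite /alive eq_lifetime.
Qed.

Lemma eq_inverse_clock t : inverse_clock g Z1 t w1 = inverse_clock g Z2 t w2.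
Proof.
rewrite /inverse_clock; congr inf.
by apply/seteqP; split=> s /=; rewrite eq_clock.
Qed.

Lemma eq_time_change t : time_change g Z1 t w1 = time_change g Z2 t w2.
Proof. by rewrite /time_change eq_total_clock eq_inverse_clock Z12. Qed.

End process_paths.

Section time_change_process.
Context {R : realType} {E : topologicalType}.
Context {disp : measure_display} {Omega : measurableType disp}.
Variables (P : absorbed E -> probability Omega R) (F : R -> set (set Omega)).
Variable Z : R -> Omega -> absorbed E.
Hypothesis H : markov_process P F Z.
Variable g : absorbed E -> R.
Hypotheses (gN : g None = 0) (gS : forall x : E, 0 < g (Some x))
  (gc : continuous g).
Implicit Types (T : Omega -> \bar R) (A : set Omega).

Let FF := mp_filtration H.
Let hausE := mp_hausdorff H.
Let lcE := mp_locally_compact H.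
Let scE := mp_second_countable H.
Local Notation Y := (time_change g Z).
Local Notation mu := (@lebesgue_measure R).

Let pZ t w : Z t w = pcoord t (pathof Z w).
Proof. by rewrite (pcoord_pathof H). Qed.

Let clockE' s w : clock g Z s w = clock g (@pcoord R E) s (pathof Z w).
Proof. by apply: eq_clock => t; exact: pZ. Qed.

Let totE w : total_clock g Z w = total_clock g (@pcoord R E) (pathof Z w).
Proof. by apply: eq_total_clock => t; exact: pZ. Qed.

Let invE t w : inverse_clock g Z t w = inverse_clock g (@pcoord R E) t (pathof Z w).
Proof. by apply: eq_inverse_clock => u; exact: pZ. Qed.

Lemma time_change_pathof t w : Y t w = time_change g (@pcoord R E) t (pathof Z w).
Proof. by apply: eq_time_change => u; exact: pZ. Qed.

Lemma is_path_time_change_process w : is_path (Y ^~ w).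
Proof.
rewrite (_ : Y ^~ w = time_change g (@pcoord R E) ^~ (pathof Z w)).
  exact: (is_path_time_change hausE lcE scE gN gS gc).
by apply/funext => t; rewrite time_change_pathof.
Qed.

Lemma pathof_time_change w : pathof Y w = tc_path g (pathof Z w).
Proof.
apply: paths_inj => t; rewrite (pcoord_tc_path hausE lcE scE gN gS gc).
by rewrite pcoord_mkpath ?time_change_pathof//; exact: is_path_time_change_process.
Qed.

Lemma pcoord_pathof_time_change t w : pcoord t (pathof Y w) = Y t w.
Proof. by rewrite pcoord_mkpath//; exact: is_path_time_change_process. Qed.

Lemma time_change_lt_lifetime t w : 0 <= t ->
  (t%:E < lifetime Y w)%E <-> Y t w <> None.
Proof.
move=> t0; rewrite (@eq_lifetime _ _ _ _ _ _ Y (@pcoord R E) w (pathof Y w)).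
  by rewrite lt_lifetime_paths// pcoord_pathof_time_change.
by move=> u; rewrite pcoord_pathof_time_change.
Qed.

Lemma lifetime_time_change w : lifetime Y w = total_clock g Z w.
Proof.
apply: eq_ereal_lt.
- by apply: le_ereal_inf_tmp => _ [t [t0 _] <-]; rewrite lee_fin.
- apply: integral_ge0 => u _; rewrite lee_fin; exact: rate_ge0.
- move=> t t0; rewrite time_change_lt_lifetime// time_change_pathof totE.
  by rewrite (time_change_alive hausE lcE scE gN gS gc).
Qed.

(** The value [+oo] beyond the total clock, where [inverse_clock] is meaningless, lets
    [change_time_lt] hold without any restriction on the total; this is how it becomes a stopping
    time. *)
Definition change_time (t : R) (w : Omega) : \bar R :=
  if (t%:E < total_clock g Z w)%E then (inverse_clock g Z t w)%:E else +oo%E.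

Lemma change_time_lt t r w : 0 <= t ->
  (change_time t w < r%:E)%E <-> (t%:E < clock g Z r w)%E.
Proof.
move=> t0; rewrite /change_time totE invE clockE'; case: ifPn => tt.
  by rewrite lte_fin (inverse_clock_lt hausE lcE scE gN gS gc).
split=> [|tr]; first by rewrite ltNge leey.
move: tt; rewrite (lt_le_trans tr)//.
exact: (clock_le_total_clock hausE lcE scE gN gS gc).
Qed.

Lemma change_time_fin t w : (change_time t w < +oo)%E = (t%:E < total_clock g Z w)%E.
Proof. by rewrite /change_time; case: ifPn => _; rewrite ?ltry ?ltxx. Qed.

Lemma change_time_ge0 t w : 0 <= t -> (0 <= change_time t w)%E.
Proof.
move=> t0; rewrite /change_time totE invE; case: ifPn => // tt.
by rewrite lee_fin (inverse_clock_ge0 hausE lcE scE gN gS gc).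
Qed.

Lemma le_change_time s t w : 0 <= s -> s <= t ->
  (change_time s w <= change_time t w)%E.
Proof.
move=> s0 st; rewrite /change_time totE !invE.
case: (ltP t%:E _) => tt; last by rewrite leey.
rewrite (le_lt_trans _ tt) ?lee_fin//.
exact: (le_inverse_clock hausE lcE scE gN gS gc).
Qed.

Lemma time_change_change_time t w : Y t w =
  if (change_time t w < +oo)%E then Z (fine (change_time t w)) w else None.
Proof. by rewrite change_time_fin /change_time /time_change; case: ifPn. Qed.

(** Tonelli's theorem on [Omega] with the sigma-field [F r]: the clock at [r] only reads the process
    frozen at [r], which is [F r]-measurable at all times. *)
Lemma clock_adapted t r : 0 <= r -> F r [set w | (t%:E < clock g Z r w)%E].
Proof.
move=> r0; pose Fr := g_sigma_algebraType (F r).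
pose V (u : R) (w : Fr) := Z (Num.min u r) w.
have mV u : 0 <= u -> measurable_fun [set: Fr] (V u).
  move=> u0 _ C mC; rewrite setTI (filtration_measurableE FF)//.
  have m0 : 0 <= Num.min u r by rewrite le_min u0.
  apply: (filtrationS FF m0); [by rewrite ge_min lexx orbT|].
  exact: (mp_adapted H m0 mC).
have rcV u (w : Fr) : 0 <= u -> V s w @[s --> u^'+] --> V u w.
  move=> u0; have [tu|ut] := leP r u.
    rewrite /V min_r// => C /nbhs_singleton C0; apply/near_at_rightP.
    by exists 1 => // y uy _; rewrite /= min_r// (le_trans tu)// ltW.
  rewrite /V min_l ?ltW// => C /(mp_right_cont H u0)/near_at_rightP[e e0 h].
  apply/near_at_rightP; exists (Num.min e (r - u)).
    by rewrite lt_min e0 subr_gt0.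
  move=> y uy; rewrite -ltrBlDl lt_min => /andP[ye yt].
  by rewrite /= min_l; [apply: h => //; lra|lra].
have mgV : measurable_fun setT (fun uw : R * Fr => g (V (Num.max uw.1 0) uw.2)).
  apply: measurableT_comp; first exact: (measurable_rate gc).
  exact: (measurable_fun_right_continuous_pos hausE lcE scE mV rcV).
pose f (up : R * Fr) := (\1_`[0, r] up.1 * g (V (Num.max up.1 0) up.2))%:E.
have mf : measurable_fun setT f.
  apply/measurable_EFinP; apply: measurable_funM => //.
  have m1 : measurable_fun setT (\1_`[0, r] : R -> R) by exact: measurable_indic.
  exact: (measurableT_comp m1 (@measurable_fst _ _ _ _)).
have f0 up : (0 <= f up)%E.
  by rewrite lee_fin mulr_ge0//; exact: rate_ge0.
have := @measurable_fun_fubini_tonelli_G _ _ _ _ _ mu _ mf f0.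
have -> : fubini_G mu f = clock g Z r.
  apply/funext => w; rewrite /fubini_G /clock [RHS]integral_mkcond.
  apply: eq_integral => u _; rewrite /f patchE /= indicE.
  case: ifPn => [uD|]; rewrite ?mul1r ?mul0r//.
  move: uD; rewrite inE /= in_itv /= => /andP[u0 ur].
  by rewrite max_l// /V min_l.
move=> mc; rewrite -(filtration_measurableE FF)//.
by rewrite -[X in measurable X]setTI; apply: measurable_lte.
Qed.

Lemma stopping_time_change_time t : 0 <= t -> stopping_time F (change_time t).
Proof.
move=> t0; apply: (stopping_time_of_lt FF) => [w|r r0].
  exact: change_time_ge0.
rewrite (_ : [set _ | _] = [set w | (t%:E < clock g Z r w)%E]).
  by apply: clock_adapted; exact: ltW.
by apply/seteqP; split=> w /=; rewrite change_time_lt.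
Qed.

Definition change_filtration (t : R) : set (set Omega) :=
  stopped_sigma F (change_time t).

Lemma filtration_change : filtration P change_filtration.
Proof.
split.
- move=> t t0; apply: (sigma_algebra_stopped_sigma FF).
  exact: stopping_time_change_time.
- by move=> t t0 A [].
- move=> s t s0 st A; apply: (stopped_sigmaS FF).
    by apply: stopping_time_change_time; exact: le_trans st.
  by move=> w; exact: le_change_time.
- move=> t t0 A GA; have mA : measurable A.
    by have [] := GA (t + 1) (ltr_pwDr ltr01 (lexx t)).
  apply: (stopped_sigma_of_lt FF) => // r r0.
  (* [change_time t w < r] means that [t] is strictly below the clock at [r], so it persists at some
     later time [t + 1/(n+1)], where the hypothesis on [A] applies. *)
  rewrite (_ : _ `&` _ = \bigcup_n (A `&`
      [set w | (change_time (t + n.+1%:R^-1) w < r%:E)%E])).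
    apply: (filtration_bigcup FF) => [|n]; first exact: ltW.
    apply: (stopped_sigma_lt FF); last exact: ltW.
      by apply: stopping_time_change_time; rewrite addr_ge0.
    by apply: GA => /=; rewrite ltrDl.
  apply/seteqP; split=> w /=; last first.
    move=> [n _ [Aw tr]]; split => //; apply: le_lt_trans tr.
    by apply: le_change_time => //; rewrite lerDl.
  move=> [Aw /((change_time_lt _ _ t0).1) tr].
  have [r' tr' rr'] : exists2 r' : R, t < r' & (r'%:E <= clock g Z r w)%E.
    case: (clock g Z r w) tr => [c| |] //=; first by exists c.
    by exists (t + 1); rewrite ?ltrDl// leey.
  have rt : 0 < r' - t by rewrite subr_gt0.
  have [N _ /(_ N (leqnn N)) /= h] := near_infty_natSinv_lt (PosNum rt).
  exists N => //; split => //=; apply/change_time_lt; first by rewrite addr_ge0.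
  by apply: lt_le_trans rr'; rewrite lte_fin -ltrBrDl.
- exact: (filtration_complete_top FF).
- move=> t t0 A hA; have mA : measurable A.
    apply: (filtration_complete_top FF) => nu.
    by have [B [N [[mB _] mN AB n0]]] := hA nu; exists B, N.
  split => // r r0; apply: (filtration_complete FF r0) => nu.
  have [B [N [[mB GB] mN AB n0]]] := hA nu.
  (* The null set stays the same: intersecting [A] and [B] with one event can only shrink their
     symmetric difference. *)
  exists (B `&` [set w | (change_time t w <= r%:E)%E]), N; split => //.
    exact: GB.
  apply: subset_trans AB => w /= [[[Aw tw] nB]|[[Bw tw] nA]].
    by left; split => // h; apply: nB.
  by right; split => // h; apply: nA.
Qed.

Lemma time_change_adapted t B : 0 <= t -> measurable B ->
  change_filtration t (Y t @^-1` B).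
Proof.
move=> t0 mB.
rewrite (_ : Y t = fun w => if (change_time t w < +oo)%E
    then id (Z (fine (change_time t w)) w) else None).
  exact: (stopped_sigma_eval_default FF (h := id) _ hausE lcE scE
    (mp_adapted H) (mp_right_cont H) (stopping_time_change_time t0) mB).
by apply/funext => w; rewrite time_change_change_time.
Qed.

Lemma time_change0 w : Y 0 w = Z 0 w.
Proof.
rewrite time_change_pathof pZ; case pE: (pcoord 0 (pathof Z w)) => [x|].
  have p0 : pcoord 0 (pathof Z w) <> None by rewrite pE.
  have [_ ->//] := time_change_clock hausE lcE scE gN gS gc (lexx _) p0 (clock0 _ _).
case tE : (time_change _ _ _ _) => [x|//].
have := (time_change_alive hausE lcE scE gN gS gc (pathof Z w) (lexx 0)).2.
rewrite tE => /(_ _)[]// /(time_changeP hausE lcE scE gN gS gc (lexx 0))[s [s0 + _ _]].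
by have := pcoord_absorbing (lexx 0) s0 pE.
Qed.

Lemma time_change_right_cont w t : 0 <= t -> Y u w @[u --> t^'+] --> Y t w.
Proof. exact: (path_right_cont (is_path_time_change_process w)). Qed.

Lemma time_change_absorbing w s t : 0 <= s -> s <= t -> Y s w = None -> Y t w = None.
Proof. exact: (path_absorbing (is_path_time_change_process w)). Qed.

End time_change_process.

Lemma eq_integral_eq0 d (T : measurableType d) (R : realType)
    (m : {measure set T -> \bar R}) (f h : T -> \bar R) :
  measurable_fun setT f -> measurable_fun setT h ->
  (forall x, 0 <= f x)%E -> (forall x, 0 <= h x)%E ->
  (forall x, f x = 0%E <-> h x = 0%E) ->
  (\int[m]_x f x = 0)%E <-> (\int[m]_x h x = 0)%E.
Proof.
have main (u v : T -> \bar R) : measurable_fun setT u -> measurable_fun setT v ->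
  (forall x, 0 <= u x)%E -> (forall x, 0 <= v x)%E ->
  (forall x, u x = 0%E -> v x = 0%E) ->
  (\int[m]_x u x = 0)%E -> (\int[m]_x v x = 0)%E.
  move=> mu mv u0 v0 uv Iu.
  have /(ae_eq_integral_abs m measurableT mu) au : (\int[m]_x `|u x| = 0)%E.
    by rewrite -[RHS]Iu; apply: eq_integral => x _; rewrite gee0_abs.
  transitivity (\int[m]_x `|v x|)%E.
    by apply: eq_integral => x _; rewrite gee0_abs.
  apply/(ae_eq_integral_abs m measurableT mv).
  by apply: filterS au => x + _ => /(_ I) /uv.
by move=> mf mh f0 h0 fh; split; apply: main => // x /fh.
Qed.

Section strong_markov_time_change.
Context {R : realType} {E : topologicalType}.
Context {disp : measure_display} {Omega : measurableType disp}.
Variables (P : absorbed E -> probability Omega R) (F : R -> set (set Omega)).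
Variable Z : R -> Omega -> absorbed E.
Hypothesis H : markov_process P F Z.
Variable g : absorbed E -> R.
Hypotheses (gN : g None = 0) (gS : forall x : E, 0 < g (Some x))
  (gc : continuous g).
Implicit Types (T : Omega -> \bar R) (A : set Omega).

Let FF := mp_filtration H.
Let hausE := mp_hausdorff H.
Let lcE := mp_locally_compact H.
Let scE := mp_second_countable H.
Local Notation Y := (time_change g Z).
Local Notation mu := (@lebesgue_measure R).
Local Notation G := (change_filtration F Z g).
Local Notation tau := (change_time Z g).
Let GG := filtration_change H gN gS gc.

Lemma measurable_pathof_time_change : measurable_fun setT (pathof Y).
Proof.
rewrite (funext (pathof_time_change H gN gS gc)).
exact: (measurableT_comp (measurable_tc_path hausE lcE scE gN gS gc)
  (measurable_pathof H)).
Qed.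

Lemma measurable_integral_time_change (f : paths R E -> \bar R) :
  measurable_fun setT f -> (forall p, 0 <= f p)%E ->
  measurable_fun setT (fun x => \int[P x]_w f (pathof Y w))%E.
Proof.
move=> mf f0; under eq_fun do under eq_integral do rewrite (pathof_time_change H gN gS gc).
apply: (measurable_integral_pathof H (f := fun p => f (tc_path g p))) => //.
exact: (measurableT_comp mf (measurable_tc_path hausE lcE scE gN gS gc)).
Qed.

Lemma measurable_time_change_process t : 0 <= t -> measurable_fun setT (Y t).
Proof.
move=> t0; rewrite -(funext (pcoord_pathof_time_change H gN gS gc t)).
exact: (measurableT_comp (measurable_pcoord t0) measurable_pathof_time_change).
Qed.

(* This is [tau_T]. *)
Definition change_stopping T (w : Omega) : \bar R :=
  if (T w < +oo)%E then tau (fine (T w)) w else +oo%E.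

Let q (n : nat) : R :=
  if (unpickle n : option rat) is Some r then Num.max 0 (ratr r) else 0.

Let q0 n : 0 <= q n.
Proof. by rewrite /q; case: unpickle => // r; rewrite le_max lexx. Qed.

Lemma change_stopping_ltE T r : stopping_time G T ->
  [set w | (change_stopping T w < r%:E)%E] =
  \bigcup_n ([set w | (T w <= (q n)%:E)%E] `&` [set w | (tau (q n) w < r%:E)%E]).
Proof.
move=> sT; apply/seteqP; split=> w /=; last first.
  move=> [n _ [/= Tq tq]]; have Tf : (T w < +oo)%E by rewrite (le_lt_trans Tq)// ltry.
  rewrite /change_stopping Tf; apply: le_lt_trans tq.
  apply: (le_change_time H gN gS gc); first exact: (fine_stopping_ge0 w sT).
  by rewrite -lee_fin fineK// ge0_fin_numE// (sT.1).
rewrite /change_stopping; case: ifPn => [Tf|_]; last by rewrite ltNge leey.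
have fT0 := fine_stopping_ge0 w sT.
move=> /((change_time_lt H gN gS gc r w fT0).1) Tr.
(* [T w] is strictly below the clock at [r], so a rational fits in between; the real [r'] stands in
   for the clock, which may be [+oo]. *)
have [r' tr' rr'] : exists2 r' : R, fine (T w) < r' & (r'%:E <= clock g Z r w)%E.
  case: (clock g Z r w) Tr => [c| |] //=; first by exists c.
  by exists (fine (T w) + 1); rewrite ?ltrDl// leey.
have [c] := @rat_in_itvoo R _ _ tr'.
rewrite in_itv /= => /andP[Tc cr'].
have qc : q (pickle c) = ratr c.
  by rewrite /q pickleK max_r// (le_trans fT0)// ltW.
exists (pickle c) => //; rewrite qc; split => /=.
  by rewrite -[T w]fineK ?lee_fin ?ltW// ge0_fin_numE// (sT.1).
apply/(change_time_lt H gN gS gc); first by rewrite (le_trans fT0)// ltW.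
by apply: lt_le_trans rr'; rewrite lte_fin.
Qed.

Lemma change_stopping_sigma_lt T A r : stopping_time G T -> 0 < r ->
  stopped_sigma G T A -> F r (A `&` [set w | (change_stopping T w < r%:E)%E]).
Proof.
move=> sT r0 [mA GA]; rewrite change_stopping_ltE// setI_bigcupr.
apply: (filtration_bigcup FF) => [|n]; first exact: ltW.
rewrite setIA; apply: (stopped_sigma_lt FF); last exact: ltW.
  exact: (stopping_time_change_time H gN gS gc).
exact: GA.
Qed.

Lemma stopping_time_change_stopping T : stopping_time G T ->
  stopping_time F (change_stopping T).
Proof.
move=> sT; apply: (stopping_time_of_lt FF) => [w|r r0].
  rewrite /change_stopping; case: ifPn => // Tf.
  exact: (change_time_ge0 H gN gS gc w (fine_stopping_ge0 w sT)).
rewrite -[X in F r X]setTI; apply: change_stopping_sigma_lt => //.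
by split=> // t t0; rewrite setTI; exact: sT.2.
Qed.

Lemma stopped_sigma_change_stopping T A : stopping_time G T ->
  stopped_sigma G T A -> stopped_sigma F (change_stopping T) A.
Proof.
move=> sT GA; apply: (stopped_sigma_of_lt FF) => [|r r0]; first exact: GA.1.
exact: change_stopping_sigma_lt.
Qed.

Lemma change_stoppingP T w : stopping_time G T -> (change_stopping T w < +oo)%E ->
  [/\ (T w < +oo)%E, ((fine (T w))%:E < total_clock g Z w)%E,
      change_stopping T w = (inverse_clock g Z (fine (T w)) w)%:E &
      forall s, 0 <= s -> Y (fine (T w) + s) w =
        time_change g (@pcoord R E) s
          (pshift (fine (change_stopping T w)) (pathof Z w))].
Proof.
move=> sT; rewrite /change_stopping; case: ifPn => // Tf.
rewrite change_time_fin => tt; split => //; first by rewrite /change_time tt.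
move=> s s0; rewrite /change_time tt /=.
have pZ t : Z t w = pcoord t (pathof Z w) by rewrite (pcoord_pathof H).
rewrite (eq_inverse_clock g pZ) (time_change_pathof H).
rewrite (time_change_pshift hausE lcE scE gN gS gc)//.
  exact: (fine_stopping_ge0 w sT).
by rewrite -(eq_total_clock g pZ).
Qed.

Local Open Scope ereal_scope.

(** Under [P None] the process starts at [None] almost surely and stays there. This settles the
    event where [T] is finite but the total clock is exhausted at [T]: there [change_stopping T] is
    [+oo] and the strong Markov property of [Z] says nothing. *)
Lemma time_change_dead (f : absorbed E -> \bar R) s : (0 <= s)%R ->
  measurable_fun setT f -> (forall p, 0 <= f p) ->
  \int[P None]_w f (Y s w) = f None.
Proof.
move=> s0 mf f0; transitivity (\int[P None]_w cst (f None) w); last first.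
  by rewrite integral_cst// [X in _ * X](probability_setT (P None)) mule1.
apply: ae_eq_integral => //.
  exact: (measurableT_comp mf (measurable_time_change_process s0)).
have mD : measurable [set w | Z 0%R w = None].
  rewrite -[X in measurable X]setTI.
  exact: (measurable_process H (lexx 0%R) measurableT measurable_None).
exists (~` [set w | Z 0%R w = None]); split.
- exact: measurableC.
- by have := probability_setC (P None) mD; rewrite (mp_start H) subee.
- move=> w /= h Z0; apply: h => _.
  rewrite (time_change_absorbing H gN gS gc (lexx 0%R) s0)//.
  by rewrite (time_change0 H gN gS gc).
Qed.

Lemma strong_markov_time_change : strong_markov P G Y.
Proof.
move=> x T s f sT s0 mf f0.
pose h y := \int[P y]_w f (Y s w).
have h0 y : 0 <= h y by exact: integral_ge0.
have mfs : measurable_fun setT (fun p => f (pcoord s p)).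
  exact: (measurableT_comp mf (measurable_pcoord s0)).
have mh : measurable_fun setT h.
  have := measurable_integral_time_change mfs (fun p => f0 _).
  congr (measurable_fun _ _); apply/funext => y; apply: eq_integral => w _.
  by rewrite (pcoord_pathof_time_change H gN gS gc).
split=> [C mC|A GA].
  have mhC : measurable (h @^-1` C) by rewrite -[X in measurable X]setTI; exact: mh.
  exact: (stopped_sigma_eval_default GG (h := h) _ hausE lcE scE
    (fun t B t0 mB => time_change_adapted H gN gS gc t0 mB)
    (fun w t t0 => time_change_right_cont H gN gS gc t0) sT mhC).
have mA : measurable A := GA.1.
have FS := stopping_time_change_stopping sT.
have FA := stopped_sigma_change_stopping sT GA.
pose D := [set w | change_stopping T w < +oo].
have FD : stopped_sigma F (change_stopping T) D by exact: (stopped_sigma_fin FF).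
have mD : measurable D := FD.1.
pose X1 w := if T w < +oo then h (Y (fine (T w)) w) else 0.
pose X2 w := if T w < +oo then f (Y (fine (T w) + s)%R w) else 0.
have mT := measurable_stopping_time GG sT.
have mT1 : measurable_fun setT (fun w => T w < +oo).
  by apply: measurable_fun_lte.
have mYT r : (0 <= r)%R -> measurable_fun setT (fun w => Y (fine (T w) + r)%R w).
  move=> r0; under eq_fun do rewrite -(pcoord_pathof_time_change H gN gS gc).
  apply: (measurable_pcoord_joint hausE lcE scE).
  - by move=> w; rewrite addr_ge0//; exact: (fine_stopping_ge0 w sT).
  - by apply: measurable_funD => //; exact: (measurable_fine_stopping GG sT).
  - exact: measurable_pathof_time_change.
have mX1 : measurable_fun setT X1.
  apply: measurable_fun_ifT => //; apply: (measurableT_comp mh).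
  by have := mYT 0%R (lexx _); under eq_fun do rewrite addr0.
have mX2 : measurable_fun setT X2.
  by apply: measurable_fun_ifT => //; exact: (measurableT_comp mf (mYT s s0)).
have X10 w : 0 <= X1 w by rewrite /X1; case: ifP.
have X20 w : 0 <= X2 w by rewrite /X2; case: ifP.
(* On [D] the strong Markov property of [Z] at [change_stopping T] applies. Off [D], either [T] is
   infinite or the time-changed process is already dead at [T], and the two integrands agree
   pointwise. *)
have AE : A = (A `&` D) `|` (A `\` D) by rewrite setDE -setIUr setUv setIT.
have mAD : measurable (A `&` D) by exact: measurableI.
have mAnD : measurable (A `\` D) by exact: measurableD.
have dAD : [disjoint A `&` D & A `\` D].
  by apply/disj_setPS => w [[_ Dw] [_]].
change (\int[P x]_(w in A) X1 w = \int[P x]_(w in A) X2 w).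
rewrite AE !ge0_integral_setU//; last 2 first.
- exact: measurable_funS mX2.
- exact: measurable_funS mX1.
congr (_ + _).
  (* Seen from [Z], the value of the time change at [s] depends on the path at many times, hence the
     functional form of the strong Markov property. *)
  pose f' p := f (time_change g (@pcoord R E) s p).
  have mf' : measurable_fun setT f'.
    exact: (measurableT_comp mf (measurable_time_change hausE lcE scE gN gS gc s0)).
  have FAD : stopped_sigma F (change_stopping T) (A `&` D).
    exact: (stopped_sigmaI FF).
  have := @strong_markov_functional _ _ _ _ _ _ _ H f' x (change_stopping T) _
    mf' (fun p => f0 _) FS FAD.
  move=> /(_ _)/esym sm.
  transitivity (\int[P x]_(w in A `&` D)
      \int[P (Z (fine (change_stopping T w)) w)]_w' f' (pathof Z w')).
    apply: eq_integral => w; rewrite inE => -[_ Dw].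
    have [Tf tt SE _] := change_stoppingP sT Dw.
    rewrite /X1 Tf /h SE /= {1}/time_change tt.
    by apply: eq_integral => w' _; rewrite (time_change_pathof H).
  rewrite sm; last by move=> w [].
  apply: eq_integral => w; rewrite inE => -[_ Dw].
  have [Tf tt _ Ys] := change_stoppingP sT Dw.
  by rewrite /X2 Tf Ys.
apply: eq_integral => w; rewrite inE => -[_]; rewrite /D /= /change_stopping /X1 /X2.
case: ifPn => // Tf; rewrite change_time_fin => /negP tt.
have YN : Y (fine (T w)) w = None by rewrite /time_change (negbTE tt).
have fT0 := fine_stopping_ge0 w sT.
rewrite YN (time_change_absorbing H gN gS gc fT0 _ YN) ?lerDl//.
exact: time_change_dead.
Qed.

(** The inverse clock is left continuous because the clock is strictly increasing while alive. So,
    below the total, [change_stopping (T n)] increases to the inverse clock at [Tlim], and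
    quasi-left continuity of [Z] along these stopping times applies. *)
Lemma quasi_left_continuous_time_change : quasi_left_continuous P G Y.
Proof.
move=> x T sT leT Tlim.
have := mp_quasi_left_cont H x (fun n => stopping_time_change_stopping (sT n)).
have leS n w : change_stopping (T n) w <= change_stopping (T n.+1) w.
  rewrite /change_stopping; have Tn := leT n w.
  case: (ltP (T n.+1 w) +oo) => Tf; last by rewrite leey.
  have Tf' := le_lt_trans Tn Tf; rewrite Tf'.
  apply: (le_change_time H gN gS gc); first exact: (fine_stopping_ge0 w (sT n)).
  by apply: fine_le => //; rewrite ge0_fin_numE// ((sT _).1).
move=> /(_ leS); apply: filterS => w hZ Tlt.
have T0 n : 0 <= T n w by exact: (sT n).1.
have Tle n : T n w <= Tlim w by apply: ereal_sup_ubound; exists n.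
have Tl0 : 0 <= Tlim w := le_trans (T0 0%N) (Tle 0%N).
have pZ t : Z t w = pcoord t (pathof Z w) by rewrite (pcoord_pathof H).
have pZ' t : pcoord t (pathof Z w) = Z t w by rewrite -pZ.
rewrite (lifetime_time_change H gN gS gc) (eq_total_clock g pZ) in Tlt.
have fTl : Tlim w \is a fin_num by rewrite ge0_fin_numE// (lt_le_trans Tlt)// leey.
rewrite -(fineK fTl) in Tlt.
have l0 : (0 <= fine (Tlim w))%R by exact: fine_ge0.
have [s [s0 ps st tcs]] := time_changeP hausE lcE scE gN gS gc l0 Tlt.
have fT n : T n w \is a fin_num.
  by rewrite ge0_fin_numE// (le_lt_trans (Tle n))// -(fineK fTl) ltry.
have Tn0 n : (0 <= fine (T n w))%R by exact: fine_ge0.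
have Tnt n : (fine (T n w))%:E < total_clock g (@pcoord R E) (pathof Z w).
  by rewrite (le_lt_trans _ Tlt)// fineK// fineK.
have SE n : change_stopping (T n) w =
    (inverse_clock g (@pcoord R E) (fine (T n w)) (pathof Z w))%:E.
  rewrite /change_stopping -ge0_fin_numE// fT /change_time.
  by rewrite (eq_total_clock g pZ) Tnt (eq_inverse_clock g pZ).
pose S n := inverse_clock g (@pcoord R E) (fine (T n w)) (pathof Z w).
have S_P n := inverse_clockP hausE lcE scE gN gS gc (Tn0 n) (Tnt n).
have sE : inverse_clock g (@pcoord R E) (fine (Tlim w)) (pathof Z w) = s.
  by have [] := inverse_clock_unique hausE lcE scE gN gS gc s0 ps st.
have Ss n : (S n <= s)%R.
  rewrite -sE; apply: (le_inverse_clock hausE lcE scE gN gS gc) => //.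
  by apply: fine_le.
have Slim : ereal_sup (range (fun n => change_stopping (T n) w)) = s%:E.
  apply/eqP; rewrite eq_le; apply/andP; split.
    by apply: ge_ereal_sup => _ [n _ <-]; rewrite SE lee_fin Ss.
  (* If the supremum [r] were below [s], every [T n] would be at most the clock at [r], which is
     strictly below the clock at [s], that is, below [Tlim]. *)
  rewrite leNgt; apply/negP => lts.
  have S0 : 0 <= ereal_sup (range (fun n => change_stopping (T n) w)).
    apply: (@le_trans _ _ (change_stopping (T 0%N) w)).
      by rewrite SE lee_fin; have [] := S_P 0%N.
    by apply: ereal_sup_ubound; exists 0%N.
  set r := fine (ereal_sup (range (fun n => change_stopping (T n) w))).
  have rE : ereal_sup (range (fun n => change_stopping (T n) w)) = r%:E.
    by rewrite /r fineK// ge0_fin_numE// (lt_trans lts)// ltry.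
  rewrite rE !lte_fin !lee_fin in S0 lts.
  have pr := pcoord_alive S0 (ltW lts) ps.
  have := lt_clock hausE lcE scE gN gS gc S0 lts pr.
  rewrite st fineK// ltNge => /negP; apply.
  apply: ge_ereal_sup => _ [n _ <-].
  have [_ _ cn] := S_P n; rewrite -(fineK (fT n)) -cn.
  apply: (le_clock hausE lcE scE gN gS gc).
  rewrite -lee_fin -rE -SE; apply: ereal_sup_ubound; exists n => //.
move: hZ; rewrite Slim => /(_ _).
have -> : s%:E < lifetime Z w.
  by apply/(lt_lifetime H w s0); rewrite pZ.
move=> /(_ isT) /= hZ.
rewrite (time_change_pathof H) tcs pZ'.
rewrite (_ : (fun n => Y (fine (T n w)) w) =
  fun n => Z (fine (change_stopping (T n) w)) w)//.
apply/funext => n; rewrite SE /= pZ (time_change_pathof H).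
by rewrite /time_change Tnt.
Qed.

(** Removing [None] from [B] replaces the random set of alive times by the fixed half-line, so that
    the inner integral is a measurable functional of the path. *)
Lemma potentialE (Q : probability Omega R) (V : R -> Omega -> absorbed E)
    (B : set (absorbed E)) : measurable B -> (forall w, is_path (V ^~ w)) ->
  potential Q V B = \int[Q]_w
    \int[mu]_(u in `[0%R, +oo[) (\1_(B `&` ~` [set None]) (pcoord u (pathof V w)))%:E.
Proof.
move=> mB pV; apply: eq_integral => w _.
rewrite [LHS]integral_mkcond [RHS]integral_mkcond.
apply: eq_integral => u _; rewrite !patchE.
have lE : lifetime V w = lifetime (@pcoord R E) (pathof V w).
  by apply: eq_lifetime => t; rewrite pcoord_mkpath.
have [u0|u0] := leP 0%R u; last first.
  rewrite !memNset//= ?in_itv /= ?andbT; first by rewrite leNgt u0.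
  by move=> [] /=; rewrite leNgt u0.
rewrite [X in _ = if X then _ else _]mem_set/= ?in_itv/= ?u0//.
rewrite pcoord_mkpath//.
case: ifPn => [|/negP h].
  move=> /set_mem[_]; rewrite lE => /(lt_lifetime_paths _ u0).1.
  rewrite pcoord_mkpath// => Vu; rewrite !indicE in_setI.
  by rewrite [X in _ && X]mem_set// andbT.
rewrite indicE memNset// => -[_ Vu]; apply: h; apply/mem_set; split => //.
by rewrite lE; apply/(lt_lifetime_paths _ u0); rewrite pcoord_mkpath.
Qed.

Lemma measurable_occupation (B : set (absorbed E)) : measurable B ->
  measurable_fun setT (fun p : paths R E =>
    \int[mu]_(u in `[0%R, +oo[) (\1_B (pcoord u p))%:E).
Proof.
move=> mB; apply: (measurable_integral_functional hausE lcE scE) => //.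
- by move=> u /=; rewrite in_itv /= andbT.
Qed.

Lemma occupationE (B : set (absorbed E)) (p : paths R E) : measurable B ->
  \int[mu]_(u in `[0%R, +oo[) (\1_B (pcoord u p))%:E =
  mu [set u | (0 <= u)%R /\ B (pcoord u p)].
Proof.
move=> mB; have mU := measurable_pcoord_preimage hausE lcE scE p mB.
rewrite -[X in _ = mu X]setIT -integral_indic//.
rewrite [LHS]integral_mkcond; apply: eq_integral => u _.
rewrite patchE; case: ifPn => [/set_mem|/negP h] /=.
  rewrite in_itv /= andbT => u0; rewrite !indicE; congr ((nat_of_bool _)%:R%:E).
  by apply/idP/idP => /set_mem h; apply/mem_set => //; case: h.
rewrite indicE memNset// => -[u0 _]; apply: h; apply/mem_set.
by rewrite /= in_itv /= u0.
Qed.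

(** By [time_change_null] the two occupation times vanish for the same trajectories. Their sizes may
    differ, but equivalence to a reference measure only involves null sets. *)
Lemma potential_time_change_eq0 x (B : set (absorbed E)) : measurable B ->
  potential (P x) Y B = 0 <-> potential (P x) Z B = 0.
Proof.
move=> mB; have mB' : measurable (B `&` ~` [set None]).
  by apply: measurableI => //; apply: measurableC; exact: measurable_None.
rewrite (potentialE (P x) mB (is_path_process H)).
rewrite (potentialE (P x) mB (is_path_time_change_process H gN gS gc)).
apply: eq_integral_eq0.
- exact: (measurableT_comp (measurable_occupation mB') measurable_pathof_time_change).
- exact: (measurableT_comp (measurable_occupation mB') (measurable_pathof H)).
- by move=> w; apply: integral_ge0 => u _; rewrite lee_fin.
- by move=> w; apply: integral_ge0 => u _; rewrite lee_fin.
- move=> w; rewrite !occupationE// (pathof_time_change H gN gS gc).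
  have -> : [set u | (0 <= u)%R /\ (B `&` ~` [set None])
        (pcoord u (tc_path g (pathof Z w)))] =
      [set u | (0 <= u)%R /\ (B `&` ~` [set None])
        (time_change g (@pcoord R E) u (pathof Z w))].
    by apply/seteqP; split=> u /=; rewrite (pcoord_tc_path hausE lcE scE gN gS gc).
  by apply: (time_change_null hausE lcE scE gN gS gc) => // -[_]; apply.
Qed.

Theorem markov_process_time_change : markov_process P G Y.
Proof.
split=> //.
- move=> t B t0 mB; exact: (time_change_adapted H gN gS gc).
- move=> t B t0 mB.
  have mC : measurable (time_change g (@pcoord R E) t @^-1` B).
    rewrite -[X in measurable X]setTI.
    exact: (measurable_time_change hausE lcE scE gN gS gc t0).
  have := measurable_law H mC; congr (measurable_fun _ _).
  apply/funext => x; congr (P x _); apply/seteqP.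
  by split=> w /=; rewrite (time_change_pathof H).
- move=> x; rewrite -[RHS](mp_start H x); congr (P x _).
  by apply/seteqP; split=> w /=; rewrite (time_change0 H gN gS gc).
- move=> w t t0; rewrite leNgt => /negP h; apply: contrapT => /= Yt; apply: h.
  exact/(time_change_lt_lifetime H gN gS gc).
- exact: (time_change_right_cont H gN gS gc).
- move=> w t t0 /((time_change_lt_lifetime H gN gS gc _ (ltW t0)).1).
  exact: (path_left_lim (is_path_time_change_process H gN gS gc w)).
- exact: strong_markov_time_change.
- exact: quasi_left_continuous_time_change.
- have [m sm hm] := mp_reference H; exists m; first exact: sm.
  move=> x.
  have [h1 h2] := hm x; split.
    move=> N mN A mA AN; apply: (potential_time_change_eq0 (Some x) mA).2.
    exact: h1 mN A mA AN.
  move=> N pN; apply: h2 => A mA AN.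
  apply: (potential_time_change_eq0 (Some x) mA).1; exact: pN.
Qed.

End strong_markov_time_change.

(** * Homeomorphic images *)

(** The types mention [absorbed] rather than [option] so that inference finds its topology and
    sigma-field. *)
Definition amap {E1 E2 : Type} (f : E1 -> E2) (x : absorbed E1) : absorbed E2 :=
  omap f x.

Lemma amapK {E1 E2 : Type} (f : E1 -> E2) (h : E2 -> E1) :
  cancel f h -> cancel (amap f) (amap h).
Proof. by move=> fK [x|] //=; rewrite /amap /= fK. Qed.

Lemma amap_None {E1 E2 : Type} (f : E1 -> E2) (x : absorbed E1) :
  amap f x = None <-> x = None.
Proof. by case: x. Qed.

Lemma continuous_amap {E1 E2 : topologicalType} (f : E1 -> E2) :
  continuous f -> continuous (amap f).
Proof.
move=> cf; apply: continuous_absorbed => x.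
by move=> A /nbhs_SomeE hA; exact: (cf x _ hA).
Qed.

Lemma measurable_amap {E1 E2 : topologicalType} (f : E1 -> E2) :
  continuous f -> measurable_fun setT (amap f).
Proof.
move=> /continuous_amap/continuousP cf; apply: measurable_fun_absorbed => U oU.
by apply: measurable_openW; exact: cf.
Qed.

Section homeomorphism.
Context {E1 E2 : topologicalType} (f : E1 -> E2) (h : E2 -> E1).
Hypotheses (fK : cancel f h) (hK : cancel h f) (cf : continuous f)
  (ch : continuous h).

Lemma hausdorff_homeo : hausdorff_space E1 -> hausdorff_space E2.
Proof.
move=> hE p q pq; apply: (can_inj hK); apply: hE => A B Ap Bq.
have [z [Az Bz]] := pq _ _ (ch Ap) (ch Bq).
by exists (h z).
Qed.

Lemma locally_compact_homeo : hausdorff_space E1 ->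
  locally_compact [set: E1] -> locally_compact [set: E2].
Proof.
move=> hE lE x _; rewrite withinET.
have [U] := lE (h x) I; rewrite withinET => Ux [cU _].
exists (f @` U).
  have : nbhs x (h @^-1` U) by exact: ch.
  by apply: filterS => y Uy; exists (h y).
have cfU : compact (f @` U) by apply: continuous_compact => //; exact: continuous_subspaceT.
by split => //; apply: compact_closed => //; exact: hausdorff_homeo.
Qed.

Lemma second_countable_homeo : @second_countable E1 -> @second_countable E2.
Proof.
move=> [B cB [Bo Bb]]; exists ((fun U => h @^-1` U) @` B).
  exact: sub_countable (card_image_le _ _) cB.
split=> [_ [U BU <-]|x A Ax].
  by move/continuousP : ch; apply; exact: Bo.
have Ahx : nbhs (h x) (h @` A).
  have : nbhs (h x) (f @^-1` A) by apply: cf; rewrite hK.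
  by apply: filterS => y Afy; exists (f y).
have [U [BU Uhx] UA] := Bb (h x) _ Ahx.
exists (h @^-1` U); first by split => //; exists U.
move=> y /UA [z Az /(can_inj hK) <-]//.
Qed.

End homeomorphism.

Section transport.
Context {R : realType} {E1 E2 : topologicalType}.
Context {disp : measure_display} {Omega : measurableType disp}.
Variables (P : absorbed E1 -> probability Omega R) (F : R -> set (set Omega)).
Variable Z : R -> Omega -> absorbed E1.
Hypothesis H : markov_process P F Z.
Variables (f : E1 -> E2) (h : E2 -> E1).
Hypotheses (fK : cancel f h) (hK : cancel h f) (cf : continuous f)
  (ch : continuous h).
Local Notation P' := (fun y => P (amap h y)).
Local Notation Z' := (fun t w => amap f (Z t w)).

Let FF := mp_filtration H.
Let mf := measurable_amap cf.
Let mh := measurable_amap ch.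

Let mpre (B : set (absorbed E2)) : measurable B -> measurable (amap f @^-1` B).
Proof. by move=> mB; rewrite -[X in measurable X]setTI; exact: mf. Qed.

Let mpreh (B : set (absorbed E1)) : measurable B -> measurable (amap h @^-1` B).
Proof. by move=> mB; rewrite -[X in measurable X]setTI; exact: mh. Qed.

(** An initial law [nu] on [absorbed E1] is pushed forward by [amap f] so that the hypothesis on
    [absorbed E2] applies to it; the exceptional set of starting points is then pulled back. *)
Lemma complete_wrt_amap (G : set (set Omega)) : complete_wrt P G -> complete_wrt P' G.
Proof.
move=> cG A hA; apply: cG => nu.
pose X := mfun_Sub (mem_set mf : amap f \in mfun).
have [B [N [GB mN AB [M [mM M0 NM]]]]] := hA (distribution nu X).
exists B, N; split => //; exists (amap f @^-1` M); split.
- exact: mpre.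
- exact: M0.
- by move=> x /= nx; apply: NM => /=; rewrite (amapK fK).
Qed.

Lemma lifetime_amap w : lifetime Z' w = lifetime Z w.
Proof.
rewrite /lifetime; congr (ereal_inf (_ @` _)).
by apply/seteqP; split=> t /= [t0 /amap_None].
Qed.

Lemma potential_amap x (B : set (absorbed E2)) :
  potential (P x) Z' B = potential (P x) Z (amap f @^-1` B).
Proof.
apply: eq_integral => w _; rewrite /alive lifetime_amap; apply: eq_integral => t _.
by rewrite !indicE; congr ((nat_of_bool _)%:R%:E).
Qed.

Lemma reference_amap (mu : {measure set (absorbed E1) -> \bar R}) :
  sigma_finite setT mu -> sigma_finite setT (image_measure mu mf).
Proof.
move=> [D TD hD]; exists (fun n => amap h @^-1` (D n)).
  by rewrite -preimage_bigcup -TD preimage_setT.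
move=> n; split; first by apply: mpreh; exact: (hD n).1.
have -> : image_measure mu mf (amap h @^-1` D n) = mu (D n).
  rewrite /image_measure /= /pushforward; congr (mu _).
  by apply/seteqP; split=> x /=; rewrite (amapK fK).
exact: (hD n).2.
Qed.

Theorem markov_process_amap : markov_process P' F Z'.
Proof.
split.
- exact: (hausdorff_homeo hK ch (mp_hausdorff H)).
- exact: (locally_compact_homeo hK cf ch (mp_hausdorff H) (mp_locally_compact H)).
- exact: (second_countable_homeo fK hK cf ch (mp_second_countable H)).
- split.
  + exact: (filtration_sigma FF).
  + exact: (filtration_sub FF).
  + exact: (filtration_mono FF).
  + exact: (filtration_right_cont FF).
  + by apply: complete_wrt_amap; exact: (filtration_complete_top FF).
  + by move=> t t0; apply: complete_wrt_amap; exact: (filtration_complete FF).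
- by move=> t B t0 mB; exact: (mp_adapted H t0 (mpre mB)).
- move=> t B t0 mB.
  exact: (measurableT_comp (mp_kernel H t0 (mpre mB)) mh).
- move=> x; rewrite -[RHS](mp_start H (amap h x)); congr (P _ _).
  apply/seteqP; split=> w /=; first by move=> <-; rewrite (amapK fK).
  by move=> ->; rewrite (amapK hK).
- move=> w t t0; rewrite lifetime_amap => tl; apply/amap_None.
  exact: (mp_absorbing H).
- move=> w t t0; have cZ := mp_right_cont H t0 (w := w).
  exact: (cvg_comp _ _ cZ (continuous_amap cf (x := _))).
- move=> w t t0; rewrite lifetime_amap => tl.
  have [l Zl] := mp_left_lim H t0 tl; exists (f l).
  exact: (cvg_comp _ _ Zl (continuous_amap cf (x := _))).
- move=> x T s k sT s0 mk k0.
  have [h1 h2] := mp_strong_markov H (amap h x) sT s0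
    (measurableT_comp mk mf) (fun p => k0 (amap f p)).
  have E1' : (fun w => if (T w < +oo)%E then
         (\int[P (amap h (amap f (Z (fine (T w)) w)))]_w' k (amap f (Z s w')))%E else 0%E) =
    (fun w => if (T w < +oo)%E then
         (\int[P (Z (fine (T w)) w)]_w' (k \o amap f) (Z s w'))%E else 0%E).
    by apply/funext => w; rewrite (amapK fK).
  by split=> [C mC|A FA]; rewrite E1'; [exact: h1|exact: h2].
- move=> x T sT leT Tlim.
  apply: filterS (mp_quasi_left_cont H (amap h x) sT leT) => w hw.
  rewrite lifetime_amap => /hw Zc.
  exact: (cvg_comp _ _ Zc (continuous_amap cf (x := _))).
- have [m sm hm] := mp_reference H; exists (image_measure m mf).
    exact: reference_amap.
  move=> x; have [h1 h2] := hm (h x).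
  (* [<<] is stated with sets all of whose measurable subsets are null, so monotonicity of [m] is
     needed to pass from a preimage to its subsets. *)
  have mle0 (A A1 : set (absorbed E1)) : measurable A -> measurable A1 ->
      A1 `<=` A -> m A = 0%E -> m A1 = 0%E.
    move=> mA mA1 A1A A0; apply/eqP; rewrite -measure_le0 -A0.
    by apply: le_measure; rewrite ?inE.
  split=> N nN A mA AN.
    rewrite potential_amap; apply: (h1 (amap f @^-1` A)) => //; last exact: mpre.
    by move=> A1 mA1 A1A; exact: (mle0 _ _ (mpre mA) mA1 A1A (nN A mA AN)).
  change (m (amap f @^-1` A) = 0%E); apply: (h2 (amap f @^-1` A)) => //; last exact: mpre.
  move=> A1 mA1 A1A.
  have := nN (amap h @^-1` A1) (mpreh mA1).
  rewrite potential_amap -comp_preimage (_ : amap h \o amap f = id); last first.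
    by apply/funext => y /=; rewrite (amapK fK).
  apply; apply: subset_trans AN => y /A1A /=.
  by rewrite (amapK hK).
Qed.

End transport.

(** * Polar coordinates *)

Lemma continuous_pair {T U V : topologicalType} (f : T -> U) (g : T -> V) :
  continuous f -> continuous g -> continuous (fun x => (f x, g x)).
Proof. by move=> cf cg x; exact: (cvg_pair (cf x) (cg x)). Qed.

Section row_topology.
Context {R : realType} {d : nat}.

Lemma continuous_row {T : topologicalType} (F : T -> 'rV[R]_d) :
  (forall j, continuous (fun x => F x 0 j)) -> continuous F.
Proof.
move=> cF x A /nbhs_ballP[e e0 eA].
have : \forall y \near x, forall j, ball (F x 0 j) e (F y 0 j).
  by apply: filter_forall => j; apply: (cF j x); exact: nbhsx_ballx.
apply: filterS => y h; apply: eA; split => // i j.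
by rewrite (ord1 i); exact: h.
Qed.

Lemma continuous_enorm : continuous (@enorm R d).
Proof.
have cs : continuous (fun x : 'rV[R]_d => \sum_i x 0 i ^+ 2).
  apply: continuous_big => [|i _]; first exact: add_continuous.
  move=> y; apply: (@continuous_comp _ _ _ (fun x : 'rV[R]_d => x 0 i) (fun r : R => r ^+ 2)).
    exact: coord_continuous.
  exact: exprn_continuous.
move=> x; apply: continuous_comp; first exact: cs.
exact: sqrt_continuous.
Qed.

Lemma enormZ (a : R) (x : 'rV[R]_d) : 0 <= a -> enorm (a *: x) = a * enorm x.
Proof.
move=> a0; rewrite /enorm; under eq_bigr do rewrite mxE exprMn.
by rewrite -mulr_sumr sqrtrM ?sqr_ge0// sqrtr_sqr ger0_norm.
Qed.

End row_topology.

Section polar.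
Context {R : realType} {d : nat} (S : set 'rV[R]_d).
Hypothesis hS : S `<=` sphere.

Lemma val_set_type {T : choiceType} (A : set T) (x : A) : A (\val x).
Proof. exact: set_mem (valP x). Qed.

Lemma enorm_val (y : S) : enorm (\val y) = 1.
Proof. exact: hS (val_set_type y). Qed.

Lemma cone_polar (p : S * R) : cone S (expR p.2 *: \val p.1).
Proof. by exists (\val p.1), p.2; split => //; exact: val_set_type. Qed.

Definition cone_of_polar (p : S * R) : cone S := SigSub (mem_set (cone_polar p)).

Lemma val_cone_of_polar p : \val (cone_of_polar p) = expR p.2 *: \val p.1.
Proof. by []. Qed.

Lemma enorm_cone_of_polar p : enorm (\val (cone_of_polar p)) = expR p.2.
Proof. by rewrite val_cone_of_polar enormZ ?expR_ge0// enorm_val mulr1. Qed.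

Lemma cone_polarP (x : cone S) : exists p, x = cone_of_polar p.
Proof.
have [y [z [Sy xE]]] := val_set_type x.
by exists (SigSub (mem_set Sy) : S, z); apply: val_inj; rewrite val_cone_of_polar.
Qed.

Lemma direction_in (x : cone S) : S ((enorm (\val x))^-1 *: \val x).
Proof.
have [p ->] := cone_polarP x.
rewrite enorm_cone_of_polar val_cone_of_polar scalerA mulVf ?gt_eqF ?expR_gt0//.
by rewrite scale1r; exact: val_set_type.
Qed.

Definition polar_of_cone (x : cone S) : S * R :=
  (SigSub (mem_set (direction_in x)), ln (enorm (\val x))).

Lemma val_direction x : \val (polar_of_cone x).1 = (enorm (\val x))^-1 *: \val x.
Proof. by []. Qed.

Lemma log_norm x : (polar_of_cone x).2 = ln (enorm (\val x)).
Proof. by []. Qed.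

Lemma cone_of_polarK : cancel cone_of_polar polar_of_cone.
Proof.
move=> [y z]; rewrite [LHS]surjective_pairing; congr (_, _).
  apply: val_inj; rewrite val_direction enorm_cone_of_polar val_cone_of_polar.
  by rewrite scalerA mulVf ?gt_eqF ?expR_gt0// scale1r.
by rewrite log_norm enorm_cone_of_polar expRK.
Qed.

Lemma polar_of_coneK : cancel polar_of_cone cone_of_polar.
Proof. by move=> x; have [p ->] := cone_polarP x; rewrite cone_of_polarK. Qed.

Lemma continuous_cone_of_polar : continuous cone_of_polar.
Proof.
apply: continuous_comp_initial; apply: continuous_row => j.
have -> : (fun x : S * R => (set_val \o cone_of_polar) x 0 j) =
    fun p : S * R => expR p.2 * \val p.1 0 j by apply/funext => p /=; rewrite mxE.
move=> p; apply: (@cvgM _ _ _ _ (fun p : S * R => expR p.2)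
    (fun p : S * R => \val p.1 0 j)).
  apply: (@continuous_comp _ _ _ (fun p : S * R => p.2) (@expR R)).
    exact: cvg_snd.
  exact: continuous_expR.
apply: (@continuous_comp _ _ _ (fun p : S * R => p.1) (fun y : S => \val y 0 j)).
  exact: cvg_fst.
apply: (@continuous_comp _ _ _ (set_val : S -> 'rV[R]_d) (fun v : 'rV[R]_d => v 0 j)).
  exact: initial_continuous.
exact: coord_continuous.
Qed.

Lemma continuous_polar_of_cone : continuous polar_of_cone.
Proof.
have cv : continuous (set_val : cone S -> 'rV[R]_d) by exact: initial_continuous.
have ce : continuous (fun x : cone S => enorm (\val x)).
  by move=> x; apply: continuous_comp; [exact: cv|exact: continuous_enorm].
have e0 (x : cone S) : 0 < enorm (\val x).
  by have [p ->] := cone_polarP x; rewrite enorm_cone_of_polar expR_gt0.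
apply: continuous_pair; last first.
  move=> x; apply: (@continuous_comp _ _ _ (fun x : cone S => enorm (\val x)) (@ln R)).
    exact: ce.
  exact: continuous_ln.
apply: continuous_comp_initial; apply: continuous_row => j.
have -> : (fun x : cone S => (set_val \o
      (fun x : cone S => SigSub (mem_set (direction_in x)) : S)) x 0 j) =
    fun x : cone S => (enorm (\val x))^-1 * \val x 0 j.
  by apply/funext => y /=; rewrite mxE.
have c1 : continuous (fun y : cone S => (enorm (\val y))^-1).
  move=> y; apply: (@continuous_comp _ _ _ (fun y : cone S => enorm (\val y)) GRing.inv).
    exact: ce.
  by apply: inv_continuous; rewrite gt_eqF.
have c2 : continuous (fun y : cone S => \val y 0 j).
  move=> y; apply: (@continuous_comp _ _ _ (set_val : cone S -> 'rV[R]_d) (fun v : 'rV[R]_d => v 0 j)).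
    exact: cv.
  exact: coord_continuous.
by move=> y; exact: (cvgM (c1 y) (c2 y)).
Qed.

Lemma state_cone_of_polar p : state S (expR p.2 *: \val p.1) = Some (cone_of_polar p).
Proof. by rewrite -val_cone_of_polar /state valK. Qed.

Lemma to_coneE p : to_cone p = amap cone_of_polar p.
Proof. by case: p => [[y z]|] //=; rewrite (state_cone_of_polar (y, z)). Qed.

Lemma to_polarE x : to_polar x = amap polar_of_cone x.
Proof.
case: x => [x|] //=; rewrite /amap /= /polar_of_cone.
rewrite (_ : insub _ = Some (SigSub (mem_set (direction_in x)) : S))//.
exact: (valK (SigSub (mem_set (direction_in x)) : S)).
Qed.

(** In the cone this is multiplication by [expR c]; see [scale_cone_of_polar]. *)
Definition level_shift (c : R) (p : S * R) : S * R := (p.1, p.2 + c).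

Lemma level_shift0 : level_shift 0 = id.
Proof. by apply/funext => -[y z]; rewrite /level_shift /= addr0. Qed.

Lemma level_shiftD b c p : level_shift b (level_shift c p) = level_shift (c + b) p.
Proof. by rewrite /level_shift /= addrA. Qed.

(** Continuity jointly in the amount and the point is wanted because the additive property shifts by
    a random level. *)
Lemma continuous_level_shift2 :
  continuous (fun cp : R * (S * R) => level_shift cp.1 cp.2).
Proof.
apply: continuous_pair => cp.
  apply: (@continuous_comp _ _ _ (fun cp : R * (S * R) => cp.2) (fun p : S * R => p.1)).
    exact: cvg_snd.
  exact: cvg_fst.
apply: (@cvgD _ _ _ _ _ (fun cp : R * (S * R) => cp.2.2) (fun cp => cp.1)).
  apply: (@continuous_comp _ _ _ (fun cp : R * (S * R) => cp.2) (fun p : S * R => p.2)).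
    exact: cvg_snd.
  exact: cvg_snd.
exact: cvg_fst.
Qed.

Lemma continuous_level_shift c : continuous (level_shift c).
Proof.
move=> p; apply: (@continuous_comp _ _ _ (fun p : S * R => (c, p))
  (fun cp : R * (S * R) => level_shift cp.1 cp.2)).
  by apply: continuous_pair => q; [exact: cvg_cst|exact: cvg_id].
exact: continuous_level_shift2.
Qed.

Lemma scale_cone_of_polar a p : 0 < a ->
  a *: \val (cone_of_polar p) = \val (cone_of_polar (level_shift (ln a) p)).
Proof.
move=> a0; rewrite !val_cone_of_polar scalerA /= expRD lnK ?posrE//.
by rewrite mulrC.
Qed.

Lemma state_scale a x : 0 < a ->
  state S (a *: vec (amap cone_of_polar x)) =
  amap cone_of_polar (amap (level_shift (ln a)) x).
Proof.
move=> a0; case: x => [p|] /=.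
  rewrite scale_cone_of_polar//; exact: valK.
(* The extra state is represented by the origin, which scaling fixes and which is outside the cone,
   since points of [S] have norm [1]. *)
rewrite scaler0 /state insubF//; apply/negP => /set_mem[y [z [Sy /esym/eqP]]].
rewrite scaler_eq0 gt_eqF ?expR_gt0//= => /eqP y0.
have := hS Sy; rewrite y0 /sphere /= /enorm => /eqP.
rewrite big1 ?sqrtr0 1?eq_sym ?oner_eq0// => i _.
by rewrite mxE expr0n.
Qed.

Lemma exp_rate_gt0 alpha (p : S * R) : 0 < exp_rate alpha (Some p).
Proof. by case: p => y z; exact: expR_gt0. Qed.

Lemma continuous_exp_rate alpha : continuous (@exp_rate R d S alpha).
Proof.
apply: continuous_absorbed => p.
rewrite (_ : (fun x : S * R => _) = fun x : S * R => expR (alpha * x.2)); last first.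
  by apply/funext => -[].
apply: (@continuous_comp _ _ _ (fun p : S * R => alpha * p.2) (@expR R)).
  apply: (@cvgM _ _ _ _ (fun=> alpha) (fun p : S * R => p.2)).
    exact: cvg_cst.
  exact: cvg_snd.
exact: continuous_expR.
Qed.

Lemma exp_rate_shift alpha c p :
  exp_rate alpha (Some (level_shift c p)) = expR (alpha * c) * exp_rate alpha (Some p).
Proof. by case: p => y z; rewrite /= -expRD mulrDr addrC. Qed.

Lemma norm_rateE alpha x :
  norm_rate alpha x = exp_rate (- alpha) (amap polar_of_cone x).
Proof.
case: x => [x|] //=; rewrite /powR ifF; last first.
  by apply/gt_eqF; have [p ->] := cone_polarP x; rewrite enorm_cone_of_polar expR_gt0.
by rewrite -expRN mulNr.
Qed.

Definition level (x : absorbed (S * R)%type) : R := if x is Some p then p.2 else 0.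

Lemma continuous_level : continuous level.
Proof. by apply: continuous_absorbed => p; exact: cvg_snd. Qed.

End polar.

Section path_sigma_theory.
Context {R : realType} {E : topologicalType}.
Implicit Types C : set (R -> absorbed E).

Lemma measurable_path_sigma d (T : measurableType d) (V : R -> T -> absorbed E) C :
  (forall t, 0 <= t -> measurable_fun setT (V t)) -> path_sigma C ->
  measurable [set w | C (V ^~ w)].
Proof.
move=> mV; move: C; apply: smallest_sub.
  split=> [|A mA|A mA] /=.
  - by rewrite (_ : [set w | _] = set0).
  - rewrite (_ : [set w | _] = ~` [set w | A (V ^~ w)]); first exact: measurableC.
    by apply/seteqP; split=> w /=; [case|split].
  - rewrite (_ : [set w | _] = \bigcup_n [set w | A n (V ^~ w)]).
      exact: bigcupT_measurable.
    by apply/seteqP; split=> w [n _ An]; exists n.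
move=> _ [t [B [t0 mB ->]]] /=; rewrite -[X in measurable X]setTI.
exact: mV.
Qed.

(** The generators only look at times [t >= 0]. This matters because the scaling identity between
    time-changed paths is established at such times only. *)
Lemma path_sigma_eq_pos C (p q : R -> absorbed E) : path_sigma C ->
  (forall t, 0 <= t -> p t = q t) -> C p <-> C q.
Proof.
move=> pC pq; move: C pC; apply: smallest_sub.
  split=> [|A mA|A mA] //=.
  - by split=> [[_ nA]|[_ nA]]; split=> // /mA.
  - by split=> -[n _ /(mA n) h]; exists n.
by move=> _ [t [B [t0 mB ->]]] /=; rewrite pq.
Qed.

(** Self-similarity is stated for events of arbitrary functions, while the time change is studied on
    [paths]; by induction on the generated sigma-field, each event of the second kind is the trace
    of one of the first. *)
Lemma path_sigma_paths (D : set (paths R E)) : measurable D ->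
  exists2 C, path_sigma C & forall p : paths R E, D p <-> C (sval p).
Proof.
move: D; apply: smallest_sub.
  have [s0 sC sU] := @smallest_sigma_algebra (R -> absorbed E) setT
    [set C | exists t B, [/\ 0 <= t, measurable B & C = [set p | B (p t)]]].
  split=> [|A [C pC AC]|A hA] /=.
  - by exists set0.
  - exists (setT `\` C); first exact: sC.
    by move=> p; split=> -[_ nA]; split => // /AC.
  - have {}hA n : {C | path_sigma C & forall p : paths R E, A n p <-> C (sval p)}.
      exact/cid2.
    exists (\bigcup_n s2val (hA n)).
      by apply: sU => n; exact: (s2valP (hA n)).
    by move=> p; split=> -[n _ h]; exists n => //; apply/(s2valP' (hA n)).
move=> _ [t [B [t0 mB ->]]]; exists [set p | B (p t)] => //.
by apply: sub_sigma_algebra; exists t, B.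
Qed.

End path_sigma_theory.

Section path_mapping.
Context {R : realType} {E1 E2 : topologicalType} (e : E1 -> E2).
Hypothesis ce : continuous e.

Definition map_paths (p : paths R E1) : paths R E2 :=
  mkpath (fun t => amap e (pcoord t p)).

Lemma is_path_map_paths (p : paths R E1) : is_path (fun t => amap e (pcoord t p)).
Proof.
split=> [t t0|s t s0 st /amap_None ps|t t0 /amap_None pt].
- exact: (cvg_comp _ _ (pcoord_cvg t0) (continuous_amap ce (x := _))).
- by apply/amap_None; exact: pcoord_absorbing ps.
- have [l pl] := pcoord_left_lim t0 pt; exists (e l).
  exact: (cvg_comp _ _ pl (continuous_amap ce (x := _))).
Qed.

Lemma pcoord_map_paths t p : pcoord t (map_paths p) = amap e (pcoord t p).
Proof. by rewrite pcoord_mkpath//; exact: is_path_map_paths. Qed.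

Lemma measurable_map_paths : measurable_fun setT map_paths.
Proof.
apply: measurable_fun_paths => t t0; under eq_fun do rewrite pcoord_map_paths.
exact: (measurableT_comp (measurable_amap ce) (measurable_pcoord t0)).
Qed.

Lemma map_paths_pshift r p : 0 <= r -> map_paths (pshift r p) = pshift r (map_paths p).
Proof.
move=> r0; apply: paths_inj => t.
by rewrite pcoord_map_paths !pcoord_shift// pcoord_map_paths.
Qed.

End path_mapping.

Section path_scale.
Context {R : realType} {E : topologicalType} (k : R).
Hypothesis k0 : 0 < k.

Lemma is_path_pscale (p : paths R E) : is_path (fun t => pcoord (k * t) p).
Proof.
split=> [t t0|s t s0 st|t t0 pt].
- move=> A /(pcoord_cvg (mulr_ge0 (ltW k0) t0))/near_at_rightP[e e0 h].
  apply/near_at_rightP; exists (e / k); first exact: divr_gt0.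
  move=> y ty; rewrite -ltrBlDl ltr_pdivlMr// => ye; apply: h.
    by rewrite ltr_pM2l.
  by rewrite -ltrBlDl -mulrBr mulrC.
- by apply: pcoord_absorbing; [exact: mulr_ge0 (ltW k0) s0|rewrite ler_pM2l].
- have [l pl] := pcoord_left_lim (mulr_gt0 k0 t0) pt; exists l.
  move=> A /pl/near_at_leftP[e e0 h].
  apply/near_at_leftP; exists (e / k); first exact: divr_gt0.
  move=> y; rewrite ltrBlDl -ltrBlDr ltr_pdivlMr// => ye yt; apply: h.
    by rewrite ltrBlDl -ltrBlDr -mulrBr mulrC.
  by rewrite ltr_pM2l.
Qed.

Definition pscale (p : paths R E) : paths R E := mkpath (fun t => pcoord (k * t) p).

Lemma pcoord_pscale t p : pcoord t (pscale p) = pcoord (k * t) p.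
Proof. by rewrite pcoord_mkpath//; exact: is_path_pscale. Qed.

End path_scale.

Lemma measurable_set1_absorbed {E : topologicalType} (x : absorbed E) :
  hausdorff_space E -> measurable [set x].
Proof.
move=> hE; case: x => [x|]; last exact: measurable_None.
apply: measurable_absorbedP; rewrite (_ : _ @^-1` _ = [set x]).
  rewrite -(setCK [set x]) -setTD; apply: sigma_algebraCD.
  apply: sub_sigma_algebra; rewrite openC.
  exact: (accessible_closed_set1 (hausdorff_accessible hE)).
by apply/seteqP; split=> y /= [->].
Qed.

(** The value [0] at [None] encodes the restriction to survival in the additive property. *)
Definition lift_fun {E : Type} {R : realType} (f : E -> \bar R) (x : absorbed E) : \bar R :=
  if x is Some p then f p else 0%E.

Lemma lift_fun_ge0 {E : Type} {R : realType} (f : E -> \bar R) x :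
  (forall p, 0 <= f p)%E -> (0 <= lift_fun f x)%E.
Proof. by case: x => /=. Qed.

Lemma measurable_lift_fun {E : topologicalType} {R : realType} (f : E -> \bar R) :
  (forall C : set (\bar R), measurable C -> <<s (@open E) >> (f @^-1` C)) ->
  measurable_fun setT (lift_fun f).
Proof.
move=> mf _ C mC; rewrite setTI; apply: measurable_absorbedP.
exact: mf.
Qed.

Section start.
Context {R : realType} {E : topologicalType}.
Context {disp : measure_display} {Omega : measurableType disp}.
Variables (P : absorbed E -> probability Omega R) (F : R -> set (set Omega)).
Variable Z : R -> Omega -> absorbed E.
Hypothesis H : markov_process P F Z.
Local Open Scope ereal_scope.

Lemma start_event x : F 0%R [set w | Z 0%R w = x].
Proof. exact: (mp_adapted H (lexx 0%R) (measurable_set1_absorbed x (mp_hausdorff H))). Qed.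

Lemma measurable_start x : measurable [set w | Z 0%R w = x].
Proof. exact: (filtration_sub (mp_filtration H) (lexx 0%R) (start_event x)). Qed.

Lemma integral_start x (f : Omega -> \bar R) : measurable_fun setT f ->
  (forall w, 0 <= f w) ->
  \int[P x]_w f w = \int[P x]_(w in [set w | Z 0%R w = x]) f w.
Proof.
move=> mf f0; set D := [set w | _]; have mD : measurable D := measurable_start x.
rewrite -(setUv D) ge0_integral_setU//.
- rewrite [X in _ + X]null_set_integral ?adde0//.
  + exact: measurableC.
  + exact: measurable_funS mf.
  + by have := probability_setC (P x) mD; rewrite (mp_start H) subee.
- exact: measurableC.
- exact: measurable_funS mf.
- by apply/disj_setPCl.
Qed.

Lemma integral_start_cst x (c : \bar R) :
  \int[P x]_(w in [set w | Z 0%R w = x]) c = c.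
Proof.
rewrite integral_cst; last exact: measurable_start.
transitivity (c * 1); last by rewrite mule1.
by congr (_ * _); exact: (mp_start H).
Qed.

Lemma process_dead (k : absorbed E -> \bar R) s : (0 <= s)%R ->
  measurable_fun setT k -> (forall x, 0 <= k x) ->
  \int[P None]_w k (Z s w) = k None.
Proof.
move=> s0 mk k0; rewrite integral_start//; last first.
  exact: (measurableT_comp mk (measurable_process H s0)).
rewrite -[RHS](integral_start_cst None); apply: eq_integral => w; rewrite inE /= => Z0.
rewrite -(pcoord_pathof H s w).
by rewrite (pcoord_absorbing (lexx 0%R) s0)// (pcoord_pathof H).
Qed.

End start.

(** * Additivity and invariance under level shifts *)

Section level_invariance.
Context {R : realType} {d : nat} {S : set 'rV[R]_d}.
Context {disp : measure_display} {Omega : measurableType disp}.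
Local Notation E := (S * R)%type.
Variables (P : absorbed E -> probability Omega R) (F : R -> set (set Omega)).
Variable Z : R -> Omega -> absorbed E.
Hypothesis H : markov_process P F Z.
Local Notation shift c := (amap (@level_shift R d S c)).
Local Open Scope ereal_scope.

Let FF := mp_filtration H.
Let hausE := mp_hausdorff H.
Let lcE := mp_locally_compact H.
Let scE := mp_second_countable H.

(** Invariance of the transition function, at a single time. The test functions [k] may be nonzero
    at [None], so equality of survival probabilities is included. *)
Definition level_invariant : Prop := forall c (q : E) s (k : absorbed E -> \bar R),
  (0 <= s)%R -> measurable_fun setT k -> (forall x, 0 <= k x) ->
  \int[P (Some (level_shift c q))]_w k (Z s w) =
  \int[P (Some q)]_w k (shift c (Z s w)).

Let mshift c : measurable_fun setT (shift c : absorbed E -> absorbed E).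
Proof. by apply: measurable_amap; exact: continuous_level_shift. Qed.

(** The additive property at [t = 0], integrated over the event that [Z 0] is [(y, z)], which has
    full probability and on which the subtracted level is the constant [z]. *)
Lemma additive_one_dim (y : S) (z : R) s (f : E -> \bar R) :
  additive_property P F Z -> (0 <= s)%R -> (forall p, 0 <= f p) ->
  (forall C : set (\bar R), measurable C -> <<s (@open E) >> (f @^-1` C)) ->
  \int[P (Some (y, 0%R))]_w lift_fun f (Z s w) =
  \int[P (Some (y, z))]_w lift_fun f (shift (- z) (Z s w)).
Proof.
move=> addP s0 f0 mf; set I := LHS.
have [_ /(_ _ (start_event H (Some (y, z)))) h] := addP y z s 0%R f s0 (lexx 0%R) f0 mf.
have ml := measurable_lift_fun mf.
rewrite (integral_start H); last 2 first.
- apply: (measurableT_comp ml).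
  exact: (measurableT_comp (mshift (- z)) (measurable_process H s0)).
- by move=> w; exact: lift_fun_ge0.
rewrite -[LHS](integral_start_cst H (Some (y, z))).
transitivity (\int[P (Some (y, z))]_(w in [set w | Z 0%R w = Some (y, z)])
  (match Z (0 + s)%R w, Z 0%R w with
         | Some (y2, z2), Some (_, z1) => f (y2, (z2 - z1)%R)
         | _, _ => 0
         end)).
  by rewrite -h; apply: eq_integral => w; rewrite inE /= => ->.
apply: eq_integral => w; rewrite inE /= => ->; rewrite add0r.
by case: (Z s w) => [[y2 z2]|].
Qed.

(** The starting points [(y, z + c)] and [(y, z)] are both compared with [(y, 0)]. The additive
    property only tests functions extended by [0] at [None]; the mass at [None] is recovered as the
    complement of the survival probability ([deadE]). *)
Lemma level_invariant_of_additive : additive_property P F Z -> level_invariant.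
Proof.
move=> addP c [y z] s k s0 mk k0.
have mkS (e : absorbed E -> \bar R) : measurable_fun setT e ->
    forall C : set (\bar R), measurable C -> <<s (@open E) >> ((e \o Some) @^-1` C).
  move=> me C mC; rewrite comp_preimage; apply: measurable_Some.
  by rewrite -[X in measurable X]setTI; exact: me.
have one (e : absorbed E -> \bar R) : measurable_fun setT e -> (forall x, 0 <= e x) ->
    \int[P (Some (y, (z + c)%R))]_w lift_fun (e \o Some) (Z s w) =
    \int[P (Some (y, z))]_w lift_fun (e \o Some) (shift c (Z s w)).
  move=> me e0.
  (* The shift by [z + c] cancels the [- (z + c)] coming from the first starting point and leaves
     [c] after the [- z] coming from the second. *)
  have me' : measurable_fun setT (e \o shift (z + c)) by exact: measurableT_comp.
  transitivity (\int[P (Some (y, 0%R))]_w lift_fun (e \o shift (z + c) \o Some) (Z s w)).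
    rewrite (@additive_one_dim y (z + c)%R s _ addP s0 _ (mkS _ me'))//; last first.
      by move=> p /=; exact: e0.
    apply: eq_integral => w _; case: (Z s w) => [p|] //=.
    by rewrite /= level_shiftD addNr level_shift0.
  rewrite (@additive_one_dim y z s _ addP s0 _ (mkS _ me'))//; last first.
    by move=> p /=; exact: e0.
  apply: eq_integral => w _; case: (Z s w) => [p|] //=.
  by rewrite /= level_shiftD addKr.
have mZ := measurable_process H s0.
pose Dead := [set w | Z s w = None].
have mDead : measurable Dead.
  by rewrite -[X in measurable X]setTI; exact: (measurable_process H s0 measurableT measurable_None).
have deadE q : P q Dead = 1 - \int[P q]_w lift_fun (cst 1 \o Some) (Z s w).
  rewrite -[X in P q X]setCK probability_setC; last exact: measurableC.
  congr (1 - _); transitivity (\int[P q]_w (\1_(~` Dead) w)%:E).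
    by rewrite integral_indic ?setIT//; exact: measurableC.
  apply: eq_integral => w _; rewrite indicE /Dead.
  case Zw : (Z s w) => [p|] /=.
    by rewrite mem_set//= Zw.
  by rewrite memNset//=; apply.
have split q (e : absorbed E -> \bar R) : measurable_fun setT e -> (forall x, 0 <= e x) ->
    \int[P q]_w e (Z s w) =
    \int[P q]_w lift_fun (e \o Some) (Z s w) + e None * P q Dead.
  move=> me e0; have -> : e None * P q Dead = \int[P q]_w (e None * (\1_Dead w)%:E).
    by rewrite ge0_integralZl//; [rewrite integral_indic ?setIT|exact/measurable_EFinP].
  rewrite -ge0_integralD//.
  - apply: eq_integral => w _; rewrite indicE; case Zw : (Z s w) => [p|] /=.
      by rewrite memNset ?mule0 ?adde0// /Dead /= Zw.
    by rewrite mem_set// mule1 add0e.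
  - by move=> w _; apply: lift_fun_ge0 => p /=; exact: e0.
  - exact: (measurableT_comp (measurable_lift_fun (mkS e me)) mZ).
  - by move=> w _; rewrite mule_ge0// lee_fin.
  - by apply: measurable_funeM; exact/measurable_EFinP.
have mks : measurable_fun setT (k \o shift c) by exact: (measurableT_comp mk (mshift c)).
rewrite (split _ k mk k0) [RHS](split _ (k \o shift c) mks (fun x => k0 _)).
congr (_ + _).
  rewrite one//; apply: eq_integral => w _.
  by case: (Z s w).
congr (_ * _); rewrite !deadE one//; congr (1 - _).
by apply: eq_integral => w _; case: (Z s w).
Qed.

Hypothesis inv : level_invariant.

Lemma level_invariantT c (x : absorbed E) s (k : absorbed E -> \bar R) :
  (0 <= s)%R -> measurable_fun setT k -> (forall x, 0 <= k x) ->
  \int[P (shift c x)]_w k (Z s w) = \int[P x]_w k (shift c (Z s w)).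
Proof.
case: x => [q|] s0 mk k0; first exact: inv.
by rewrite !(process_dead H (k := fun x => k (shift c x)))// ?(process_dead H)//;
  exact: measurableT_comp.
Qed.

Let pms c : measurable_fun setT (@map_paths R _ _ (@level_shift R d S c)).
Proof. by apply: measurable_map_paths; exact: continuous_level_shift. Qed.

(** The Markov property at time [r] leaves a function of the position at [r]; invariance moves the
    shift from the starting point to that position; the induction hypothesis carries it through the
    remaining cylinder; the Markov property is then read backwards. *)
Lemma pathof_level_shift_cyl c l : cyl_ok l -> forall x,
  P (shift c x) (pathof Z @^-1` cyl l) =
  P x (pathof Z @^-1` (map_paths (level_shift c) @^-1` cyl l)).
Proof.
elim: l => [_ x|[r B] l IH [r0 mB okl] x] /=; first by rewrite !probability_setT.
have {}IH := IH okl.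
pose L y := P y (pathof Z @^-1` cyl l).
have mL : measurable_fun setT L by exact: (measurable_law H (measurable_cyl okl)).
pose k v := (\1_B v)%:E * L v.
have k0 v : 0 <= k v by rewrite mule_ge0// lee_fin.
have mk : measurable_fun setT k.
  by apply: emeasurable_funM => //; apply/measurable_EFinP; exact: measurable_indic.
have sT := stopping_time_cst FF r0.
have AT (A : set Omega) : A `<=` [set w | (r%:E : \bar R) < +oo].
  by move=> w _ /=; rewrite ltry.
transitivity (\int[P (shift c x)]_w k (Z r w)).
  have FA : stopped_sigma F (fun=> r%:E) (Z r @^-1` B).
    by apply/(stopped_sigma_cst FF) => //; exact: (mp_adapted H).
  have h := strong_markov_event H (shift c x) (measurable_cyl okl) sT FA (AT _).
  transitivity (\int[P (shift c x)]_(w in Z r @^-1` B) L (Z r w)).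
    rewrite -[RHS]h; congr (P _ _); apply/seteqP; split=> w /=;
      by rewrite (pcoord_pathof H).
  rewrite integral_mkcond; apply: eq_integral => w _; rewrite patchE /k indicE.
  have -> : (w \in Z r @^-1` B) = (Z r w \in B) by apply/idP/idP; rewrite !inE.
  by case: ifPn => _; rewrite ?mul1e ?mul0e.
rewrite level_invariantT//.
pose B' := shift c @^-1` B.
have mB' : measurable B' by rewrite -[X in measurable X]setTI; exact: mshift.
pose C' := map_paths (level_shift c) @^-1` cyl l.
have mC' : measurable C'.
  by rewrite -[X in measurable X]setTI; apply: pms => //; exact: measurable_cyl.
have FA : stopped_sigma F (fun=> r%:E) (Z r @^-1` B').
  by apply/(stopped_sigma_cst FF) => //; exact: (mp_adapted H).
have h := strong_markov_event H x mC' sT FA (AT _).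
transitivity (\int[P x]_(w in Z r @^-1` B') P (Z r w) (pathof Z @^-1` C')).
  rewrite [RHS]integral_mkcond; apply: eq_integral => w _; rewrite patchE /k indicE.
  have -> : (w \in Z r @^-1` B') = (shift c (Z r w) \in B).
    by apply/idP/idP; rewrite !inE.
  by case: ifPn => _; rewrite ?mul1e ?mul0e// /L IH.
rewrite -[LHS]h; congr (P _ _).
have cs : continuous (@level_shift R d S c) by exact: continuous_level_shift.
apply/seteqP; split=> w /= [h1 h2]; split.
- by rewrite (pcoord_map_paths cs) (pcoord_pathof H).
- by rewrite -(map_paths_pshift cs).
- by move: h1; rewrite (pcoord_map_paths cs) (pcoord_pathof H).
- by rewrite /C' /= (map_paths_pshift cs).
Qed.

Lemma pathof_level_shift c x (C : set (paths R E)) : measurable C ->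
  P (shift c x) (pathof Z @^-1` C) =
  P x (pathof Z @^-1` (map_paths (level_shift c) @^-1` C)).
Proof.
have mZ := measurable_pathof H.
have mZ' : measurable_fun setT (map_paths (@level_shift R d S c) \o pathof Z).
  exact: (measurableT_comp (pms c) mZ).
apply: (@measure_unique _ R (paths R E)
  [set C | exists2 l, cyl_ok l & C = cyl l] (fun=> setT) _ _ _ _
  (image_measure (P (shift c x)) mZ) (image_measure (P x) mZ')).
- exact: measurable_pathsE.
- move=> _ _ [l1 ok1 ->] [l2 ok2 ->]; have [l okl <-] := cylI ok1 ok2.
  by exists l.
- by move=> _; exists [::].
- by rewrite bigcup_const.
- by move=> _ [l okl ->]; exact: pathof_level_shift_cyl.
- move=> _; change (P (shift c x) setT < +oo).
  by rewrite probability_setT ltry.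
Qed.

(** For the path shifted by [t] this is the pair [(theta_(t+s), xi_(t+s) - xi_t)] of the additive
    property. *)
Let eval_shift s (p : paths R E) : absorbed E :=
  shift (- level (pcoord 0%R p)) (pcoord s p).

(* The shift is by a random level: view it as a right continuous family of
   shifts evaluated at a random nonnegative time, once for each sign. *)
Let measurable_eval_shift s : (0 <= s)%R -> measurable_fun setT (eval_shift s).
Proof.
move=> s0.
have ml : measurable_fun setT (fun p : paths R E => level (pcoord 0%R p)).
  apply: (measurableT_comp _ (measurable_pcoord (lexx 0%R))).
  by apply: continuous_measurable_absorbed; exact: continuous_level.
have rc (b : R) (x : absorbed E) u : shift (b * s) x @[s --> u^'+] --> shift (b * u) x.
  apply: cvg_at_right_filter; case: x => [p|]; last exact: cvg_cst.
  have cm : continuous (fun v : R => (b * v)%R).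
    by move=> v; apply: cvgM; [exact: cvg_cst|exact: cvg_id].
  have c1 : continuous (fun v : R => ((b * v)%R, p)).
    by apply: continuous_pair => // v; exact: cvg_cst.
  have c2 := @continuous_level_shift2 R d S.
  have c12 : continuous (fun v : R => level_shift (b * v) p).
    by move=> v; apply: (@continuous_comp _ _ _ (fun v : R => ((b * v)%R, p))
      (fun cp : R * E => level_shift cp.1 cp.2)); [exact: c1|exact: c2].
  by move=> A /nbhs_SomeE hA; exact: (c12 u _ hA).
pose V1 u (p : paths R E) := shift (-1 * u) (pcoord s p).
pose S1 (p : paths R E) := Num.max (level (pcoord 0%R p)) 0%R.
pose S2 (p : paths R E) : R := Num.max (- level (pcoord 0%R p) : R)%R 0%R.
have mS1 : measurable_fun setT S1.
  exact: (measurable_maxr ml (@measurable_cst _ _ _ _ _ _)).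
have mS2 : measurable_fun setT S2.
  by apply: measurable_maxr => //; exact: measurableT_comp.
have m1 : measurable_fun setT (fun p => V1 (S1 p) p).
  apply: (measurable_fun_right_continuous_time hausE lcE scE) => //.
  - by move=> u _; exact: (measurableT_comp (mshift _) (measurable_pcoord s0)).
  - by move=> u p _; exact: rc.
  - by move=> p; rewrite le_max lexx orbT.
pose V2 u p := shift (1 * u) (V1 (S1 p) p).
have m2 : measurable_fun setT (fun p => V2 (S2 p) p).
  apply: (measurable_fun_right_continuous_time hausE lcE scE) => //.
  - by move=> u _; exact: (measurableT_comp (mshift _) m1).
  - by move=> u p _; exact: rc.
  - by move=> p; rewrite le_max lexx orbT.
rewrite (_ : eval_shift s = fun p => V2 (S2 p) p)//.
apply/funext => p; rewrite /eval_shift /V2 /V1 /S2 /S1.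
case: (pcoord s p) => [q|] //=; rewrite /amap /= level_shiftD; congr (Some (level_shift _ _)).
set l := level _; rewrite mulN1r mul1r; have [l0|l0] := leP 0%R l.
  have e2 : Num.max (- l)%R 0%R = 0%R by rewrite max_r// oppr_le0.
  by rewrite [X in (_ + X)%R]e2 addr0.
have e2 : Num.max (- l)%R 0%R = (- l)%R by rewrite max_l// oppr_ge0 ltW.
by rewrite [X in (_ + X)%R]e2 oppr0 add0r.
Qed.

(** The Markov property at the constant time [t], for the path functional [Hf] that applies [f] to
    the increment. Its mean from [(y1, z1)] is, by invariance under the shift by [- z1], the mean of
    [f] from [(y1, 0)]. *)
Lemma additive_of_level_invariant : additive_property P F Z.
Proof.
move=> y z s t f s0 t0 f0 mf.
have ml := measurable_lift_fun mf.
pose base (p : E) : E := (p.1, 0%R).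
have cbase : continuous base.
  apply: continuous_pair => p; first exact: cvg_fst.
  exact: cvg_cst.
pose kap (x : absorbed E) := if x is Some p
  then \int[P (Some (p.1, 0%R))]_w lift_fun f (Z s w) else 0.
have mI : measurable_fun setT (fun x => \int[P x]_w lift_fun f (Z s w)).
  by apply: (measurable_integral_process H) => // x; exact: lift_fun_ge0.
(* [kap] agrees with [base_int] on [E], which is enough because measurability on [absorbed E] is
   decided by traces on [E]. *)
have mkap : measurable_fun setT kap.
  pose base_int x := \int[P (amap base x)]_w lift_fun f (Z s w).
  have mb : measurable_fun setT base_int.
    exact: (measurableT_comp mI (measurable_amap cbase)).
  move=> _ C mC; rewrite setTI.
  have mbC : measurable (base_int @^-1` C) by rewrite -[X in measurable X]setTI; exact: mb.
  apply: measurable_absorbedP.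
  exact: (measurable_Some mbC).
pose Hf p := lift_fun f (eval_shift s p).
have mHf : measurable_fun setT Hf.
  exact: (measurableT_comp ml (measurable_eval_shift s0)).
have Hf0 p : 0 <= Hf p by exact: lift_fun_ge0.
have kapE x : \int[P x]_w Hf (pathof Z w) = kap x.
  have mHfZ : measurable_fun setT (fun w => Hf (pathof Z w)).
    exact: (measurableT_comp mHf (measurable_pathof H)).
  case: x => [[y1 z1]|]; last first.
    rewrite (integral_start H)// -[RHS](integral_start_cst H None).
    apply: eq_integral => w; rewrite inE /= => Z0; rewrite /Hf /eval_shift.
    rewrite (pcoord_absorbing (lexx 0%R) s0)//.
    by rewrite (pcoord_pathof H).
  have mg : measurable_fun setT (fun w => lift_fun f (shift (- z1) (Z s w))).
    apply: (measurableT_comp ml).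
    exact: (measurableT_comp (mshift _) (measurable_process H s0)).
  transitivity (\int[P (Some (y1, z1))]_w lift_fun f (shift (- z1) (Z s w))).
    rewrite (integral_start H)// [RHS](integral_start H)//; last first.
      by move=> w; exact: lift_fun_ge0.
    apply: eq_integral => w; rewrite inE /= => Z0.
    by rewrite /Hf /eval_shift !(pcoord_pathof H) Z0.
  rewrite -(inv (- z1)%R (y1, z1) s0 ml)//; last by move=> x; exact: lift_fun_ge0.
  by rewrite /level_shift /= subrr.
have kE : (fun w => match Z t w with
         | Some (y1, _) => (\int[P (Some (y1, 0%R))]_w'
             (if Z s w' is Some p then f p else 0))
         | None => 0
         end) = kap \o Z t.
  by apply/funext => w /=; case: (Z t w) => [[y1 z1]|].
rewrite kE; split=> [C mC|A FA].
  rewrite comp_preimage; apply: (mp_adapted H) => //.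
  by rewrite -[X in measurable X]setTI; exact: mkap.
have sT := stopping_time_cst FF t0.
have FA' : stopped_sigma F (fun=> t%:E) A by exact/(stopped_sigma_cst FF).
have := @strong_markov_functional _ _ _ _ _ _ _ H Hf (Some (y, z)) _ A mHf Hf0 sT FA'.
move=> /(_ _) h; transitivity (\int[P (Some (y, z))]_(w in A)
    \int[P (Z t w)]_w' Hf (pathof Z w')).
  by apply: eq_integral => w _; rewrite kapE.
rewrite -[LHS]h; last by move=> w _ /=; rewrite ltry.
apply: eq_integral => w _ /=; rewrite /Hf /eval_shift !pcoord_shift// !(pcoord_pathof H).
rewrite addr0; case ZE : (Z (t + s)%R w) => [[y2 z2]|] //=.
case Z0 : (Z t w) => [[y1 z1]|] //=.
have := pcoord_absorbing (p := pathof Z w) t0 (_ : (t <= t + s)%R).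
by rewrite lerDl s0 !(pcoord_pathof H) Z0 ZE => /(_ isT erefl).
Qed.

End level_invariance.

(** * The two constructions *)

Section lamperti.
Context {R : realType} {d : nat} {S : set 'rV[R]_d}.
Hypothesis hS : S `<=` sphere.
Context {disp : measure_display} {Omega : measurableType disp}.
Local Notation E := (S * R)%type.
Local Notation shift c := (amap (@level_shift R d S c)).
Local Notation cop := (@cone_of_polar R d S).
Local Notation poc := (polar_of_cone hS).
Local Notation rate := (@exp_rate R d S).

Let copK : cancel cop poc := cone_of_polarK hS.
Let pocK : cancel poc cop := polar_of_coneK hS.
Let c_cop : continuous cop := @continuous_cone_of_polar R d S.
Let c_poc : continuous poc := @continuous_polar_of_cone R d S hS.

Lemma state_scale_Some a q : 0 < a ->
  state S (a *: \val (cop q)) = Some (cop (level_shift (ln a) q)).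
Proof. by move=> a0; exact: (state_scale hS (Some q) a0). Qed.

Lemma cone_of_level_shift (a : R) (x : cone S) : 0 < a ->
  exists q, Some x = amap cop (shift (ln a) (Some q)) /\
    state S (a^-1 *: \val x) = amap cop (Some q).
Proof.
move=> a0; have [q ->] := cone_polarP x.
exists (level_shift (- ln a) q); split.
  by rewrite /amap /= level_shiftD addNr level_shift0.
by rewrite state_scale_Some ?invr_gt0// lnV.
Qed.

Section direct.
Variables (alpha : R) (P : absorbed E -> probability Omega R)
  (F : R -> set (set Omega)) (Z : R -> Omega -> absorbed E).
Hypothesis HZ : MAP P F Z.
Let H := MAP_markov HZ.
Let gS := @exp_rate_gt0 R d S alpha.
Let gc := @continuous_exp_rate R d S alpha.

Lemma ssMp_of_MAPE :
  ssMp_of_MAP alpha Z = fun t w => amap cop (time_change (rate alpha) Z t w).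
Proof.
apply/funext => t; apply/funext => w; rewrite /ssMp_of_MAP /time_change.
by case: ifPn => // _; rewrite to_coneE.
Qed.

Lemma lifetime_ssMp_of_MAP w :
  lifetime (ssMp_of_MAP alpha Z) w = total_clock (rate alpha) Z w.
Proof. by rewrite ssMp_of_MAPE lifetime_amap (lifetime_time_change H). Qed.

Lemma markov_process_ssMp_of_MAP :
  markov_process (fun x => P (to_polar x)) (change_filtration F Z (rate alpha))
    (ssMp_of_MAP alpha Z).
Proof.
rewrite ssMp_of_MAPE (_ : (fun x => P (to_polar x)) = fun x => P (amap poc x)).
  exact: (markov_process_amap (markov_process_time_change H erefl gS gc) copK pocK c_cop c_poc).
by apply/funext => x; rewrite (to_polarE hS).
Qed.

(** In polar coordinates [x] is the shift by [ln a] of [q], the point of [x / a].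
    [pathof_level_shift] moves this shift from the starting point to the path, where it commutes
    with the time change up to the speed [(expR (alpha * ln a))^-1], which is [a] to the power
    [- alpha]. *)
Lemma scaling_ssMp_of_MAP (a : R) (x : cone S) : 0 < a ->
  same_law (P (to_polar (Some x))) (ssMp_of_MAP alpha Z)
    (P (to_polar (state S (a^-1 *: \val x))))
    (fun t w => state S (a *: vec (ssMp_of_MAP alpha Z (a `^ (- alpha) * t) w))).
Proof.
move=> a0 C pC; have [q [xE sE]] := cone_of_level_shift x a0.
rewrite xE sE !(to_polarE hS) !(amapK copK) ssMp_of_MAPE.
have hE := mp_hausdorff H; have lE := mp_locally_compact H.
have sE' := mp_second_countable H.
pose tc := time_change (rate alpha) (@pcoord R E).
have mtc t : 0 <= t -> measurable_fun setT (fun p => amap cop (tc t p)).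
  move=> t0; apply: (measurableT_comp (measurable_amap c_cop)).
  exact: (measurable_time_change hE lE sE' erefl gS gc t0).
pose D := [set p : paths R E | C (fun t => amap cop (tc t p))].
have mD : measurable D by exact: (measurable_path_sigma mtc pC).
have inv := level_invariant_of_additive H (MAP_additive HZ).
transitivity (P (shift (ln a) (Some q)) (pathof Z @^-1` D)).
  congr (P _ _); apply/seteqP; split=> w; rewrite /D /=;
  rewrite (_ : (fun t => amap cop (tc t (pathof Z w))) =
    (fun t => amap cop (time_change (rate alpha) Z t w)))//;
  by apply/funext => t; rewrite (time_change_pathof H).
rewrite (pathof_level_shift H inv _ _ mD); congr (P _ _).
have cs := @continuous_level_shift R d S (ln a).
suff eqC w : C (fun t => amap cop (tc t (map_paths (level_shift (ln a)) (pathof Z w)))) <->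
    C (fun t => state S (a *:
      vec (amap cop (time_change (rate alpha) Z (a `^ (- alpha) * t) w)))).
  by apply/seteqP; split=> w; [move/(eqC w)|move/(eqC w).2].
apply: path_sigma_eq_pos => // t t0; rewrite (state_scale hS)//.
congr (amap cop _); rewrite (time_change_pathof H).
have m0 : 0 < expR (alpha * ln a) by exact: expR_gt0.
rewrite /tc (@time_change_scale _ _ hE lE sE' (rate alpha) erefl gS gc (pathof Z w)
  (map_paths (level_shift (ln a)) (pathof Z w)) (level_shift (ln a)) 1 _ ltr01 m0)//.
- rewrite mul1r (_ : a `^ (- alpha) = (expR (alpha * ln a))^-1)//.
  by rewrite /powR gt_eqF// mulNr expRN.
- by move=> u u0; rewrite (pcoord_map_paths cs) mul1r.
- by move=> p; exact: exp_rate_shift.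
Qed.

End direct.

Section converse.
Variables (alpha : R) (P : absorbed (cone S) -> probability Omega R)
  (F : R -> set (set Omega)) (X : R -> Omega -> absorbed (cone S)).
Hypothesis HX : ssMp alpha P F X.
Let H := ssMp_markov HX.
Let gS := @exp_rate_gt0 R d S (- alpha).
Let gc := @continuous_exp_rate R d S (- alpha).
Let Q := fun q => P (amap cop q).
(** [X] in polar coordinates, before any time change. Coordinates are changed first and time second,
    the reverse of the direct part, so that both time changes take place on [S * R] with an
    exponential rate. *)
Let V := fun t w => amap poc (X t w).
Let W := time_change (rate (- alpha)) V.

Let HV : markov_process Q F V.
Proof. exact: (markov_process_amap H pocK copK c_poc c_cop). Qed.

Let HW : markov_process Q (change_filtration F V (rate (- alpha))) W.
Proof. exact: (markov_process_time_change HV erefl gS gc). Qed.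

Lemma total_clock_polar w :
  total_clock (norm_rate alpha) X w = total_clock (rate (- alpha)) V w.
Proof.
rewrite /total_clock /alive lifetime_amap; apply: eq_integral => u _.
by rewrite (norm_rateE hS).
Qed.

Lemma inverse_clock_polar t w :
  inverse_clock (norm_rate alpha) X t w = inverse_clock (rate (- alpha)) V t w.
Proof.
have cE s : clock (norm_rate alpha) X s w = clock (rate (- alpha)) V s w.
  by apply: eq_integral => u _; rewrite (norm_rateE hS).
by rewrite /inverse_clock; congr inf; apply/seteqP; split=> s /=; rewrite cE.
Qed.

Lemma MAP_of_ssMpE : MAP_of_ssMp alpha X = W.
Proof.
apply/funext => t; apply/funext => w; rewrite /MAP_of_ssMp /W /time_change.
rewrite total_clock_polar inverse_clock_polar.
by case: ifPn => // _; rewrite (to_polarE hS).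
Qed.

Lemma lifetime_MAP_of_ssMp w :
  lifetime (MAP_of_ssMp alpha X) w = total_clock (norm_rate alpha) X w.
Proof. by rewrite MAP_of_ssMpE (lifetime_time_change HV)// total_clock_polar. Qed.

Lemma pathof_polar w : map_paths poc (pathof X w) = pathof V w.
Proof.
apply: paths_inj => t.
by rewrite (pcoord_map_paths c_poc) (pcoord_pathof H) (pcoord_pathof HV).
Qed.

(** Self-similarity with [a = expR c] trades the shifted starting point for a path that is shifted
    and run at speed [kk]. The shift multiplies the rate by the same [kk], so the time change
    absorbs the speed and only the shift remains. *)
Lemma level_invariant_MAP_of_ssMp : level_invariant Q W.
Proof.
move=> c q s k s0 mk k0.
have hE := mp_hausdorff HV; have lE := mp_locally_compact HV.
have sE := mp_second_countable HV.
have cs := @continuous_level_shift R d S c.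
have a0 : 0 < expR c by exact: expR_gt0.
have mW := measurable_process HW s0.
have mW' : measurable_fun setT (fun w => shift c (W s w)).
  exact: (measurableT_comp (measurable_amap cs) mW).
rewrite -(ge0_integral_image_measure (Q (Some (level_shift c q))) mW mk k0).
rewrite -(ge0_integral_image_measure (Q (Some q)) mW' mk k0).
apply: eq_measure_integral => B mB _.
change (Q (Some (level_shift c q)) (W s @^-1` B) =
  Q (Some q) ((fun w => shift c (W s w)) @^-1` B)).
pose tc := time_change (rate (- alpha)) (@pcoord R E).
(* The event for [W] at time [s] is expressed through the whole trajectory of [X], the process that
   the scaling hypothesis is about. *)
pose D := [set p : paths R (cone S) | B (tc s (map_paths poc p))].
have mD : measurable D.
  rewrite -[X in measurable X]setTI.
  have mtc := measurable_time_change hE lE sE erefl gS gc s0.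
  exact: (measurableT_comp mtc (measurable_map_paths c_poc)).
have [C pC DC] := path_sigma_paths mD.
have scal := ssMp_scaling HX (cop (level_shift c q)) a0 pC.
have qE : state S ((expR c)^-1 *: \val (cop (level_shift c q))) = Some (cop q).
  rewrite state_scale_Some ?invr_gt0// lnV// expRK.
  by rewrite level_shiftD addrN level_shift0.
rewrite qE in scal.
transitivity (P (Some (cop (level_shift c q))) [set w | C (X ^~ w)]).
  congr (P _ _); apply/seteqP; split=> w /=;
    rewrite -(sval_mkpath (is_path_process H w)) -DC /D /= pathof_polar;
    by rewrite /W (time_change_pathof HV).
rewrite scal; congr (P _ _).
pose kk := expR c `^ (- alpha).
have kk0 : 0 < kk by exact: powR_gt0.
pose p2 w := map_paths cop (map_paths (level_shift c) (pscale kk (pathof V w))).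
have p2E w : (fun t => state S (expR c *: vec (X (kk * t) w))) = sval (p2 w).
  apply/funext => t; rewrite -[RHS]/(pcoord t (p2 w)).
  rewrite (pcoord_map_paths c_cop) (pcoord_map_paths cs) (pcoord_pscale kk0).
  rewrite (pcoord_pathof HV) -[c in RHS]expRK -(state_scale hS)//.
  by rewrite /V (amapK pocK).
suff eqD w : D (p2 w) <-> B (shift c (W s w)).
  by apply/seteqP; split=> w /=; rewrite p2E -DC; [move/(eqD w)|move/(eqD w).2].
rewrite /D /=.
have -> : map_paths poc (p2 w) = map_paths (level_shift c) (pscale kk (pathof V w)).
  apply: paths_inj => t; rewrite (pcoord_map_paths c_poc) /p2 (pcoord_map_paths c_cop).
  by rewrite (amapK copK).
rewrite /tc (@time_change_scale _ _ hE lE sE _ erefl gS gc (pathof V w)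
  (map_paths (level_shift c) (pscale kk (pathof V w))) (level_shift c) kk kk kk0 kk0)//.
- by rewrite divff ?gt_eqF// mul1r /W (time_change_pathof HV).
- by move=> u u0; rewrite (pcoord_map_paths cs) (pcoord_pscale kk0).
- by move=> p; rewrite exp_rate_shift /kk /powR gt_eqF// expRK.
Qed.

Lemma MAP_MAP_of_ssMp : exists G : R -> set (set Omega),
  MAP (fun p => P (to_cone p)) G (MAP_of_ssMp alpha X).
Proof.
exists (change_filtration F V (rate (- alpha))).
rewrite MAP_of_ssMpE (_ : (fun p => P (to_cone p)) = Q); last first.
  by apply/funext => p; rewrite to_coneE.
split; first exact: HW.
exact: (additive_of_level_invariant HW level_invariant_MAP_of_ssMp).
Qed.

End converse.

End lamperti.

Theorem theorem1 (R : realType) (d : nat) (hd : (1 <= d)%N)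
    (S : set 'rV[R]_d) (hS : S `<=` sphere) (hSlc : locally_compact [set: S])
    (alpha : R) (halpha : 0 <= alpha)
    (disp : measure_display) (Omega : measurableType disp) :
  (forall (P : absorbed (S * R)%type -> probability Omega R)
      (F : R -> set (set Omega)) (Z : R -> Omega -> absorbed (S * R)%type),
    MAP P F Z ->
    (exists G : R -> set (set Omega),
       ssMp alpha (fun x => P (to_polar x)) G (ssMp_of_MAP alpha Z)) /\
    (forall w, lifetime (ssMp_of_MAP alpha Z) w =
               total_clock (exp_rate alpha) Z w)) /\
  (forall (P : absorbed (cone S) -> probability Omega R)
      (F : R -> set (set Omega)) (X : R -> Omega -> absorbed (cone S)),
    ssMp alpha P F X ->
    (exists G : R -> set (set Omega),
       MAP (fun p => P (to_cone p)) G (MAP_of_ssMp alpha X)) /\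
    (forall w, lifetime (MAP_of_ssMp alpha X) w =
               total_clock (norm_rate alpha) X w)).
Proof.
split=> [P F Z HZ|P F X HX]; split.
- exists (change_filtration F Z (exp_rate alpha)); split.
    exact: (markov_process_ssMp_of_MAP hS _ HZ).
  by move=> a x a0; exact: (scaling_ssMp_of_MAP hS _ HZ x a0).
- by move=> w; exact: (lifetime_ssMp_of_MAP _ HZ).
- exact: (MAP_MAP_of_ssMp hS HX).
- by move=> w; exact: (lifetime_MAP_of_ssMp hS HX).
Qed.
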